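(* Let $\Omega=\mathbb{T}^3$ or $\Omega=\mathbb{R}^3$ and $-3<\gamma\le 1$. Let $\beta>\max\{3,3+\gamma\}$ and $\bar M\ge 1$ be given. Then there is a small constant $\varepsilon_0>0$, depending on $\gamma,\beta,\bar M$, such that the following holds. Suppose $F_0(x,v)=\mu(v)+\sqrt{\mu(v)}\,f_0(x,v)\ge 0$, $\|w_\beta f_0\|_{L^\infty}\le \bar M$, and $\mathcal{E}(F_0)+\|f_0\|_{L^1_xL^\infty_v}\le \varepsilon_0$. Let $F(t,x,v)=\mu(v)+\sqrt{\mu(v)}f(t,x,v)\ge0$ be the global unique mild solution of the Boltzmann equation $F_t+v\cdot\nabla_xF=Q(F,F)$, $F|_{t=0}=F_0$ (which exists, satisfies the conservation laws of defect mass, momentum and energy and the defect entropy inequality stated in the context, and satisfies $\|w_\beta f(t)\|_{L^\infty}\le\tilde C_1\bar M^2$ for all $t\ge0$ with $\tilde C_1$ depending only on $\gamma,\beta$). Then there exists a positive time $T_0>0$ such that the density $\rho(t,x)=\int_{\mathbb{R}^3}F(t,x,v)\,dv$ satisfies $$|\rho(t,x)-1|=\Big|\int_{\mathbb{R}^3}[F(t,x,v)-\mu(v)]\,dv\Big|\le \frac34$$ for all $t\ge T_0$ and $x\in\Omega$.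
   Context: Here $\mathbb{T}^3=(\mathbb{R}/2\pi\mathbb{Z})^3$, $x\in\Omega$, $v\in\mathbb{R}^3$. Collision operator: $Q(F_1,F_2)=Q_+(F_1,F_2)-Q_-(F_1,F_2)$ with $Q_+(F_1,F_2)(v)=\int_{\mathbb{R}^3}\int_{\mathbb{S}^2}B(v-u,\theta)F_1(u')F_2(v')\,d\omega\,du$, $Q_-(F_1,F_2)(v)=\int_{\mathbb{R}^3}\int_{\mathbb{S}^2}B(v-u,\theta)F_1(u)F_2(v)\,d\omega\,du$, where $u'=u+[(v-u)\cdot\omega]\omega$, $v'=v-[(v-u)\cdot\omega]\omega$, $\cos\theta=(v-u)\cdot\omega/|v-u|$. The kernel is fixed: $B(v-u,\theta)=|v-u|^\gamma b(\theta)$ with $-3<\gamma\le1$, $0\le b(\theta)\le C|\cos\theta|$ for a constant $C>0$, and $b$ not a.e. zero. Constants may always depend on the fixed function $b$. $\mu(v)=(2\pi)^{-3/2}e^{-|v|^2/2}$; $w_\beta(v)=(1+|v|^2)^{\beta/2}$; $f=(F-\mu)/\sqrt\mu$. $\|\cdot\|_{L^\infty}$ is the $L^\infty(\Omega\times\mathbb{R}^3_v)$ norm (pointwise statements are understood up to null sets when $f$ is only measurable); $\|f_0\|_{L^1_xL^\infty_v}=\int_\Omega \|f_0(x,\cdot)\|_{L^\infty_v}\,dx$. Defect quantities: $M_0=\int_\Omega\int_{\mathbb{R}^3}(F_0-\mu)\,dv\,dx$, $J_0=\int_\Omega\int_{\mathbb{R}^3}v(F_0-\mu)\,dv\,dx$,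 $E_0=\int_\Omega\int_{\mathbb{R}^3}|v|^2(F_0-\mu)\,dv\,dx$, and $\mathcal{E}(F_0)=\int_\Omega\int_{\mathbb{R}^3}\{F_0\ln F_0-\mu\ln\mu\}\,dv\,dx+[\tfrac32\ln(2\pi)-1]M_0+\tfrac12E_0$ (which is $\ge0$). Conservation laws: for all $t$, $\int_\Omega\int(F(t)-\mu)\,dv\,dx=M_0$, $\int_\Omega\int v(F(t)-\mu)\,dv\,dx=J_0$, $\int_\Omega\int|v|^2(F(t)-\mu)\,dv\,dx=E_0$. Defect entropy inequality: $\int_\Omega\int\{F(t)\ln F(t)-\mu\ln\mu\}\,dv\,dx\le\int_\Omega\int\{F_0\ln F_0-\mu\ln\mu\}\,dv\,dx$. Mild solution: $f$ satisfies, for $t\ge0$, $f(t,x,v)=e^{-\nu(v)t}f_0(x-vt,v)+\int_0^te^{-\nu(v)(t-s)}(Kf)(s,x-v(t-s),v)\,ds+\int_0^te^{-\nu(v)(t-s)}\Gamma(f,f)(s,x-v(t-s),v)\,ds$, where $\nu(v)=\int\int B(v-u,\theta)\mu(u)\,d\omega\,du\sim(1+|v|)^\gamma$, $K=K_2-K_1$, $(K_1f)(v)=\int\int B(v-u,\theta)\sqrt{\mu(v)\mu(u)}f(u)\,d\omega\,du$, $(K_2f)(v)=\int\int B(v-u,\theta)\sqrt{\mu(u)\mu(u')}f(v')\,d\omega\,du+\int\int B(v-u,\theta)\sqrt{\mu(u)\mu(v')}f(u')\,d\omega\,du$, $\Gamma(f,f)=\mu^{-1/2}Q(\sqrt\mu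 f,\sqrt\mu f)$ (integrals over $\mathbb{R}^3\times\mathbb{S}^2$). Uniqueness is within mild solutions for which $\|w_\beta f(t)\|_{L^\infty}$ is bounded on bounded time intervals. *)

(* Defs.v *)
From HB Require Import structures.
From mathcomp Require Import all_boot all_order all_algebra.
From mathcomp Require Import all_classical all_reals all_analysis.

Set Implicit Arguments.
Unset Strict Implicit.
Unset Printing Implicit Defensive.

Import Order.TTheory GRing.Theory Num.Theory.
Import numFieldNormedType.Exports.

Local Open Scope classical_set_scope.
Local Open Scope ring_scope.

(* The triple product ((x1, x2), x3), with its product sigma-algebra. *)
Notation R3 R :=
  (measurableTypeR R * measurableTypeR R * measurableTypeR R)%type.

Lemma product_sigma_finite d1 d2 (T1 : measurableType d1)
    (T2 : measurableType d2) (R : realType)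
    (m1 : {sigma_finite_measure set T1 -> \bar R})
    (m2 : {sigma_finite_measure set T2 -> \bar R}) :
  sigma_finite setT (m1 \x m2)%E.
Proof.
have /sigma_finiteP[F [TF ndF Foo]] := sigma_finiteT m1.
have /sigma_finiteP[G [TG ndG Goo]] := sigma_finiteT m2.
exists (fun n => F n `*` G n) => [|k].
  rewrite -setXTT TF TG predeqE => -[x y]; split.
    move=> [/= [n _ Fnx] [k _ Gky]]; exists (maxn n k) => //; split.
      by move: x Fnx; exact/subsetPset/ndF/leq_maxl.
    by move: y Gky; exact/subsetPset/ndG/leq_maxr.
  by move=> [n _ []/= ? ?]; split; exists n.
have [? ?] := Foo k; have [? ?] := Goo k.
split; first exact: measurableX.
by rewrite product_measure1E// lte_mul_pinfty// ge0_fin_numE.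
Qed.

Section Space.
Context {R : realType}.

(* Lebesgue measure on R^2, R^3 and R^3 x R^3. They are named constants because
   canonical structure inference on a bare product \x only finds its
   sigma-finite structure for subprobabilities. *)
Definition leb2 : set (measurableTypeR R * measurableTypeR R) -> \bar R :=
  (@lebesgue_measure R \x @lebesgue_measure R)%E.
HB.instance Definition _ := Measure.on leb2.
HB.instance Definition _ := Measure_isSigmaFinite.Build _ _ _ leb2
  (product_sigma_finite (@lebesgue_measure R) (@lebesgue_measure R)).

Definition leb3 : set (R3 R) -> \bar R := (leb2 \x @lebesgue_measure R)%E.
HB.instance Definition _ := Measure.on leb3.
HB.instance Definition _ := Measure_isSigmaFinite.Build _ _ _ leb3
  (product_sigma_finite leb2 (@lebesgue_measure R)).

Definition leb6 : set (R3 R * R3 R) -> \bar R := (leb3 \x leb3)%E.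
HB.instance Definition _ := Measure.on leb6.
HB.instance Definition _ := Measure_isSigmaFinite.Build _ _ _ leb6
  (product_sigma_finite leb3 leb3).

Definition smul (a : R) (x : R3 R) : R3 R :=
  (a * x.1.1, a * x.1.2, a * x.2).

Definition dot (x y : R3 R) : R :=
  x.1.1 * y.1.1 + x.1.2 * y.1.2 + x.2 * y.2.

Definition norm3 (x : R3 R) : R := Num.sqrt (dot x x).

(* Surface integral over S^2 in spherical coordinates (theta, phi). *)
Definition sphere_point (a : R * R) : R3 R :=
  (sin a.1 * cos a.2, sin a.1 * sin a.2, cos a.1).

Definition sphere_integral (g : R3 R -> R) : R :=
  \int[leb2]_(a in `[0, pi] `*` `[0, 2 * pi])
    (g (sphere_point a) * sin a.1).

(* A function on T^3 = (R/2piZ)^3 is a function on R^3 that is 2pi-periodic in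
   each coordinate; integrals and null sets are taken over the fundamental cell
   [0, 2pi)^3. *)
Inductive spatial_domain := Torus | WholeSpace.

Definition on_domain (Omega : spatial_domain) (T : Type) (h : R3 R -> T) :=
  match Omega with
  | Torus => forall x,
      [/\ h (x + (2 * pi, 0, 0)) = h x,
          h (x + (0, 2 * pi, 0)) = h x &
          h (x + (0, 0, 2 * pi)) = h x]
  | WholeSpace => True
  end.

Definition cell (Omega : spatial_domain) : set (R3 R) :=
  match Omega with
  | Torus => `[0, 2 * pi[ `*` `[0, 2 * pi[ `*` `[0, 2 * pi[
  | WholeSpace => setT
  end.

Definition phase (Omega : spatial_domain) : set (R3 R * R3 R) :=
  cell Omega `*` setT.

Definition ae_space Omega (P : R3 R -> Prop) : Prop :=
  {ae leb3, forall x, cell Omega x -> P x}.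

Definition ae_phase Omega (P : R3 R -> R3 R -> Prop) : Prop :=
  {ae leb6, forall z, phase Omega z -> P z.1 z.2}.

Definition Linf_norm Omega (h : R3 R -> R3 R -> R) : \bar R :=
  'N[leb6]_+oo%E[EFin \o ((fun z => h z.1 z.2) \_ (phase Omega))].

Definition L1x_Linfv_norm Omega (h : R3 R -> R3 R -> R) : \bar R :=
  (\int[leb3]_(x in cell Omega) 'N[leb3]_+oo[EFin \o h x])%E.

Definition phase_integrable Omega (h : R3 R -> R3 R -> R) : Prop :=
  leb6.-integrable (phase Omega) (fun z => (h z.1 z.2)%:E).

Definition phase_integral Omega (h : R3 R -> R3 R -> R) : R :=
  \int[leb6]_(z in phase Omega) h z.1 z.2.

End Space.

Section Boltzmann.
Context {R : realType}.
Implicit Types (gamma : R) (b : R -> R) (u v omega : R3 R).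

Definition maxwellian v : R :=
  (2 * pi) `^ (- (3 / 2)) * expR (- (dot v v / 2)).

Definition weight (beta : R) v : R := (1 + dot v v) `^ (beta / 2).

(* b is a function of the angle theta in [0, pi]. *)
Definition angular_kernel b : Prop :=
  [/\ measurable_fun (`[0, pi] : set R) b,
      exists2 C : R, 0 < C &
        forall theta, 0 <= theta <= pi -> 0 <= b theta <= C * `|cos theta| &
      ~ {ae lebesgue_measure, forall theta : R,
           0 <= theta <= pi -> b theta = 0}].

(* The kernel B(z, theta) where cos theta = z . omega / |z|. *)
Definition kernelB gamma b (z omega : R3 R) : R :=
  norm3 z `^ gamma * b (acos (dot z omega / norm3 z)).

Definition post_u v u omega : R3 R := u + smul (dot (v - u) omega) omega.

Definition post_v v u omega : R3 R := v - smul (dot (v - u) omega) omega.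

Definition collision_integral gamma b v (G : R3 R -> R3 R -> R) : R :=
  \int[leb3]_u sphere_integral
    (fun omega => kernelB gamma b (v - u) omega * G u omega).

Definition Qgain gamma b (F1 F2 : R3 R -> R) v : R :=
  collision_integral gamma b v
    (fun u omega => F1 (post_u v u omega) * F2 (post_v v u omega)).

Definition Qloss gamma b (F1 F2 : R3 R -> R) v : R :=
  collision_integral gamma b v (fun u _ => F1 u * F2 v).

Definition Q gamma b (F1 F2 : R3 R -> R) v : R :=
  Qgain gamma b F1 F2 v - Qloss gamma b F1 F2 v.

Definition nu gamma b v : R :=
  collision_integral gamma b v (fun u _ => maxwellian u).

Definition K1 gamma b (f : R3 R -> R) v : R :=
  collision_integral gamma b v
    (fun u _ => Num.sqrt (maxwellian v * maxwellian u) * f u).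

Definition K2 gamma b (f : R3 R -> R) v : R :=
  collision_integral gamma b v
    (fun u omega =>
       Num.sqrt (maxwellian u * maxwellian (post_u v u omega))
       * f (post_v v u omega))
  + collision_integral gamma b v
    (fun u omega =>
       Num.sqrt (maxwellian u * maxwellian (post_v v u omega))
       * f (post_u v u omega)).

Definition K gamma b (f : R3 R -> R) v : R := K2 gamma b f v - K1 gamma b f v.

Definition Gamma gamma b (f g : R3 R -> R) v : R :=
  (Num.sqrt (maxwellian v))^-1 *
  Q gamma b (fun w => Num.sqrt (maxwellian w) * f w)
            (fun w => Num.sqrt (maxwellian w) * g w) v.

(* F = mu + sqrt(mu) f. *)
Definition density_of (f : R3 R -> R3 R -> R) (x v : R3 R) : R :=
  maxwellian v + Num.sqrt (maxwellian v) * f x v.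

Section Defects.
Variables (Omega : spatial_domain) (F : R3 R -> R3 R -> R).

Let mass_density (x v : R3 R) := F x v - maxwellian v.
Let momentum_density (p : R3 R -> R) (x v : R3 R) :=
  p v * (F x v - maxwellian v).
Let energy_density (x v : R3 R) := dot v v * (F x v - maxwellian v).
Let entropy_density (x v : R3 R) :=
  F x v * ln (F x v) - maxwellian v * ln (maxwellian v).

Definition defect_mass : R := phase_integral Omega mass_density.

Definition defect_momentum : R3 R :=
  (phase_integral Omega (momentum_density (fun v => v.1.1)),
   phase_integral Omega (momentum_density (fun v => v.1.2)),
   phase_integral Omega (momentum_density (fun v => v.2))).

Definition defect_energy : R := phase_integral Omega energy_density.

Definition defect_entropy : R := phase_integral Omega entropy_density.

Definition conserved_defects_integrable : Prop :=
  [/\ phase_integrable Omega mass_density,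
      [/\ phase_integrable Omega (momentum_density (fun v => v.1.1)),
          phase_integrable Omega (momentum_density (fun v => v.1.2)) &
          phase_integrable Omega (momentum_density (fun v => v.2))] &
      phase_integrable Omega energy_density].

Definition defect_entropy_integrable : Prop :=
  phase_integrable Omega entropy_density.

Definition relative_entropy : R :=
  defect_entropy + (3 / 2 * ln (2 * pi) - 1) * defect_mass
  + 1 / 2 * defect_energy.

End Defects.

(* Rintegral is total, with a junk value on non-integrable functions, hence the
   integrability clauses below. For F0 they follow from the weighted sup bound
   on f0 and its finite L^1_x L^oo_v norm. *)
Definition conservation_laws Omega (F0 : R3 R -> R3 R -> R)
    (F : R -> R3 R -> R3 R -> R) : Prop :=
  forall t, 0 <= t ->
  [/\ conserved_defects_integrable Omega (F t),
      defect_mass Omega (F t) = defect_mass Omega F0,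
      defect_momentum Omega (F t) = defect_momentum Omega F0 &
      defect_energy Omega (F t) = defect_energy Omega F0].

Definition entropy_inequality Omega (F0 : R3 R -> R3 R -> R)
    (F : R -> R3 R -> R3 R -> R) : Prop :=
  forall t, 0 <= t ->
  defect_entropy_integrable Omega (F t) /\
  defect_entropy Omega (F t) <= defect_entropy Omega F0.

Definition phase_function Omega (f : R3 R -> R3 R -> R) : Prop :=
  measurable_fun setT (fun z : R3 R * R3 R => f z.1 z.2) /\
  on_domain Omega f.

Definition mild_solution Omega gamma b (f0 : R3 R -> R3 R -> R)
    (f : R -> R3 R -> R3 R -> R) : Prop :=
  [/\ measurable_fun ([set t : measurableTypeR R | 0 <= t] `*` setT)
        (fun z : measurableTypeR R * (R3 R * R3 R) => f z.1 z.2.1 z.2.2),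
      forall t, 0 <= t -> on_domain Omega (f t) &
      forall t, 0 <= t -> ae_phase Omega (fun x v =>
        f t x v =
          expR (- (nu gamma b v * t)) * f0 (x - smul t v) v
          + \int[lebesgue_measure]_(s in `[0, t])
              (expR (- (nu gamma b v * (t - s))) *
               K gamma b (f s (x - smul (t - s) v)) v)
          + \int[lebesgue_measure]_(s in `[0, t])
              (expR (- (nu gamma b v * (t - s))) *
               Gamma gamma b (f s (x - smul (t - s) v))
                             (f s (x - smul (t - s) v)) v))].

End Boltzmann.

(* Main.v *)
From HB Require Import structures.
Require Import Defs.
From mathcomp Require Import all_boot all_order all_algebra.
From mathcomp Require Import all_classical all_reals all_analysis.
From mathcomp Require Import measurable_realfun ess_sup_inf.
From mathcomp Require Import ring lra.

Set Implicit Arguments.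
Unset Strict Implicit.
Unset Printing Implicit Defensive.

Import Order.TTheory GRing.Theory Num.Theory.
Import numFieldNormedType.Exports.

Local Open Scope classical_set_scope.
Local Open Scope ring_scope.

(** Let g = F - mu = sqrt(mu) f; the density defect at (t, x) is the velocity
    integral of g. By the Duhamel formula, sqrt(mu) |f| at (t, x, v) is at most
    e^{-nu t} sqrt(mu) |f0| plus the damped time integral of
    sqrt(mu) (|K f| + |Gamma(f, f)|) along the characteristic through (t, x, v).

    The first term: nu(v) >= c (1 + |v|^2)^-2 ([nu_lower]), hence
    e^{-nu t} <= (1 + |v|^2)^2 / (c t), and the velocity integral is O(1 / t)
    ([damped_sqrt_mu_integral]). This is what T0 is for.

    The collision terms: as |f| <= M almost everywhere with M independent of the
    solution, K f and Gamma(f, f) are both at most M times a majorant in which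
    the values of |f| at the velocities u, v', u' of a collision enter linearly
    ([K_bound], [Gamma_bound]). Integrated over v, the majorant is an integral
    of |f| against a density on the space of scattering histories
    (v, u, omega, tau), of finite total mass L, where |f| is evaluated at time
    t - tau, position x - tau v and velocity w, for w = u, v' or u'
    ([collision_majorant_flow], [scattering_density_fin]). Where |f| <= k, with k
    a small constant, the contribution is at most k L. The set where |f| > k is
    small by entropy: the relative entropy density of F with respect to mu
    dominates (sqrt F - sqrt mu)^2, so that on bounded velocities the measure of
    this set at a given time is at most a constant times the relative entropy
    ([entropy_bound]), which is at most eps0 since it does not increase. It
    remains to see that small sets scatter little, uniformly in t and x. The maps
    (v, u, omega, tau) |-> (tau, tau v, w) do not charge null sets: for w = v' and
    w = u' the reason is that, given v and omega, v' runs through a line and u'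
    through a plane containing v ([null_gain], [flow_map_null_fun]). The image of
    the scattering density is therefore an absolutely continuous finite measure,
    and a set which is small in a large window of space-time and velocity has a
    small preimage ([flow_localized], [scattered_superlevel]). On the torus the
    window is covered by finitely many cells ([integral_cube_periodic]).

    The bound by M fails on null sets. For almost every x, almost every
    characteristic through (t, x) avoids them at the initial time and at almost
    all later times ([exceed_transport], [exceed_trajectory]); at the velocities
    u, v', u' they are given the value +oo in the majorant, which is harmless
    because the scattering flow does not charge null sets ([envelope]). *)

(** * Comparison of integrals and iterated integrals *)

Section Domination.
Local Open Scope ereal_scope.
Context d (T : measurableType d) (R : realType).
Variable m : {measure set T -> \bar R}.
Import HBNNSimple.

(** The integral of a nonnegative function is a supremum over the simple
    functions below it, so that comparison needs no measurability. The positive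
    and the negative part of [f] are compared with [g] separately. The collision
    terms of the mild formula are integrals of functions about whose
    measurability nothing is assumed, and they are estimated by this lemma. *)
Lemma abse_integral_dom (D : set T) (f g : T -> \bar R) :
  (forall x, D x -> `|f x| <= g x) ->
  `|\int[m]_(x in D) f x| <= \int[m]_(x in D) g x.
Proof.
move=> fg.
have g0 x : D x -> 0 <= g x by move=> /fg; apply: le_trans.
have half (h : T -> \bar R) : (forall x, 0 <= h x) ->
    (forall x, h x <= `|(f \_ D) x|) ->
    0 <= \int[m]_x h x <= \int[m]_(x in D) g x.
  move=> h0 hf; rewrite integral_ge0//= ge0_integralTE// [leRHS]ge0_integralE//.
  apply: ge_ereal_sup => _ [k /= kh <-]; apply: ereal_sup_ubound; exists k => // x.
  rewrite (le_trans (kh x))// (le_trans (hf x))//.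
  by rewrite /patch; case: ifPn => [|_]; rewrite ?inE; [exact: fg|rewrite abse0].
rewrite integral_mkcond integralE.
have /andP[p0 pI] := half ((f \_ D) ^\+) (@funepos_ge0 _ _ _)
  (fun x => ltac:(by rewrite -[leRHS]/((abse \o (f \_ D)) x) fune_abse leeDl)).
have /andP[n0 nI] := half ((f \_ D) ^\-) (@funeneg_ge0 _ _ _)
  (fun x => ltac:(by rewrite -[leRHS]/((abse \o (f \_ D)) x) fune_abse leeDr)).
move: p0 pI n0 nI.
case: (\int[m]_(x in D) g x) => [c| |].
- case: (integral _ _ _) => [a| |]//; case: (integral _ _ _) => [b| |]//.
  rewrite !lee_fin => *; rewrite ler_norml; lra.
- by move=> *; exact: leey.
- by move=> a0 aNy; have := le_trans a0 aNy; rewrite leeNy_eq.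
Qed.

Lemma le_integral_dom (D : set T) (f g : T -> \bar R) :
  (forall x, D x -> 0 <= f x) -> (forall x, D x -> f x <= g x) ->
  \int[m]_(x in D) f x <= \int[m]_(x in D) g x.
Proof.
move=> f0 fg; rewrite -[leLHS]gee0_abs; last exact: integral_ge0.
by apply: abse_integral_dom => x Dx; rewrite gee0_abs ?fg ?f0.
Qed.

Lemma normr_Rintegral_dom (D : set T) (f : T -> R) (g : T -> \bar R) :
  (forall x, D x -> `|f x|%:E <= g x) ->
  `|\int[m]_(x in D) f x|%:E <= \int[m]_(x in D) g x.
Proof.
move=> fg; have : `|\int[m]_(x in D) (f x)%:E| <= \int[m]_(x in D) g x.
  exact: abse_integral_dom.
apply: le_trans; rewrite /Rintegral.
by case: (\int[m]_(x in D) (f x)%:E) => [r| |]//=; rewrite normr0 leey.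
Qed.

End Domination.

Lemma integral_swap d1 d2 (T1 : measurableType d1) (T2 : measurableType d2)
    (R : realType) (m1 : {sigma_finite_measure set T1 -> \bar R})
    (m2 : {sigma_finite_measure set T2 -> \bar R}) (k : T1 -> T2 -> \bar R) :
  measurable_fun setT (fun z : T1 * T2 => k z.1 z.2) ->
  (forall x y, 0 <= k x y)%E ->
  (\int[m1]_x \int[m2]_y k x y = \int[m2]_y \int[m1]_x k x y)%E.
Proof.
by move=> mk k0; exact: (fubini_tonelli (m1 := m1) (m2 := m2) (fun z => k z.1 z.2)).
Qed.

Section Iterated.
Local Open Scope ereal_scope.
Context {R : realType}.
Notation leb1 := (@lebesgue_measure R).
Notation RR := (measurableTypeR R).

Lemma leb2E (f : RR * RR -> \bar R) : measurable_fun setT f ->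
  (forall x, 0 <= f x) ->
  \int[leb2]_z f z = \int[leb1]_x \int[leb1]_y f (x, y).
Proof. by move=> mf f0; exact: fubini_tonelli1. Qed.

Lemma leb2E' (f : RR * RR -> \bar R) : measurable_fun setT f ->
  (forall x, 0 <= f x) ->
  \int[leb2]_z f z = \int[leb1]_y \int[leb1]_x f (x, y).
Proof. by move=> mf f0; exact: fubini_tonelli2. Qed.

Lemma leb1_swap (k : RR -> RR -> \bar R) :
  measurable_fun setT (fun z : RR * RR => k z.1 z.2) -> (forall x y, 0 <= k x y) ->
  \int[leb1]_x \int[leb1]_y k x y = \int[leb1]_y \int[leb1]_x k x y.
Proof. by move=> mk k0; rewrite -(leb2E mk)// leb2E'. Qed.

Lemma leb3E (f : R3 R -> \bar R) : measurable_fun setT f ->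
  (forall x, 0 <= f x) ->
  \int[leb3]_z f z = \int[leb2]_x \int[leb1]_y f (x, y).
Proof. by move=> mf f0; exact: (@fubini_tonelli1 _ _ _ _ _ leb2). Qed.

Lemma leb3E' (f : R3 R -> \bar R) : measurable_fun setT f ->
  (forall x, 0 <= f x) ->
  \int[leb3]_z f z = \int[leb1]_y \int[leb2]_x f (x, y).
Proof. by move=> mf f0; exact: (@fubini_tonelli2 _ _ _ _ _ leb2). Qed.

Lemma leb6E (f : R3 R * R3 R -> \bar R) : measurable_fun setT f ->
  (forall x, 0 <= f x) ->
  \int[leb6]_z f z = \int[leb3]_x \int[leb3]_y f (x, y).
Proof. by move=> mf f0; exact: (@fubini_tonelli1 _ _ _ _ _ leb3 leb3). Qed.

Lemma leb6E' (f : R3 R * R3 R -> \bar R) : measurable_fun setT f ->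
  (forall x, 0 <= f x) ->
  \int[leb6]_z f z = \int[leb3]_y \int[leb3]_x f (x, y).
Proof. by move=> mf f0; exact: (@fubini_tonelli2 _ _ _ _ _ leb3 leb3). Qed.

End Iterated.

(** * Affine changes of variables *)

Section Affine.
Context {R : realType}.
Notation leb1 := (@lebesgue_measure R).
Notation RR := (measurableTypeR R).
Implicit Types (c e : R).

Lemma measurable_affine c e : measurable_fun setT (fun x : RR => c * x + e : RR).
Proof. by apply: measurable_funD => //; exact: measurable_funM. Qed.

Lemma preimage_affine_itv c e (a b : R) : c != 0 ->
  leb1 ((fun x : RR => c * x + e) @^-1` `]a, b]%classic)
  = ((`|c|^-1)%:E * leb1 `]a, b]%classic)%E :> \bar R.
Proof.
move=> c0; have [ab|ba] := ltP a b; last first.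
  rewrite (_ : `]a, b]%classic = set0) ?preimage_set0 ?measure0 ?mule0//.
  by apply: set_itv_ge; rewrite bnd_simp -leNgt.
have [cp|] := ltrP 0 c; last rewrite le_eqVlt (negbTE c0)/= => cn.
  rewrite (_ : _ @^-1` _ = `](a - e) / c, (b - e) / c]%classic); last first.
    apply/seteqP; split => x /=; rewrite !in_itv/= => /andP[];
    rewrite ?ltr_pdivrMr// ?ler_pdivlMr// => *; apply/andP; split; lra.
  rewrite !lebesgue_measure_itv/= !lte_fin ab.
  rewrite ltr_pM2r ?invr_gt0// ltrD2r ab gtr0_norm// -!EFinD -EFinM.
  by congr EFin; field.
rewrite (_ : _ @^-1` _ = `[(b - e) / c, (a - e) / c[%classic); last first.
  apply/seteqP; split => x /=; rewrite !in_itv/= => /andP[];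
  rewrite ?ltr_ndivlMr// ?ler_ndivrMr// => *; apply/andP; split; lra.
rewrite !lebesgue_measure_itv/= !lte_fin ab.
rewrite ltr_nM2r ?invr_lt0// ltrD2r ab ltr0_norm// -!EFinD -EFinM.
by congr EFin; field.
Qed.

(** Lebesgue measure is determined by its values on half-open intervals, on which
    the scaling is explicit. *)
Lemma lebesgue_measure_affine c e (A : set RR) : c != 0 -> measurable A ->
  (`|c|%:E * leb1 ((fun x : RR => (c * x + e : RR)%R) @^-1` A) = leb1 A)%E.
Proof.
move=> c0 mA; have c0' : 0 <= `|c| by [].
pose f := (fun x : RR => (c * x + e : RR)).
have mf : measurable_fun setT f by exact: measurable_affine.
pose m0 : {measure set RR -> \bar R} := pushforward leb1 f.
pose m : {measure set RR -> \bar R} := mscale (NngNum c0') (m0 mf).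
apply/esym; rewrite (@lebesgue_measure_unique R m)//.
move=> _ [[a b]] _ <-; rewrite /m /m0 /= /mscale/= /pushforward preimage_affine_itv//.
by rewrite muleA -EFinM divff ?normr_eq0// mul1e.
Qed.

Local Open Scope ereal_scope.

Lemma integral_affine c e (h : RR -> \bar R) : c != 0%R ->
  measurable_fun setT h -> (forall x, 0 <= h x) ->
  \int[leb1]_x (`|c|%:E * h (c * x + e)%R) = \int[leb1]_x h x.
Proof.
move=> c0 mh h0; have c0' : (0 <= `|c|)%R by [].
pose f := (fun x : RR => (c * x + e : RR)%R).
have mf : measurable_fun setT f by exact: measurable_affine.
pose m0 : {measure set RR -> \bar R} := pushforward leb1 f.
pose m : {measure set RR -> \bar R} := mscale (NngNum c0') (m0 mf).
rewrite ge0_integralZl//; last exact: measurableT_comp.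
transitivity (\int[m]_x h x); last first.
  by apply: eq_measure_integral => A mA _; exact: lebesgue_measure_affine.
rewrite /m ge0_integral_mscale//=; congr (_ * _).
by rewrite ge0_integral_pushforward.
Qed.

Lemma integral_affineV c e (h : RR -> \bar R) : c != 0%R ->
  measurable_fun setT h -> (forall x, 0 <= h x) ->
  \int[leb1]_x h (c * x + e)%R = (`|c|^-1)%:E * \int[leb1]_x h x.
Proof.
move=> c0 mh h0; rewrite -(integral_affine e c0 mh h0) ge0_integralZl//.
- by rewrite muleA -EFinM mulVf ?normr_eq0// mul1e.
- by apply: (measurableT_comp mh); exact: measurable_affine.
Qed.

End Affine.

(** * Measurability and sign of explicit integrands *)

Section Meas.
Context d (T : measurableType d) {R : realType}.
Notation RR := (measurableTypeR R).

Lemma meas_pair d1 d2 (T1 : measurableType d1) (T2 : measurableType d2)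
  (f : T -> T1) (g : T -> T2) :
  measurable_fun setT f -> measurable_fun setT g ->
  measurable_fun setT (fun x => (f x, g x)).
Proof. by move=> mf mg; exact: measurable_fun_pair. Qed.

Lemma meas_fst d1 d2 (T1 : measurableType d1) (T2 : measurableType d2)
  (f : T -> T1 * T2) : measurable_fun setT f -> measurable_fun setT (fun x => (f x).1).
Proof. by move=> mf; apply: (measurableT_comp measurable_fst mf). Qed.

Lemma meas_snd d1 d2 (T1 : measurableType d1) (T2 : measurableType d2)
  (f : T -> T1 * T2) : measurable_fun setT f -> measurable_fun setT (fun x => (f x).2).
Proof. by move=> mf; apply: (measurableT_comp measurable_snd mf). Qed.

Lemma meas_opp (f : T -> RR) : measurable_fun setT f ->
  measurable_fun setT (fun x => - f x : RR).
Proof. by move=> mf; exact: measurable_funN. Qed.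

Lemma meas_add (f g : T -> RR) : measurable_fun setT f -> measurable_fun setT g ->
  measurable_fun setT (fun x => f x + g x : RR).
Proof. by move=> mf mg; exact: measurable_funD. Qed.

Lemma meas_mul (f g : T -> RR) : measurable_fun setT f -> measurable_fun setT g ->
  measurable_fun setT (fun x => f x * g x : RR).
Proof. by move=> mf mg; exact: measurable_funM. Qed.

Lemma meas_inv (f : T -> RR) : measurable_fun setT f ->
  measurable_fun setT (fun x => (f x)^-1 : RR).
Proof.
move=> mf.
have -> : (fun x => (f x)^-1) =
   (fun x => if f x < 0 then - ((- f x) `^ (-1)) else (f x) `^ (-1)).
  apply/funext => x; case: ltP => fx; rewrite powR_inv1 ?opprK ?invrN ?opprK//.
  by rewrite oppr_ge0 ltW.
have mp : measurable_fun setT ((@powR R) ^~ (-1)) by exact: measurable_powR.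
apply: measurable_fun_ifT.
- by apply: measurable_fun_ltr => //; exact: measurable_cst.
- apply: meas_opp; apply: (measurableT_comp mp); exact: meas_opp.
- exact: (measurableT_comp mp).
Qed.

Lemma meas_norm (f : T -> RR) : measurable_fun setT f ->
  measurable_fun setT (fun x => `|f x| : RR).
Proof. by move=> mf; apply: measurableT_comp mf. Qed.

Lemma meas_cont (k : R -> R) (f : T -> RR) : continuous k -> measurable_fun setT f ->
  measurable_fun setT (fun x => k (f x) : RR).
Proof.
move=> ck mf; apply: (measurableT_comp _ mf); exact: continuous_measurable_fun.
Qed.

Lemma meas_exp (f : T -> RR) : measurable_fun setT f ->
  measurable_fun setT (fun x => expR (f x) : RR).
Proof. by apply: meas_cont; exact: continuous_expR. Qed.

Lemma meas_sin (f : T -> RR) : measurable_fun setT f ->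
  measurable_fun setT (fun x => sin (f x) : RR).
Proof. by apply: meas_cont; exact: continuous_sin. Qed.

Lemma meas_cos (f : T -> RR) : measurable_fun setT f ->
  measurable_fun setT (fun x => cos (f x) : RR).
Proof. by apply: meas_cont; exact: continuous_cos. Qed.

Lemma meas_sqrt (f : T -> RR) : measurable_fun setT f ->
  measurable_fun setT (fun x => Num.sqrt (f x) : RR).
Proof. by apply: meas_cont; exact: sqrt_continuous. Qed.

Lemma meas_ln (f : T -> RR) : measurable_fun setT f ->
  measurable_fun setT (fun x => ln (f x) : RR).
Proof. by move=> mf; exact: (measurableT_comp (@measurable_ln R) mf). Qed.

Lemma meas_powR (f : T -> RR) p : measurable_fun setT f ->
  measurable_fun setT (fun x => (f x) `^ p : RR).
Proof.
by move=> mf; exact: (measurableT_comp (measurable_powR p) mf).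
Qed.

Lemma meas_exprn (f : T -> RR) n : measurable_fun setT f ->
  measurable_fun setT (fun x => (f x) ^+ n : RR).
Proof. by move=> mf; exact: measurable_funX. Qed.

Lemma meas_EFin (f : T -> RR) : measurable_fun setT f ->
  measurable_fun setT (fun x => (f x)%:E).
Proof. by move=> mf; apply/measurable_EFinP. Qed.

Lemma meas_adde (f g : T -> \bar R) : measurable_fun setT f -> measurable_fun setT g ->
  measurable_fun setT (fun x => (f x + g x)%E).
Proof. by move=> mf mg; exact: emeasurable_funD. Qed.

Lemma meas_mule (f g : T -> \bar R) : measurable_fun setT f -> measurable_fun setT g ->
  measurable_fun setT (fun x => (f x * g x)%E).
Proof. by move=> mf mg; exact: emeasurable_funM. Qed.

Lemma meas_bool (f : T -> bool) : measurable_fun setT f ->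
  measurable_fun setT (fun x => (f x)%:R : RR).
Proof.
move=> mf; have -> : (fun x => (f x)%:R) = (fun x => if f x then 1 else 0 : RR).
  by apply/funext => x; case: (f x).
by apply: measurable_fun_ifT => //; exact: measurable_cst.
Qed.

Lemma meas_lt (f g : T -> RR) : measurable_fun setT f -> measurable_fun setT g ->
  measurable_fun setT (fun x => f x < g x).
Proof. by move=> mf mg; exact: measurable_fun_ltr. Qed.

Lemma meas_le (f g : T -> RR) : measurable_fun setT f -> measurable_fun setT g ->
  measurable_fun setT (fun x => f x <= g x).
Proof. by move=> mf mg; exact: measurable_fun_ler. Qed.

Lemma meas_neq (f g : T -> RR) : measurable_fun setT f -> measurable_fun setT g ->
  measurable_fun setT (fun x => f x != g x).
Proof. by move=> mf mg; apply: measurable_neg; exact: measurable_fun_eqr. Qed.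

Lemma meas_and (f g : T -> bool) : measurable_fun setT f -> measurable_fun setT g ->
  measurable_fun setT (fun x => f x && g x).
Proof. by move=> mf mg; exact: measurable_and. Qed.

Lemma meas_comp d1 d2 (T1 : measurableType d1) (T2 : measurableType d2)
  (k : T1 -> T2) (f : T -> T1) : measurable_fun setT k -> measurable_fun setT f ->
  measurable_fun setT (fun x => k (f x)).
Proof. by move=> mk mf; exact: (measurableT_comp mk mf). Qed.

Lemma meas_int d2 (T2 : measurableType d2) (m2 : {sigma_finite_measure set T2 -> \bar R})
    (k : T -> T2 -> \bar R) :
  measurable_fun setT (fun z : T * T2 => k z.1 z.2) ->
  (forall x y, 0 <= k x y)%E ->
  measurable_fun setT (fun x => \int[m2]_y k x y)%E.
Proof.
move=> mk k0.
exact: (measurable_fun_fubini_tonelli_F (m2 := m2) (fun z => k z.1 z.2)).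
Qed.

Lemma meas_smul (f : T -> RR) (g : T -> R3 R) :
  measurable_fun setT f -> measurable_fun setT g ->
  measurable_fun setT (fun x => smul (f x) (g x)).
Proof.
move=> mf mg; have mg1 := meas_fst mg.
by do 2?apply: meas_pair; apply: meas_mul => //;
   [exact: meas_fst|exact: (meas_snd mg1)|exact: meas_snd].
Qed.

Lemma meas_dot (f g : T -> R3 R) :
  measurable_fun setT f -> measurable_fun setT g ->
  measurable_fun setT (fun x => dot (f x) (g x) : RR).
Proof.
move=> mf mg; have mf1 := meas_fst mf; have mg1 := meas_fst mg.
by do 2?apply: meas_add; apply: meas_mul;
   [exact: meas_fst|exact: meas_fst|exact: (meas_snd mf1)|exact: (meas_snd mg1)
   |exact: meas_snd|exact: meas_snd].
Qed.

Lemma meas_add3 (f g : T -> R3 R) :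
  measurable_fun setT f -> measurable_fun setT g ->
  measurable_fun setT (fun x => f x + g x : R3 R).
Proof.
move=> mf mg; have mf1 := meas_fst mf; have mg1 := meas_fst mg.
have -> : (fun x => f x + g x : R3 R) = (fun x => ((f x).1.1 + (g x).1.1,
   (f x).1.2 + (g x).1.2, (f x).2 + (g x).2)) by [].
by do 2?apply: meas_pair; apply: meas_add;
   [exact: meas_fst|exact: meas_fst|exact: (meas_snd mf1)|exact: (meas_snd mg1)
   |exact: meas_snd|exact: meas_snd].
Qed.

Lemma meas_opp3 (f : T -> R3 R) :
  measurable_fun setT f -> measurable_fun setT (fun x => - f x : R3 R).
Proof.
move=> mf; have mf1 := meas_fst mf.
have -> : (fun x => - f x : R3 R) = (fun x => (- (f x).1.1, - (f x).1.2, - (f x).2)) by [].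
by do 2?apply: meas_pair; apply: meas_opp;
   [exact: meas_fst|exact: (meas_snd mf1)|exact: meas_snd].
Qed.

Lemma meas_sphere_point (f : T -> RR * RR) : measurable_fun setT f ->
  measurable_fun setT (fun x => sphere_point (f x)).
Proof.
move=> mf; have m1 := meas_fst mf; have m2 := meas_snd mf.
do 2?apply: meas_pair; [apply: meas_mul|apply: meas_mul|];
  [exact: meas_sin|exact: meas_cos|exact: meas_sin|exact: meas_sin|exact: meas_cos].
Qed.

Lemma meas_id : measurable_fun setT (fun x : T => x).
Proof. exact: measurable_id. Qed.

End Meas.

Lemma ge0_Mnat (R : realType) (b : bool) (r : R) : (b -> 0 <= r) -> 0 <= b%:R * r.
Proof. by case: b => [/(_ isT)|_]; rewrite ?mul1r ?mul0r. Qed.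

(** Iterated integrals generate many side conditions, nonnegativity and
    measurability, about explicit integrands. Both are proved by recursion on the
    head symbol of the formula, the hypotheses being used for the abstract
    functions which occur in it. *)
Ltac nneg1 := cbv beta;
  lazymatch goal with
  | |- forall x, _ => move=> ?
  | |- is_true (@Order.le _ _ _ (?x * ?y)%E) => apply: mule_ge0
  | |- is_true (@Order.le _ _ _ (integral _ _ _)%E) => apply: integral_ge0
  | |- is_true (@Order.le _ _ _ (?x%:E)%E) => rewrite lee_fin
  | |- is_true (@Order.le _ _ _ (+oo)%E) => exact: leey
  | |- is_true (@Order.le _ _ _ ((nat_of_bool _)%:R * ?y)%R) =>
      first [solve [apply: ge0_Mnat => /ltW //]
            |solve [apply: ge0_Mnat => /ltW; rewrite oppr_ge0 //] | apply: mulr_ge0]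
  | |- is_true (@Order.le _ _ _ (?x * ?y)%R) => apply: mulr_ge0
  | |- is_true (@Order.le _ _ _ (?x + ?y)%R) => first [apply: addr_ge0 | apply: adde_ge0]
  | |- is_true (@Order.le _ _ _ (`|?x|)%R) => exact: normr_ge0
  | |- is_true (@Order.le _ _ _ (?x%:R)%R) => exact: ler0n
  | |- is_true (@Order.le _ _ _ (expR ?x)%R) => exact: expR_ge0
  | |- is_true (@Order.le _ _ _ (?x `^ ?y)%R) => exact: powR_ge0
  | |- is_true (@Order.le _ _ _ (Num.sqrt ?x)%R) => exact: sqrtr_ge0
  | |- is_true (@Order.le _ _ _ (?x ^+ 2)%R) => exact: sqr_ge0
  | |- is_true (@Order.le _ _ _ (?x ^+ ?n)%R) => apply: exprn_ge0
  | |- is_true (@Order.le _ _ _ (?x^-1)%R) => rewrite invr_ge0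
  | H : forall x, is_true (@Order.le _ _ _ (?k x)) |- is_true (@Order.le _ _ _ (?k _)) => exact: H
  | _ => first [assumption | done]
  end.
Ltac nneg := repeat nneg1.

Ltac meas1 :=
  cbv beta;
  lazymatch goal with
  | |- measurable_fun _ (fun x => x) => exact: meas_id
  | |- measurable_fun _ (fun x => (@?f x).1) => apply: (meas_fst (f := f))
  | |- measurable_fun _ (fun x => (@?f x).2) => apply: (meas_snd (f := f))
  | |- measurable_fun _ (fun x => (@?f x, @?g x)) => apply: (meas_pair (f := f) (g := g))
  | |- measurable_fun _ (fun x => EFin (@?f x)) => apply: (meas_EFin (f := f))
  | |- measurable_fun _ (fun x => (@?f x * @?g x)%E) => apply: (meas_mule (f := f) (g := g))
  | |- measurable_fun _ (fun x => (nat_of_bool (@?f x))%:R) => apply: (meas_bool (f := f))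
  | |- measurable_fun _ (fun x => @?f x + @?g x) =>
      first [apply: (meas_add (f := f) (g := g)) | apply: (meas_adde (f := f) (g := g))
            |apply: (meas_add3 (f := f) (g := g))]
  | |- measurable_fun _ (fun x => @?f x * @?g x) => apply: (meas_mul (f := f) (g := g))
  | |- measurable_fun _ (fun x => - @?f x) => first [apply: (meas_opp (f := f)) | apply: (meas_opp3 (f := f))]
  | |- measurable_fun _ (fun x => smul (@?f x) (@?g x)) => apply: (meas_smul (f := f) (g := g))
  | |- measurable_fun _ (fun x => dot (@?f x) (@?g x)) => apply: (meas_dot (f := f) (g := g))
  | |- measurable_fun _ (fun x => sphere_point (@?f x)) => apply: (meas_sphere_point (f := f))
  | |- measurable_fun _ (fun x => (@?f x)^-1) => apply: (meas_inv (f := f))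
  | |- measurable_fun _ (fun x => `|@?f x|) => apply: (meas_norm (f := f))
  | |- measurable_fun _ (fun x => expR (@?f x)) => apply: (meas_exp (f := f))
  | |- measurable_fun _ (fun x => sin (@?f x)) => apply: (meas_sin (f := f))
  | |- measurable_fun _ (fun x => cos (@?f x)) => apply: (meas_cos (f := f))
  | |- measurable_fun _ (fun x => ln (@?f x)) => apply: (meas_ln (f := f))
  | |- measurable_fun _ (fun x => Num.sqrt (@?f x)) => apply: (meas_sqrt (f := f))
  | |- measurable_fun _ (fun x => (@?f x) `^ ?p) => apply: (meas_powR (f := f))
  | |- measurable_fun _ (fun x => (@?f x) ^+ ?p) => apply: (meas_exprn (f := f))
  | |- measurable_fun _ (fun x => @?f x < @?g x) => apply: (meas_lt (f := f) (g := g))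
  | |- measurable_fun _ (fun x => @?f x <= @?g x) => apply: (meas_le (f := f) (g := g))
  | |- measurable_fun _ (fun x => @?f x != @?g x) => apply: (meas_neq (f := f) (g := g))
  | |- measurable_fun _ (fun x => @?f x && @?g x) => apply: (meas_and (f := f) (g := g))
  | |- measurable_fun _ (fun x => integral ?m setT (fun y => @?k x y)) =>
      apply: (@meas_int _ _ _ _ _ _ k); [ | by nneg]
  | H : measurable_fun _ ?k |- measurable_fun _ (fun x => ?k (@?f x)) =>
      apply: (meas_comp (k := k) (f := f) H)
  | |- measurable_fun _ ?f => first [exact: measurable_cst | assumption | done ]
  end.
Ltac meas := repeat meas1.

(** * Rotations and similarities of space *)

Section Rotations.
Local Open Scope ereal_scope.
Context {R : realType}.
Notation leb1 := (@lebesgue_measure R).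
Notation RR := (measurableTypeR R).

Lemma leb3_swap (h : R3 R -> \bar R) : measurable_fun setT h ->
  (forall x, 0 <= h x) ->
  \int[leb3]_z h z = \int[leb1]_y \int[leb2]_q h (q.1, y, q.2).
Proof.
move=> mh h0; rewrite leb3E// leb2E'; last 2 first.
- by apply: (measurable_fun_fubini_tonelli_F (m2 := leb1)) => //.
- by move=> x; exact: integral_ge0.
apply: eq_integral => y _; rewrite leb2E//=.
by meas.
Qed.

(** For c <> 0 the rotation is computed by two affine substitutions: first in the
    abscissa at fixed ordinate, with Jacobian c, then in the ordinate at fixed new
    abscissa, with Jacobian 1 / c. For c = 0 it exchanges the coordinates up to
    sign. *)
Lemma integral_rot2 (c s : R) (h : RR * RR -> \bar R) : (c ^+ 2 + s ^+ 2 = 1)%R ->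
  measurable_fun setT h -> (forall x, 0 <= h x) ->
  \int[leb2]_z h (c * z.1 - s * z.2, s * z.1 + c * z.2)%R = \int[leb2]_z h z.
Proof.
move=> cs1 mh h0.
have [c0|c0] := eqVneq c 0%R.
  have s0 : s != 0%R.
    by apply: contra_eq_neq cs1 => ->; rewrite c0 !expr0n/= addr0 eq_sym oner_eq0.
  have s1 : `|s|%R = 1%R.
    by apply/eqP; rewrite -sqrp_eq1// real_normK ?num_real// -cs1 c0 expr0n add0r.
  rewrite leb2E//=; last by meas.
  transitivity (\int[leb1]_x \int[leb1]_y h (y, s * x + 0)%R).
    apply: eq_integral => x _.
    transitivity (\int[leb1]_y h (- s * y + 0, s * x + 0)%R).
      apply: eq_integral => y _; congr h; congr pair; rewrite c0; ring.
    rewrite (@integral_affineV _ (- s)%R 0%R (fun y => h (y, s * x + 0)%R))//.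
    - by rewrite normrN s1 invr1 mul1e.
    - by rewrite oppr_eq0.
    - by meas.
  rewrite (@leb1_swap _ (fun x y => h (y, s * x + 0)%R))//=; last by meas.
  rewrite (leb2E mh h0); apply: eq_integral => y _.
  rewrite (@integral_affineV _ s 0%R (fun x => h (y, x)))//; last by meas.
  by rewrite s1 invr1 mul1e.
rewrite leb2E'//=; last by meas.
transitivity (\int[leb1]_y \int[leb1]_x ((`|c|^-1)%:E * h (x, (c^-1 * y + s / c * x))%R)).
  apply: eq_integral => y _.
  transitivity (\int[leb1]_x (fun X => h (X, c^-1 * y + s / c * X)%R) (c * x + - (s * y))%R).
    apply: eq_integral => x _ /=; congr h; congr pair.
    (* c^2 + s^2 = 1 divided by c *)
    have ci : (c^-1 = c + s ^+ 2 / c)%R by rewrite -[LHS]mul1r -cs1; field.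
    by rewrite {1}ci; field.
  rewrite (@integral_affineV _ c (- (s * y))%R (fun X => h (X, c^-1 * y + s / c * X)%R))//; last by meas.
  by rewrite ge0_integralZl//; meas.
rewrite (@leb1_swap _ (fun y x => (`|c|^-1)%:E * h (x, (c^-1 * y + s / c * x))%R))//=; last 2 first.
- by meas.
- by move=> x y; rewrite mule_ge0// lee_fin invr_ge0.
rewrite (leb2E mh h0); apply: eq_integral => x _.
rewrite ge0_integralZl//; last by meas.
rewrite (@integral_affineV _ c^-1%R _ (fun y => h (x, y)))//; [|by rewrite invr_eq0|by meas].
by rewrite muleA -EFinM normfV mulfV ?invr_eq0 ?normr_eq0// mul1e.
Qed.

(** The rotation by the angle a.1 in the plane of the first and third axes followed
    by that by a.2 in the plane of the first two; it takes the third axis to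
    [sphere_point a]. *)
Definition frame (a : R * R) (p : R3 R) : R3 R :=
  let q := (cos a.1 * p.1.1 + sin a.1 * p.2)%R in
  (cos a.2 * q - sin a.2 * p.1.2, sin a.2 * q + cos a.2 * p.1.2,
   cos a.1 * p.2 - sin a.1 * p.1.1)%R.

Lemma integral_frame a (h : R3 R -> \bar R) :
  measurable_fun setT h -> (forall x, 0 <= h x) ->
  \int[leb3]_p h (frame a p) = \int[leb3]_p h p.
Proof.
move=> mh h0; rewrite leb3_swap//; last by rewrite /frame/=; meas.
transitivity (\int[leb1]_y \int[leb2]_q h
    (cos a.2 * q.1 - sin a.2 * y, sin a.2 * q.1 + cos a.2 * y, q.2)%R).
  apply: eq_integral => y _.
  rewrite -[RHS](@integral_rot2 (cos a.1) (- sin a.1)) ?sqrrN ?cos2Dsin2//; last by meas.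
  apply: eq_integral => q _; rewrite /frame/=; congr h; congr pair; last by ring.
  by congr pair; ring.
rewrite -(leb3_swap (h := fun p => h (cos a.2 * p.1.1 - sin a.2 * p.1.2,
   sin a.2 * p.1.1 + cos a.2 * p.1.2, p.2)%R))//; last by meas.
rewrite leb3E'//; last by meas.
rewrite (leb3E' mh h0); apply: eq_integral => z _ /=.
by rewrite (@integral_rot2 _ _ (fun q => h (q, z))) ?cos2Dsin2//; meas.
Qed.

Lemma integral_affine3 (c : R) (e : R3 R) (h : R3 R -> \bar R) : c != 0%R ->
  measurable_fun setT h -> (forall x, 0 <= h x) ->
  \int[leb3]_p h (c * p.1.1 + e.1.1, c * p.1.2 + e.1.2, c * p.2 + e.2)%R
  = (`|c|^-1 ^+ 3)%:E * \int[leb3]_p h p.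
Proof.
move=> c0 mh h0; have k0 : (0 <= `|c|^-1)%R by rewrite invr_ge0.
have aff2 (k : RR * RR -> \bar R) : measurable_fun setT k -> (forall x, 0 <= k x) ->
    \int[leb2]_q k (c * q.1 + e.1.1, c * q.2 + e.1.2)%R
    = (`|c|^-1 ^+ 2)%:E * \int[leb2]_q k q.
  move=> mk kge0; rewrite !leb2E//=; last by meas.
  transitivity (\int[leb1]_x ((`|c|^-1)%:E * \int[leb1]_y k (c * x + e.1.1, y)%R)).
    apply: eq_integral => x _.
    by rewrite (@integral_affineV _ c _ (fun y => k (c * x + e.1.1, y)%R))//; meas.
  have mI : measurable_fun setT (fun x : RR => \int[leb1]_y k (x, y)).
    exact: (measurable_fun_fubini_tonelli_F (m2 := leb1)).
  rewrite ge0_integralZl; [|exact: measurableT|exact: (measurableT_comp mI (measurable_affine _ _))|by move=> x _; exact: integral_ge0|by rewrite lee_fin ?exprn_ge0].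
  rewrite (@integral_affineV _ c _ (fun x => \int[leb1]_y k (x, y)))//; last first.
    by move=> x; exact: integral_ge0.
  by rewrite muleA -EFinM -expr2.
rewrite !leb3E'//=; last by meas.
transitivity (\int[leb1]_y ((`|c|^-1 ^+ 2)%:E * \int[leb2]_q h (q, c * y + e.2)%R)).
  apply: eq_integral => y _.
  by rewrite -(@aff2 (fun q => h (q, c * y + e.2)%R))//; meas.
have mI : measurable_fun setT (fun y : RR => \int[leb2]_q h (q, y)).
  exact: (measurable_fun_fubini_tonelli_G (m1 := leb2)).
rewrite ge0_integralZl; [|exact: measurableT|exact: (measurableT_comp mI (measurable_affine _ _))|by move=> x _; exact: integral_ge0|by rewrite lee_fin ?exprn_ge0].
rewrite (@integral_affineV _ c _ (fun y => \int[leb2]_q h (q, y)))//; last first.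
  by move=> x; exact: integral_ge0.
by rewrite muleA -EFinM -exprSr.
Qed.

End Rotations.

(** * Polar and spherical coordinates *)

Section WeightedPushforward.
Local Open Scope ereal_scope.
Context d1 d2 (X : measurableType d1) (Y : measurableType d2) {R : realType}.
Variables (m : {measure set X -> \bar R}) (w : X -> R) (phi : X -> Y).
Hypotheses (mw : measurable_fun setT (EFin \o w)) (w0 : forall x, 0 <= (w x)%:E).
Hypothesis mphi : measurable_fun setT phi.

(** The image under [phi] of the measure with density [w]. The side conditions are
    arguments, so that a measure structure can be attached to the constant. *)
Definition wpush of measurable_fun setT (EFin \o w) & (forall x, 0 <= (w x)%:E)
    & measurable_fun setT phi :=
  fun A : set Y => \int[m]_(x in phi @^-1` A) (w x)%:E.

Notation nu := (wpush mw w0 mphi).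

Let nu0 : nu set0 = 0.
Proof. by rewrite /wpush preimage_set0 integral_set0. Qed.

Let nu_ge0 A : 0 <= nu A.
Proof. exact: integral_ge0. Qed.

Let mpre A : measurable A -> measurable (phi @^-1` A).
Proof. by move=> mA; rewrite -[_ @^-1` _]setTI; exact: mphi. Qed.

Let nu_sigma : semi_sigma_additive nu.
Proof.
move=> F mF tF mUF; rewrite /wpush preimage_bigcup.
apply: semi_sigma_additive_nng_induced => //.
- by move=> n; exact: mpre.
- apply/trivIsetP => /= i j _ _ ij; rewrite -preimage_setI.
  by move/trivIsetP : tF => /(_ _ _ _ _ ij) ->//; rewrite preimage_set0.
- by rewrite -preimage_bigcup; exact: mpre.
Qed.

HB.instance Definition _ := isMeasure.Build _ _ _ nu nu0 nu_ge0 nu_sigma.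

Variable m' : {measure set Y -> \bar R}.
Hypothesis m'E : forall A, measurable A -> m' A = \int[m]_(x in phi @^-1` A) (w x)%:E.

Import HBNNSimple.

(** Knowing the image measure on sets is enough: the formula passes to simple
    functions by linearity and to nonnegative functions by monotone convergence. *)
Lemma ge0_integral_wpush (h : Y -> \bar R) :
  measurable_fun setT h -> (forall y, 0 <= h y) ->
  \int[m']_y h y = \int[m]_x ((w x)%:E * h (phi x)).
Proof.
move=> mh h0; pose f_ := nnsfun_approx measurableT mh.
have mfphi n : measurable_fun setT (fun x => (f_ n (phi x))%:E).
  by apply/measurable_EFinP; exact: measurableT_comp.
transitivity (limn (fun n => \int[m']_y (f_ n y)%:E)).
  rewrite -monotone_convergence//=.
  - apply: eq_integral => x _; apply/esym/cvg_lim => //=.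
    exact: cvg_nnsfun_approx.
  - by move=> n; exact/measurable_EFinP.
  - by move=> n x _; rewrite lee_fin.
  - by move=> x _ a b ab; rewrite lee_fin//; exact/lefP/nd_nnsfun_approx.
rewrite (_ : \int[m]_x _ =
    limn (fun n => \int[m]_x ((w x)%:E * (f_ n (phi x))%:E))); last first.
  rewrite -monotone_convergence//=.
  - apply: eq_integral => x _; apply/esym/cvg_lim => //=.
    by apply: cvgeMl => //; exact: cvg_nnsfun_approx.
  - by move=> n; exact: emeasurable_funM.
  - by move=> n x _; rewrite mule_ge0// lee_fin.
  - move=> x _ a b ab; apply: lee_wpmul2l => //.
    by rewrite lee_fin; exact/lefP/nd_nnsfun_approx.
congr (limn _); apply/funext => n.
move: (f_ n) => g.
under [LHS]eq_integral do rewrite fimfunE -fsumEFin//.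
rewrite [LHS]ge0_integral_fsum//; last 2 first.
  - by move=> r; exact/measurable_EFinP/measurableT_comp.
  - by move=> r x _; rewrite EFinM nnfun_muleindic_ge0.
under [RHS]eq_integral.
  move=> x _; rewrite fimfunE -fsumEFin// ge0_mule_fsumr; last first.
    by move=> r; rewrite EFinM nnfun_muleindic_ge0.
  over.
have mind r : measurable_fun setT (fun x => (\1_(g @^-1` [set r]) (phi x))%:E : \bar R).
  by apply/measurable_EFinP; apply: measurableT_comp.
rewrite [RHS]ge0_integral_fsum//; last 2 first.
  - move=> r; apply: emeasurable_funM => //; under eq_fun do rewrite EFinM.
    exact: emeasurable_funM.
  - by move=> r x _; rewrite EFinM mule_ge0// nnfun_muleindic_ge0.
apply: eq_fsbigr => r _.
rewrite integralZl_indic_nnsfun// integral_indic// setIT m'E//.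
have [r0|r0] := ltP r 0%R.
  have gr : g @^-1` [set r] = set0 by exact: preimage_nnfun0.
  rewrite gr preimage_set0 integral_set0 mule0.
  by under eq_integral do rewrite indic0 mulr0 mule0; rewrite integral0.
under [RHS]eq_integral do rewrite EFinM muleCA.
rewrite ge0_integralZl//; last 2 first.
- exact: emeasurable_funM.
- by move=> x _; rewrite mule_ge0// lee_fin.
congr (_ * _); rewrite integral_mkcond; apply: eq_integral => x _.
rewrite patchE indicE (_ : (phi x \in _) = (x \in phi @^-1` (g @^-1` [set r]))).
  by case: ifPn; rewrite ?mule1 ?mule0.
by apply/idP/idP; rewrite !inE.
Qed.

End WeightedPushforward.

Section Polar.
Context {R : realType}.
Notation leb1 := (@lebesgue_measure R).
Notation RR := (measurableTypeR R).

Definition tan_weight (x : RR) : R :=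
  (- (pi / 2) < x < pi / 2)%R%:R * (cos x)^-1 ^+ 2.

Let tan_weight_ge0 x : (0 <= (tan_weight x)%:E)%E.
Proof. by rewrite lee_fin mulr_ge0// sqr_ge0. Qed.

Let mtan_weight : measurable_fun setT (EFin \o tan_weight).
Proof. by rewrite /tan_weight; apply/measurable_EFinP; meas. Qed.

Let mtan : measurable_fun setT (tan : RR -> RR).
Proof. by rewrite /tan; meas. Qed.

(** On half-open intervals this is the fundamental theorem of calculus for the
    tangent; uniqueness of Lebesgue measure does the rest. *)
Lemma tan_weight_preimage (A : set RR) : measurable A ->
  leb1 A = (\int[leb1]_(x in tan @^-1` A) (tan_weight x)%:E)%E.
Proof.
pose nu : {measure set RR -> \bar R} := wpush leb1 mtan_weight tan_weight_ge0 mtan.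
rewrite -[RHS]/(nu A); apply: lebesgue_measure_unique => _ [[a b]] _ <-.
rewrite /nu/= /wpush lebesgue_measure_itv/= lte_fin.
have atI (c : R) : atan c \in `](- (pi / 2)), (pi / 2)[.
  by rewrite in_itv/= atan_gtNpi2 atan_ltpi2.
have E x : ((fun x => (tan_weight x)%:E) \_ (tan @^-1` `]a, b])) x =
           ((fun x => ((cos x)^-1 ^+ 2)%:E) \_ `]atan a, atan b]) x.
  rewrite !patchE /tan_weight.
  have [xI|xI] := boolP (x \in `](- (pi / 2)), (pi / 2)[).
    move: (xI); rewrite in_itv/= => ->; rewrite mul1r.
    rewrite (_ : (x \in tan @^-1` _) = (x \in `]atan a, atan b]%classic))//.
    have lta : (a < tan x) = (atan a < x) by rewrite -{1}(atanK a) ltr_tan.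
    have leb : (tan x <= b) = (x <= atan b).
      by rewrite -{1}(atanK b) !leNgt ltr_tan.
    by apply/idP/idP; rewrite !inE/= !in_itv/= lta leb.
  move: (xI); rewrite in_itv/= => /negbTE ->; rewrite mul0r.
  rewrite [in RHS](_ : (x \in _) = false) ?if_same//.
  apply/negbTE/negP; rewrite inE/= in_itv/= => /andP[ax xb].
  move/negP : xI; apply; rewrite in_itv/= (lt_trans (atan_gtNpi2 _) ax)/=.
  exact: le_lt_trans xb (atan_ltpi2 _).
rewrite [RHS]integral_mkcond.
transitivity (\int[leb1]_(x in `]atan a, atan b]) ((cos x)^-1 ^+ 2)%:E)%E; last first.
  by rewrite [LHS]integral_mkcond; apply: eq_integral => x _; exact/esym/E.
case: ltP => [ab|ba]; last first.
  rewrite set_itv_ge ?integral_set0// bnd_simp -leNgt.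
  by apply: le_atan.
have cosn0 x : x \in `[atan a, atan b] -> cos x != 0.
  rewrite in_itv/= => /andP[ax xb]; rewrite gt_eqF// cos_gt0_pihalf//.
  by rewrite (lt_le_trans (atan_gtNpi2 _) ax) (le_lt_trans xb (atan_ltpi2 _)).
rewrite integral_itv_obnd_cbnd; last first.
  apply: measurable_funTS; apply/measurable_EFinP.
  rewrite -/(measurable_fun _ _); by meas.
rewrite (@continuous_FTC2 _ _ tan).
- by rewrite !atanK.
- exact: lt_atan.
- apply: continuous_in_subspaceT => x; rewrite inE/= => xI.
  apply: cvgM; apply: cvgV; [exact: cosn0|exact: continuous_cos|exact: cosn0|exact: continuous_cos].
- split.
  + by move=> x xI; apply: derivable_tan; apply: cosn0; exact: subset_itv_oo_cc.
  + apply: cvg_at_right_filter; apply: continuous_tan; apply: cosn0.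
    by rewrite in_itv/= lexx le_atan// ltW.
  + apply: cvg_at_left_filter; apply: continuous_tan; apply: cosn0.
    by rewrite in_itv/= lexx le_atan// ltW.
- move=> x xI; rewrite derive1E.
  have /is_derive_tan dt : cos x != 0 by apply: cosn0; exact: subset_itv_oo_cc.
  by rewrite derive_val exprVn.
Qed.

Local Open Scope ereal_scope.

Lemma integral_tan (h : RR -> \bar R) :
  measurable_fun setT h -> (forall y, 0 <= h y) ->
  \int[leb1]_y h y = \int[leb1]_x ((tan_weight x)%:E * h (tan x)).
Proof.
move=> mh h0.
by apply: (ge0_integral_wpush mtan_weight tan_weight_ge0 mtan) => // A mA; exact: tan_weight_preimage.
Qed.

(** With y = r cos x one has (r cos x, r sin x) = (y, y tan x), so that the
    substitution s = tan x in one variable replaces a change of variables in the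
    plane. Radii are signed, hence a half circle of directions is enough. *)
Lemma integral_polar (G : RR * RR -> \bar R) :
  measurable_fun setT G -> (forall y, 0 <= G y) ->
  \int[leb1]_x \int[leb1]_r
    (((- (pi / 2) < x < pi / 2)%R%:R * `|r|)%:E * G (r * cos x, r * sin x)%R)
  = \int[leb2]_z G z.
Proof.
move=> mG G0.
transitivity (\int[leb1]_x \int[leb1]_y
    ((tan_weight x)%:E * (`|y|%:E * G (y, y * tan x)%R))).
  apply: eq_integral => x _; rewrite /tan_weight.
  case/boolP : (- (pi / 2) < x < pi / 2)%R => xI; last first.
    rewrite !integral0_eq// => y _; first by rewrite !mul0r mul0e.
    by rewrite mul0r mul0e.
  have c0 : (0 < cos x)%R by rewrite cos_gt0_pihalf.
  have mk : measurable_fun setT (fun y : RR => ((cos x)^-1 * `|y|)%:E * G (y, y * tan x)%R).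
    by meas.
  transitivity (\int[leb1]_r (((cos x)^-1 * `|cos x * r + 0|)%:E *
     G (cos x * r + 0, (cos x * r + 0) * tan x)%R)).
    apply: eq_integral => r _; rewrite !mul1r !addr0 normrM gtr0_norm//.
    rewrite mulKf ?gt_eqF// mulrC (mulrC (cos x)) /tan; congr (_ * G _).
    by congr pair; field; rewrite gt_eqF.
  rewrite (@integral_affineV _ (cos x) 0%R (fun y => ((cos x)^-1 * `|y|)%:E * G (y, y * tan x)%R))//.
  - rewrite -ge0_integralZl//.
    + apply: eq_integral => y _; rewrite muleA -EFinM gtr0_norm// muleA -EFinM.
      by congr (_%:E * _); rewrite mul1r expr2 !mulrA.
    + by move=> y _; rewrite mule_ge0// lee_fin mulr_ge0// invr_ge0 ltW.
  - by rewrite gt_eqF.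
  - by move=> y; rewrite mule_ge0// lee_fin mulr_ge0// invr_ge0 ltW.
rewrite (@leb1_swap _ (fun x y => (tan_weight x)%:E * (`|y|%:E * G (y, y * tan x)%R))); last 2 first.
- rewrite /tan_weight /tan; by meas.
- by move=> x y; rewrite !mule_ge0// tan_weight_ge0.
rewrite (leb2E mG G0); apply: ge0_ae_eq_integral => //.
- by rewrite /tan_weight /tan; meas.
- by meas.
- by move=> x _; apply: integral_ge0 => y _; rewrite !mule_ge0// tan_weight_ge0.
- by move=> x _; exact: integral_ge0.
exists [set 0%R]; split => //; first exact: lebesgue_measure_set1.
move=> x /= /not_implyP[_ xE]; apply/eqP; apply: contra_notT xE => x0.
rewrite -(@integral_tan (fun s => `|x|%:E * G (x, x * s)%R)); last 2 first.
- by meas.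
- by move=> y; rewrite mule_ge0.
rewrite -(integral_affine 0%R x0 (h := fun y => G (x, y)))//; last by meas.
by apply: eq_integral => y _; rewrite addr0.
Qed.

End Polar.

Section NullSupport.
Local Open Scope ereal_scope.
Context d (T : measurableType d) (R : realType).
Variable m : {measure set T -> \bar R}.

Lemma integral0_ae (g : T -> \bar R) : measurable_fun setT g ->
  (forall x, 0 <= g x) -> \int[m]_x g x = 0 -> {ae m, forall x, g x = 0}.
Proof.
move=> mg g0 ig; have : \int[m]_x `|g x| = 0.
  by rewrite -[RHS]ig; apply: eq_integral => x _; rewrite gee0_abs.
move/(@ae_eq_integral_abs _ _ _ m setT measurableT g mg).
by apply: filterS => x /(_ I).
Qed.

Lemma ae_integral0 (f : T -> \bar R) : measurable_fun setT f ->
  (forall x, 0 <= f x) -> {ae m, forall x, f x = 0} -> \int[m]_x f x = 0.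
Proof.
move=> mf f0 aef; rewrite -(integral0 m setT).
by apply: ge0_ae_eq_integral => //; apply: filterS aef => x + _.
Qed.

Lemma integral0_support (f g : T -> \bar R) :
  measurable_fun setT f -> measurable_fun setT g ->
  (forall x, 0 <= f x) -> (forall x, 0 <= g x) ->
  (forall x, g x = 0 -> f x = 0) -> \int[m]_x g x = 0 -> \int[m]_x f x = 0.
Proof.
move=> mf mg f0 g0 gf /(integral0_ae mg g0) g0ae.
by apply: ae_integral0 => //; apply: filterS g0ae.
Qed.

End NullSupport.

Section Spherical.
Local Open Scope ereal_scope.
Context {R : realType}.
Notation leb1 := (@lebesgue_measure R).
Notation RR := (measurableTypeR R).

Lemma integral_off_countable (S : set RR) (f g : RR -> \bar R) : countable S ->
  measurable_fun setT f -> measurable_fun setT g ->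
  (forall x, 0 <= f x) -> (forall x, 0 <= g x) ->
  (forall x, ~ S x -> f x = g x) ->
  \int[leb1]_x f x = \int[leb1]_x g x.
Proof.
move=> cS mf mg f0 g0 fg; apply: ge0_ae_eq_integral => //.
exists S; split; [exact: countable_measurable|exact: countable_lebesgue_measure0|].
by move=> x /= fgx; apply: contrapT => /fg xE; apply: fgx.
Qed.

Lemma integral_off0 (f : RR -> \bar R) : measurable_fun setT f ->
  (forall x, 0 <= f x) ->
  \int[leb1]_x f x = \int[leb1]_x ((x != 0)%R%:R%:E * f x).
Proof.
move=> mf f0; apply: (@integral_off_countable [set 0%R]) => //.
- have -> : (fun x : RR => (x != 0)%R%:R%:E * f x) = (fun x => (0 < `|x|)%R%:R%:E * f x).
    by apply/funext => x; rewrite normr_gt0.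
  by meas.
- by nneg.
- by move=> x /eqP ->; rewrite mul1e.
Qed.

Lemma integral_polar_pi (G : RR * RR -> \bar R) :
  measurable_fun setT G -> (forall y, 0 <= G y) ->
  \int[leb1]_x \int[leb1]_r
    (((0 < x < pi)%R%:R * `|r|)%:E * G (r * sin x, r * cos x)%R)
  = \int[leb2]_z G z.
Proof.
move=> mG G0; rewrite -(integral_polar mG G0).
pose h (x : RR) := \int[leb1]_r
    (((- (pi / 2) < x < pi / 2)%R%:R * `|r|)%:E * G (r * cos x, r * sin x)%R).
transitivity (\int[leb1]_x h ((-1) * x + pi / 2)%R); last first.
  rewrite (@integral_affineV _ (-1) _ h) ?oppr_eq0 ?oner_eq0//.
  - by rewrite normrN1 invr1 mul1e.
  - by rewrite /h; meas.
  - by rewrite /h; nneg.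
apply: eq_integral => x _; rewrite /h; apply: eq_integral => r _.
rewrite mulN1r cosDpihalf sinDpihalf sinN cosN opprK.
by congr (((nat_of_bool _)%:R * _)%:E * _); apply/idP/idP => /andP[? ?]; apply/andP; split; lra.
Qed.

(** The half circle with signed radii is traded for the full circle with positive
    radii: the radii r < 0 in the direction x are the radii r > 0 in the direction
    x + pi. *)
Lemma integral_polar_2pi (G : RR * RR -> \bar R) :
  measurable_fun setT G -> (forall y, 0 <= G y) ->
  \int[leb1]_x \int[leb1]_r
    (((0 <= x <= 2 * pi)%R%:R * ((0 < r)%R%:R * r))%:E * G (r * cos x, r * sin x)%R)
  = \int[leb2]_z G z.
Proof.
move=> mG G0.
have pos r : (0 <= (0 < r)%R%:R * r :> R)%R by case: ltP => [/ltW|]; rewrite ?mul1r ?mul0r.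
pose H (x : RR) := \int[leb1]_r (((0 < r)%R%:R * r)%:E * G (r * cos x, r * sin x)%R).
have mH : measurable_fun setT H.
  by rewrite /H; apply: meas_int; [meas|nneg].
have H0 x : 0 <= H x by rewrite /H; nneg.
have -> : \int[leb2]_z G z = \int[leb2]_z G (z.2, z.1).
  by rewrite leb2E// leb2E'//=; meas.
have mG' : measurable_fun setT (fun z : RR * RR => G (z.2, z.1)) by meas.
rewrite -[RHS](integral_polar_pi mG' (fun z => G0 _)) /=.
transitivity (\int[leb1]_x ((0 <= x <= 2 * pi)%R%:R%:E * H x)).
  apply: eq_integral => x _; rewrite /H -ge0_integralZl//; last 2 first.
  - by meas.
  - by move=> r _; rewrite mule_ge0// lee_fin.
  by apply: eq_integral => r _; rewrite EFinM muleA.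
transitivity (\int[leb1]_x ((0 < x < pi)%R%:R%:E * H x + (0 < x - pi < pi)%R%:R%:E * H x)).
  apply: (@integral_off_countable [set 0%R; pi; (2 * pi)%R]).
  - exact: finite_set_countable.
  - by meas.
  - by meas.
  - by nneg.
  - by nneg.
  - move=> x /= xn; have pp := @pi_gt0 R.
    have x0 : x != 0%R by apply: contra_notN xn => /eqP ->; left; left.
    have xp : x != pi by apply: contra_notN xn => /eqP ->; left; right.
    have xpp : x != (2 * pi)%R by apply: contra_notN xn => /eqP ->; right.
    rewrite -ge0_muleDl// -EFinD; congr (_%:E * _).
    have [xl|xl] := ltP x pi.
      rewrite (_ : (0 < x - pi)%R = false) ?addr0; last by apply/negP => ?; lra.
      rewrite (_ : (x <= 2 * pi)%R = true) ?andbT; last by lra.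
      by rewrite [in RHS]lt_neqAle eq_sym x0.
    have xl' : (pi < x)%R by rewrite lt_neqAle eq_sym xp.
    rewrite andbF add0r; congr (nat_of_bool _)%:R; apply/idP/idP => /andP[xa xb].
      have xb' : (x < 2 * pi)%R by rewrite lt_neqAle xpp.
      by apply/andP; split; lra.
    by apply/andP; split; lra.
rewrite ge0_integralD; [|exact: measurableT|by nneg|by meas|by nneg|by meas].
pose h2 (y : RR) := (0 < y < pi)%R%:R%:E * H (y + pi)%R.
have mh2 : measurable_fun setT h2 by rewrite /h2; meas.
have h20 y : 0 <= h2 y by rewrite /h2; nneg.
rewrite [X in _ + X](_ : _ = \int[leb1]_x h2 x); last first.
  transitivity (\int[leb1]_x h2 (1 * x + - pi)%R).
    by apply: eq_integral => x _; rewrite /h2 mul1r subrK.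
  by rewrite integral_affineV ?oner_eq0// normr1 invr1 mul1e.
rewrite -ge0_integralD; [|exact: measurableT|by nneg|by meas|by nneg|by meas].
apply: eq_integral => x _; rewrite /h2.
have -> : H (x + pi)%R = \int[leb1]_r
    (((r < 0)%R%:R * - r)%:E * G (r * cos x, r * sin x)%R).
  rewrite /H; pose k (r : RR) :=
    (((r < 0)%R%:R * - r)%:E * G (r * cos x, r * sin x)%R).
  transitivity (\int[leb1]_r k ((-1) * r + 0)%R); last first.
    rewrite (@integral_affineV _ (-1) _ k) ?oppr_eq0 ?oner_eq0//.
    - by rewrite normrN1 invr1 mul1e.
    - by rewrite /k; meas.
    - move=> r; rewrite /k mule_ge0// lee_fin.
      by case: ltP => [/ltW|]; rewrite ?mul1r ?mul0r// oppr_ge0.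
  apply: eq_integral => r _; rewrite /k addr0 mulN1r oppr_lt0 opprK cosDpi sinDpi.
  by rewrite !mulrN !mulNr.
rewrite -ge0_muleDr//; last first.
  by apply: integral_ge0 => r _; rewrite mule_ge0// lee_fin; case: ltP => [/ltW|]; rewrite ?mul1r ?mul0r// oppr_ge0.
rewrite /H -ge0_integralD//; last 4 first.
- by nneg.
- by meas.
- by move=> r _; rewrite mule_ge0// lee_fin; case: ltP => [/ltW|]; rewrite ?mul1r ?mul0r// oppr_ge0.
- by meas.
rewrite -ge0_integralZl//; last 2 first.
- by meas.
- by nneg.
apply: eq_integral => r _; rewrite -ge0_muleDl ?lee_fin//; last first.
  by case: ltP => [/ltW|]; rewrite ?mul1r ?mul0r// oppr_ge0.
rewrite muleA -EFinD -EFinM; congr ((_ * _)%:E * _).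
case: (ltgtP r 0%R) => [r0|r0|->]; rewrite ?mul1r ?mul0r ?add0r ?addr0.
- by rewrite ltr0_norm.
- by rewrite gtr0_norm.
- by rewrite normr0.
Qed.

End Spherical.

Section Sphere.
Local Open Scope ereal_scope.
Context {R : realType}.
Notation leb1 := (@lebesgue_measure R).
Notation RR := (measurableTypeR R).

(** The surface density of the sphere in the angles of [sphere_point], cut off to
    the parameter domain; the polar angles 0 and pi, where the sine vanishes, are
    left out in order that the weight be positive on its support. *)
Definition sphere_weight (a : RR * RR) : R :=
  ((0 < a.1 < pi) && (0 <= a.2 <= 2 * pi))%R%:R * sin a.1.

Lemma sphere_weight_ge0 a : (0 <= sphere_weight a)%R.
Proof.
rewrite /sphere_weight; case: (boolP (0 < a.1 < pi)%R) => a1; rewrite ?mul0r//.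
by rewrite mulr_ge0// ltW// sin_gt0_pi.
Qed.

Lemma measurable_sphere_weight : measurable_fun setT sphere_weight.
Proof. by rewrite /sphere_weight; meas. Qed.

(** Polar coordinates twice: in the horizontal plane, and then in the half plane of
    the horizontal radius and the third coordinate. *)
Lemma integral_spherical (k : R3 R -> \bar R) : measurable_fun setT k ->
  (forall p, 0 <= k p) ->
  \int[leb2]_a ((sphere_weight a)%:E * \int[leb1]_r
      (((0 < r)%R%:R * r ^+ 2)%:E * k (smul r (sphere_point a))))
  = \int[leb3]_p k p.
Proof.
move=> mk k0.
have pos (r : R) : (0 <= (0 < r)%R%:R * r)%R by apply: ge0_Mnat => /ltW.
have mks : measurable_fun setT (fun z : (RR * RR) * RR => k (smul z.2 (sphere_point z.1))).
  by meas.
have mw := measurable_sphere_weight.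
rewrite leb2E'/=; last 2 first.
- by meas.
- by nneg; exact: sphere_weight_ge0.
rewrite leb3E'//.
transitivity (\int[leb1]_z \int[leb1]_y
    ((0 <= y <= 2 * pi)%R%:R%:E * \int[leb1]_r (((0 < r)%R%:R * r)%:E *
       k ((r * cos y, r * sin y)%R, z)))); last first.
  apply: eq_integral => z _; rewrite -[RHS](@integral_polar_2pi R (fun q => k (q, z)))//; last by meas.
  apply: eq_integral => y _; rewrite -ge0_integralZl//.
  - by apply: eq_integral => r _; rewrite EFinM muleA.
  - by meas.
  - by nneg.
rewrite [RHS](@leb1_swap R (fun z y => (0 <= y <= 2 * pi)%R%:R%:E * \int[leb1]_r (((0 < r)%R%:R * r)%:E *
       k ((r * cos y, r * sin y)%R, z)))); last 2 first.
- by apply: meas_mule; [meas|apply: meas_int; [meas|by nneg]].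
- by nneg.
apply: eq_integral => y _.
have [yI|yI] := boolP (0 <= y <= 2 * pi)%R; last first.
  rewrite integral0_eq => [|x _]; last by rewrite /sphere_weight/= (negbTE yI) andbF mul0r mul0e.
  by rewrite integral0_eq// => x _; rewrite mul0e.
under [RHS]eq_integral do rewrite mul1e.
pose G (q : RR * RR) := ((0 < q.1)%R%:R * q.1)%:E * k ((q.1 * cos y, q.1 * sin y)%R, q.2).
have mG : measurable_fun setT G by rewrite /G; meas.
have G0 q : 0 <= G q by rewrite /G; nneg.
rewrite -(leb2E' mG G0) -[RHS]integral_polar_pi//; apply: eq_integral => x _.
rewrite -ge0_integralZl//; last 3 first.
- apply: meas_mule; first by meas.
  rewrite /smul /sphere_point/=; by meas.
- by nneg.
- by rewrite lee_fin sphere_weight_ge0.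
apply: eq_integral => r _; rewrite /G /sphere_weight /=.
have [xI|xI] := boolP (0 < x < pi)%R; last by rewrite !mul0r !mul0e.
rewrite yI !mul1r !muleA -!EFinM /smul/= pmulr_lgt0 ?sin_gt0_pi//.
rewrite !mulrA; congr (_%:E * _).
by case: ltP => [r0|]; rewrite ?(mul0r, mulr0)// (gtr0_norm r0); ring.
Qed.

Lemma null_rays_pos (k : R3 R -> \bar R) : measurable_fun setT k ->
  (forall p, 0 <= k p) -> \int[leb3]_p k p = 0 ->
  \int[leb3]_q ((sphere_weight q.1)%:E * ((0 < q.2)%R%:R%:E *
       k (smul q.2 (sphere_point q.1)))) = 0.
Proof.
move=> mk k0 ik.
have mks : measurable_fun setT (fun z : (RR * RR) * RR => k (smul z.2 (sphere_point z.1))).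
  by meas.
have mw := measurable_sphere_weight.
apply: (@integral0_support _ _ _ _ _ (fun q : R3 R => (sphere_weight q.1)%:E *
   (((0 < q.2)%R%:R * q.2 ^+ 2)%:E * k (smul q.2 (sphere_point q.1))))).
- by meas.
- by meas.
- by nneg; exact: sphere_weight_ge0.
- by nneg; exact: sphere_weight_ge0.
- move=> q; case: ltP => [r0|_]; rewrite ?mul0r// mul1r mul1e.
  move=> /eqP; rewrite !mule_eq0 !eqe sqrf_eq0 (gt_eqF r0)/= => /orP[/eqP ->|/eqP ->].
    by rewrite mul0e.
  by rewrite mule0.
rewrite -[RHS]ik -[RHS]integral_spherical// leb3E/=; last 2 first.
- by meas.
- by nneg; exact: sphere_weight_ge0.
apply: eq_integral => a _; rewrite ge0_integralZl//.
- by meas.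
- by nneg.
- by rewrite lee_fin sphere_weight_ge0.
Qed.

(** The density r^2 vanishes only at the origin, so that a null function vanishes
    almost everywhere on almost every line through the origin. The negative half
    of a line is reached through p |-> - p. *)
Lemma null_rays (k : R3 R -> \bar R) : measurable_fun setT k ->
  (forall p, 0 <= k p) -> \int[leb3]_p k p = 0 ->
  \int[leb2]_a ((sphere_weight a)%:E *
      \int[leb1]_r k (smul r (sphere_point a))) = 0.
Proof.
move=> mk k0 ik.
have mks : measurable_fun setT (fun z : (RR * RR) * RR => k (smul z.2 (sphere_point z.1))).
  by meas.
have mw := measurable_sphere_weight.
pose k' (p : R3 R) := k (smul (-1) p).
have mk' : measurable_fun setT k' by rewrite /k'; meas.
have k'0 p : 0 <= k' p by rewrite /k'.
have ik' : \int[leb3]_p k' p = 0.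
  transitivity (\int[leb3]_p k (-1 * p.1.1 + (0 : R3 R).1.1, -1 * p.1.2 + (0 : R3 R).1.2, -1 * p.2 + (0 : R3 R).2)%R).
    by apply: eq_integral => p _; rewrite /k' /smul/= !addr0.
  by rewrite integral_affine3 ?oppr_eq0 ?oner_eq0// ik mule0.
have mk's : measurable_fun setT (fun z : (RR * RR) * RR => k' (smul z.2 (sphere_point z.1))).
  by meas.
have e1 := null_rays_pos mk k0 ik; have e2 := null_rays_pos mk' k'0 ik'.
rewrite leb3E/= in e1; [|by meas|by nneg; exact: sphere_weight_ge0].
rewrite leb3E/= in e2; [|by meas|by nneg; exact: sphere_weight_ge0].
transitivity (\int[leb2]_a ((\int[leb1]_r ((sphere_weight a)%:E * ((0 < r)%R%:R%:E *
       k (smul r (sphere_point a))))) +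
   (\int[leb1]_r ((sphere_weight a)%:E * ((0 < r)%R%:R%:E *
       k' (smul r (sphere_point a))))))); last first.
  rewrite ge0_integralD.
  - by rewrite e1 e2 adde0.
  - exact: measurableT.
  - by nneg; exact: sphere_weight_ge0.
  - by apply: meas_int; [meas|nneg; exact: sphere_weight_ge0].
  - by nneg; exact: sphere_weight_ge0.
  - by apply: meas_int; [meas|nneg; exact: sphere_weight_ge0].
apply: eq_integral => a _.
have w0 : 0 <= (sphere_weight a)%:E by rewrite lee_fin sphere_weight_ge0.
have mr : measurable_fun setT (fun r : RR => k (smul r (sphere_point a))).
  by meas.
have mr' : measurable_fun setT (fun r : RR => k' (smul r (sphere_point a))).
  by meas.
rewrite !ge0_integralZl//; [|by meas|by nneg|by meas|by nneg].
rewrite -ge0_muleDr; [|by nneg|by nneg].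
congr (_ * _).
pose h (r : RR) := (r < 0)%R%:R%:E * k (smul r (sphere_point a)).
have -> : \int[leb1]_r ((0 < r)%R%:R%:E * k' (smul r (sphere_point a)))
   = \int[leb1]_r h r.
  transitivity (\int[leb1]_r h ((-1) * r + 0)%R).
    apply: eq_integral => r _; rewrite /h /k' addr0 mulN1r oppr_lt0.
    by congr (_ * k _); rewrite /smul/= !mulN1r !mulNr.
  rewrite integral_affineV ?oppr_eq0 ?oner_eq0// ?normrN1 ?invr1 ?mul1e//.
  - by rewrite /h; meas.
  - by rewrite /h; nneg.
rewrite integral_off0// -ge0_integralD//; [|by nneg|by meas|by rewrite /h; nneg|by rewrite /h; meas].
apply: eq_integral => r _; rewrite /h -ge0_muleDl// -EFinD.
by case: (ltgtP r 0)%R; rewrite ?addr0 ?add0r.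
Qed.

End Sphere.

(** * Post-collisional velocities and null sets *)

Section NullGain.
Local Open Scope ereal_scope.
Context {R : realType}.
Notation leb1 := (@lebesgue_measure R).
Notation RR := (measurableTypeR R).

Lemma dot_frame a (p : R3 R) : dot (frame a p) (sphere_point a) = p.2.
Proof.
have e1 := cos2Dsin2 a.1; have e2 := cos2Dsin2 a.2.
rewrite /dot /frame /sphere_point/=.
transitivity ((cos a.2 ^+ 2 + sin a.2 ^+ 2) * sin a.1 * (cos a.1 * p.1.1 + sin a.1 * p.2) +
  (cos a.1 * p.2 - sin a.1 * p.1.1) * cos a.1)%R; first by ring.
rewrite e2 mul1r.
transitivity ((cos a.1 ^+ 2 + sin a.1 ^+ 2) * p.2)%R; first by ring.
by rewrite e1 mul1r.
Qed.

Lemma frame_sphere_point a (p : R3 R) :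
  (frame a p - smul p.2 (sphere_point a))%R = frame a (p.1, 0%R) :> R3 R.
Proof.
rewrite /frame /smul /sphere_point/=; congr ((_, _), _) => /=; ring.
Qed.

Lemma integral_reflect3 (e : R3 R) (h : R3 R -> \bar R) :
  measurable_fun setT h -> (forall x, 0 <= h x) ->
  \int[leb3]_p h (e - p)%R = \int[leb3]_p h p.
Proof.
move=> mh h0.
transitivity (\int[leb3]_p h (-1 * p.1.1 + e.1.1, -1 * p.1.2 + e.1.2, -1 * p.2 + e.2)%R).
  apply: eq_integral => -[[p1 p2] p3] _; case: e => -[e1 e2] e3 /=.
  by congr h; congr ((_, _), _) => /=; ring.
rewrite integral_affine3 ?oppr_eq0 ?oner_eq0//.
by rewrite normrN1 invr1 expr1n mul1e.
Qed.

(** For a fixed second angle, all the planes orthogonal to [sphere_point a] contain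
    one horizontal line and are swept by rotation about it. In the coordinates
    position on that line, angle and signed radius, Lebesgue measure has the
    density |r|, which vanishes only on a null set. *)
Lemma null_planes (k : R3 R -> \bar R) : measurable_fun setT k ->
  (forall p, 0 <= k p) -> \int[leb3]_p k p = 0 ->
  \int[leb2]_a ((sphere_weight a)%:E * \int[leb2]_q k (frame a (q, 0%R))) = 0.
Proof.
move=> mk k0 ik; have mw := @measurable_sphere_weight R.
have w0 := @sphere_weight_ge0 R.
have mf : measurable_fun setT (fun z : (RR * RR) * (RR * RR) => k (frame z.1 (z.2, 0%R))).
  by rewrite /frame/=; meas.
have w0' (a : RR * RR) : 0 <= (sphere_weight a)%:E by rewrite lee_fin.
rewrite leb2E'/=; last 2 first.
- by apply: meas_mule; [meas|apply: (@meas_int _ _ _ _ _ _ (fun a q => k (frame a (q, 0%R))))].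
- by move=> a; rewrite mule_ge0//; apply: integral_ge0.
apply: integral0_eq => y _.
pose ky p := k (frame (0%R, y) p).
have mky : measurable_fun setT ky by rewrite /ky /frame/=; meas.
have ky0 p : 0 <= ky p by rewrite /ky.
have iky : \int[leb3]_p ky p = 0 by rewrite /ky integral_frame.
have frameE x (q : R * R) : k (frame (x, y) (q, 0%R)) =
    ky (q.1 * cos x, q.2, - (q.1 * sin x))%R.
  rewrite /ky /frame/= cos0 sin0; congr k; congr ((_, _), _) => /=; ring.
rewrite leb3_swap// in iky.
have {}iky : \int[leb1]_z \int[leb2]_q ky (q.2, z, - q.1)%R = 0.
  rewrite -[RHS]iky; apply: eq_integral => z _.
  rewrite leb2E; [|by meas|by move=> ?].
  rewrite leb2E'; [|by meas|by move=> ?] => /=.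
  transitivity (\int[leb1]_x (fun t => \int[leb1]_s ky (s, z, t)) ((-1) * x + 0)%R).
    by apply: eq_integral => x _; rewrite mulN1r addr0.
  rewrite (@integral_affineV _ (-1) 0%R (fun t => \int[leb1]_s ky (s, z, t))).
  - by rewrite normrN1 invr1 mul1e.
  - by rewrite oppr_eq0 oner_eq0.
  - by meas.
  - by nneg.
have {}iky : \int[leb1]_z \int[leb1]_x \int[leb1]_r
   (((0 < x < pi)%R%:R * `|r|)%:E * ky (r * cos x, z, - (r * sin x))%R) = 0.
  rewrite -[RHS]iky; apply: eq_integral => z _.
  by rewrite -[RHS](integral_polar_pi (G := fun q => ky (q.2, z, - q.1)%R));
   [|by meas|by move=> ?].
pose g (q : R3 R) := ((0 < q.1.2 < pi)%R%:R * `|q.2|)%:E *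
   ky (q.2 * cos q.1.2, q.1.1, - (q.2 * sin q.1.2))%R.
have mg : measurable_fun setT g by rewrite /g; meas.
have g0 q : 0 <= g q by rewrite /g; nneg.
pose f (q : R3 R) := (sphere_weight (q.1.2, y))%:E * ((0 < `|q.2|)%R%:R%:E *
   ky (q.2 * cos q.1.2, q.1.1, - (q.2 * sin q.1.2))%R).
have mff : measurable_fun setT f by rewrite /f; meas.
have f0 q : 0 <= f q by rewrite /f; nneg.
have ig : \int[leb3]_q g q = 0.
  rewrite (leb3E mg g0) leb2E; [exact: iky|by meas|by nneg].
have := integral0_support mff mg f0 g0 _ ig.
rewrite (leb3E mff f0) leb2E; [|by meas|by nneg].
move=> if0; rewrite -[RHS]if0; last first.
  move=> q; rewrite /f /g /sphere_weight/=.
  case: (boolP (0 < q.1.2 < pi)%R) => xI; last by rewrite !mul0r !mul0e.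
  rewrite mul1r; have [->|r0] := eqVneq q.2 0%R.
    by rewrite normr0 ltxx mul0e mule0.
  move/eqP; rewrite mule_eq0 eqe normr_eq0 (negbTE r0)/= => /eqP ->.
  by rewrite !mule0.
rewrite [RHS](@leb1_swap R (fun z x => \int[leb1]_r f (z, x, r))); [|by meas|by nneg].
apply: eq_integral => x _.
under [in LHS]eq_integral do rewrite frameE.
rewrite leb2E'; [|by meas|by move=> ?] => /=.
rewrite -ge0_integralZl; [|exact: measurableT|by meas|by nneg|exact: w0'].
apply: eq_integral => z _.
rewrite integral_off0; [|by meas|by move=> ?].
rewrite -ge0_integralZl.
- by apply: eq_integral => r _; rewrite /f normr_gt0.
- exact: measurableT.
- by meas.
- by move=> r _; rewrite mule_ge0.
- exact: w0'.
Qed.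

(** With z = v - u, the post-collisional velocity v' = v - (z . omega) omega runs
    through a line and u' = v - (z - (z . omega) omega) through a plane, parallel
    respectively orthogonal to omega and containing v. In the rotated coordinates
    whose third axis is omega, the claims become [null_rays] and [null_planes]. *)
Lemma null_gain (v : R3 R) (k : R3 R -> \bar R) : measurable_fun setT k ->
  (forall p, 0 <= k p) -> \int[leb3]_p k p = 0 ->
  \int[leb3]_u \int[leb2]_a ((sphere_weight a)%:E *
     k (post_v v u (sphere_point a))) = 0 /\
  \int[leb3]_u \int[leb2]_a ((sphere_weight a)%:E *
     k (post_u v u (sphere_point a))) = 0.
Proof.
move=> mk k0 ik; have mw := @measurable_sphere_weight R.
have w0 := @sphere_weight_ge0 R.
have w0' (a : RR * RR) : 0 <= (sphere_weight a)%:E by rewrite lee_fin.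
pose k' p := k (v - p)%R.
have mk' : measurable_fun setT k' by rewrite /k'; meas.
have k'0 p : 0 <= k' p by rewrite /k'.
have ik' : \int[leb3]_p k' p = 0 by rewrite /k' integral_reflect3.
have vvz z : (v - (v - z) = z)%R by rewrite opprB addrC subrK.
split.
- rewrite (@integral_swap _ _ _ _ R leb3 leb2 (fun u a => (sphere_weight a)%:E *
     k (post_v v u (sphere_point a)))); last 2 first.
  + by rewrite /post_v; meas.
  + by move=> u a; rewrite mule_ge0.
  apply: (@integral0_support _ _ _ _ _ (fun a => (sphere_weight a)%:E *
      \int[leb1]_r k' (smul r (sphere_point a)))); last exact: null_rays.
  + by rewrite /post_v; meas.
  + by meas.
  + by nneg.
  + by nneg.
  move=> a /eqP; rewrite mule_eq0 eqe => /orP[/eqP wa|/eqP J0].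
    by apply: integral0_eq => u _; rewrite wa mul0e.
  rewrite ge0_integralZl; [|exact: measurableT|by rewrite /post_v; meas|by nneg|exact: w0'].
  transitivity ((sphere_weight a)%:E * \int[leb3]_z k' (smul (dot z (sphere_point a)) (sphere_point a))).
    congr (_ * _).
    rewrite -(@integral_reflect3 v (fun u => k (post_v v u (sphere_point a)))); [|by rewrite /post_v; meas|by move=> ?].
    by apply: eq_integral => z _; rewrite /post_v /k' vvz.
  rewrite -(@integral_frame R a (fun z => k' (smul (dot z (sphere_point a)) (sphere_point a)))); [|by meas|by move=> ?].
  rewrite leb3E; [|by rewrite /frame/=; meas|by move=> ?].
  rewrite (_ : \int[leb2]_x _ = 0) ?mule0//; apply: integral0_eq => q _.
  by rewrite -[RHS]J0; apply: eq_integral => r _; rewrite dot_frame.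
- rewrite (@integral_swap _ _ _ _ R leb3 leb2 (fun u a => (sphere_weight a)%:E *
     k (post_u v u (sphere_point a)))); last 2 first.
  + by rewrite /post_u; meas.
  + by move=> u a; rewrite mule_ge0.
  have mf : measurable_fun setT (fun z : (RR * RR) * (RR * RR) => k' (frame z.1 (z.2, 0%R))).
    by rewrite /frame/=; meas.
  apply: (@integral0_support _ _ _ _ _ (fun a => (sphere_weight a)%:E *
      \int[leb2]_q k' (frame a (q, 0%R)))); last exact: null_planes.
  + by rewrite /post_u; meas.
  + by apply: meas_mule; [meas|apply: (@meas_int _ _ _ _ _ _ (fun a q => k' (frame a (q, 0%R))))].
  + by nneg.
  + by nneg.
  move=> a /eqP; rewrite mule_eq0 eqe => /orP[/eqP wa|/eqP J0].
    by apply: integral0_eq => u _; rewrite wa mul0e.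
  rewrite ge0_integralZl; [|exact: measurableT|by rewrite /post_u; meas|by nneg|exact: w0'].
  transitivity ((sphere_weight a)%:E * \int[leb3]_z k' (z - smul (dot z (sphere_point a)) (sphere_point a))%R).
    congr (_ * _).
    rewrite -(@integral_reflect3 v (fun u => k (post_u v u (sphere_point a)))); [|by rewrite /post_u; meas|by move=> ?].
    apply: eq_integral => z _; rewrite /post_u /k' vvz; congr k.
    by rewrite opprB addrA [RHS]addrAC.
  rewrite -(@integral_frame R a (fun z => k' (z - smul (dot z (sphere_point a)) (sphere_point a))%R)); [|by meas|by move=> ?].
  rewrite leb3E'; [|by rewrite /frame/=; meas|by move=> ?].
  rewrite (_ : \int[leb1]_x _ = 0) ?mule0//; apply: integral0_eq => r _.
  by rewrite -[RHS]J0; apply: eq_integral => q _; rewrite dot_frame frame_sphere_point.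
Qed.

End NullGain.

(** * The angular part of the kernel *)

Section Angular.
Context {R : realType}.
Notation leb1 := (@lebesgue_measure R).
Notation RR := (measurableTypeR R).
Implicit Types (z p : R3 R).

Lemma dotC (x y : R3 R) : dot x y = dot y x.
Proof. by rewrite /dot !(mulrC x.1.1, mulrC x.1.2, mulrC x.2). Qed.

Lemma dot_ge0 z : 0 <= dot z z.
Proof. by rewrite /dot -!expr2 !addr_ge0// sqr_ge0. Qed.

Lemma norm3_ge0 z : 0 <= norm3 z. Proof. exact: sqrtr_ge0. Qed.

Lemma sqr_norm3 z : norm3 z ^+ 2 = dot z z.
Proof. by rewrite sqr_sqrtr// dot_ge0. Qed.

Lemma dot_smul r s (x y : R3 R) : dot (smul r x) (smul s y) = r * s * dot x y.
Proof. by rewrite /dot /smul/=; ring. Qed.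

Lemma norm3_smul r z : norm3 (smul r z) = `|r| * norm3 z.
Proof. by rewrite /norm3 dot_smul -expr2 sqrtrM ?sqr_ge0// sqrtr_sqr. Qed.

Lemma norm3_eq0 z : (norm3 z == 0) = (z == 0).
Proof.
apply/eqP/eqP => [z0|->]; last by rewrite /norm3 /dot/= !mul0r !addr0 sqrtr0.
have : dot z z = 0 by rewrite -sqr_norm3 z0 expr0n.
move: z z0 => [[x y] t] _; rewrite /dot/= -!expr2 => /eqP.
rewrite !paddr_eq0 ?addr_ge0 ?sqr_ge0// !sqrf_eq0.
by move=> /andP[/andP[/eqP -> /eqP ->] /eqP ->].
Qed.

Lemma dot_sphere_point (a : R * R) : dot (sphere_point a) (sphere_point a) = 1.
Proof.
rewrite /dot /sphere_point/=.
transitivity ((cos a.2 ^+ 2 + sin a.2 ^+ 2) * sin a.1 ^+ 2 + cos a.1 ^+ 2); first by ring.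
by rewrite cos2Dsin2 mul1r addrC cos2Dsin2.
Qed.

Lemma dot_frame_frame (a : R * R) p : dot (frame a p) (frame a p) = dot p p.
Proof.
rewrite /dot /frame/=.
transitivity ((cos a.2 ^+ 2 + sin a.2 ^+ 2) * ((cos a.1 * p.1.1 + sin a.1 * p.2) ^+ 2 + p.1.2 ^+ 2)
  + (cos a.1 * p.2 - sin a.1 * p.1.1) ^+ 2); first by ring.
rewrite cos2Dsin2 mul1r.
transitivity ((cos a.1 ^+ 2 + sin a.1 ^+ 2) * (p.1.1 ^+ 2 + p.2 ^+ 2) + p.1.2 ^+ 2); first by ring.
by rewrite cos2Dsin2; ring.
Qed.

Lemma polar_exists (x y : R) : exists t,
  x = Num.sqrt (x ^+ 2 + y ^+ 2) * cos t /\ y = Num.sqrt (x ^+ 2 + y ^+ 2) * sin t.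
Proof.
set r := Num.sqrt _; have r2 : r ^+ 2 = x ^+ 2 + y ^+ 2.
  by rewrite sqr_sqrtr// addr_ge0 ?sqr_ge0.
have [r0|r0] := eqVneq r 0.
  move: r2; rewrite r0 expr0n/= => /esym/eqP.
  rewrite paddr_eq0 ?sqr_ge0// !sqrf_eq0 => /andP[/eqP -> /eqP ->].
  by exists 0; rewrite !mul0r.
have rp : 0 < r by rewrite lt_neqAle eq_sym r0 sqrtr_ge0.
have cb : -1 <= x / r <= 1.
  rewrite ler_pdivlMr// ler_pdivrMr// mulN1r mul1r -ler_norml.
  rewrite -ler_sqr ?nnegrE ?sqrtr_ge0// real_normK ?num_real// r2.
  by rewrite lerDl sqr_ge0.
have sE : r * Num.sqrt (1 - (x / r) ^+ 2) = `|y|.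
  have -> : 1 - (x / r) ^+ 2 = (y / r) ^+ 2.
    rewrite !exprMn -[1](@divff _ (r ^+ 2)) ?expf_neq0// exprVn {1}r2; ring.
  by rewrite sqrtr_sqr normrM normfV (gtr0_norm rp) mulrCA divff ?mulr1.
have [y0|y0] := leP 0 y.
- exists (acos (x / r)); rewrite acosK ?in_itv//= sin_acos// sE ger0_norm//.
  by rewrite mulrCA divff ?mulr1.
- exists (- acos (x / r)); rewrite cosN sinN acosK ?in_itv//= sin_acos//.
  by rewrite mulrN sE ltr0_norm// opprK mulrCA divff ?mulr1.
Qed.

Lemma sphere_point_exists z : exists a, z = smul (norm3 z) (sphere_point a).
Proof.
have [phi [xE yE]] := polar_exists z.1.1 z.1.2.
set rho := Num.sqrt _ in xE yE.
have [th [zE rE]] := polar_exists z.2 rho.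
exists (th, phi); rewrite /smul /sphere_point/=.
have nE : norm3 z = Num.sqrt (z.2 ^+ 2 + rho ^+ 2).
  rewrite /norm3 /dot sqr_sqrtr ?addr_ge0 ?sqr_ge0//; congr Num.sqrt; ring.
rewrite nE !mulrA -rE -zE -xE -yE; by case: (z) => [[]].
Qed.

Lemma dot_sphere_bound z (a : R * R) : -1 <= dot z (sphere_point a) / norm3 z <= 1.
Proof.
have [z0|z0] := eqVneq (norm3 z) 0; first by rewrite z0 invr0 mulr0; lra.
have zp : 0 < norm3 z by rewrite lt_neqAle eq_sym z0 norm3_ge0.
rewrite ler_pdivlMr// ler_pdivrMr// mulN1r mul1r -ler_norml.
rewrite -ler_sqr ?nnegrE ?norm3_ge0// real_normK ?num_real// sqr_norm3.
rewrite -[leRHS]mulr1 -(dot_sphere_point a) -subr_ge0.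
set w := sphere_point a.
have -> : dot z z * dot w w - dot z w ^+ 2 =
  (z.1.1 * w.1.2 - z.1.2 * w.1.1) ^+ 2 + (z.1.1 * w.2 - z.2 * w.1.1) ^+ 2
  + (z.1.2 * w.2 - z.2 * w.1.2) ^+ 2 by rewrite /dot; ring.
by rewrite !addr_ge0 ?sqr_ge0.
Qed.

Section Kernel.
Variables (b : R -> R).
Hypothesis hb : angular_kernel b.

(** [b] as a function of the cosine, extended by 0 in order to be a measurable
    function on the whole line. *)
Definition bcos (c : RR) : R :=
  if (-1 <= c) && (c <= 1) then (b \_ (`[0, pi] : set RR)) (acos c) else 0.

Lemma bcosE c : -1 <= c <= 1 -> bcos c = b (acos c).
Proof.
move=> cI; rewrite /bcos cI patchE mem_set//= in_itv/= acos_ge0//= acos_lepi//.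
Qed.

Lemma measurable_bcos : measurable_fun setT bcos.
Proof.
case: hb => mb _ _.
have -> : bcos = (fun c => (b \_ (`[0, pi] : set RR)) (acos c)) \_ (`[(-1), 1] : set RR).
  apply/funext => c; rewrite /bcos [RHS]patchE; case: ifPn => cI.
    by rewrite mem_set//= in_itv.
  by rewrite memNset//=; apply/negP; rewrite in_itv.
apply/(measurable_restrictT _ _).1 => //.
have mbr : measurable_fun setT (b \_ (`[0, pi] : set RR)).
  exact/(measurable_restrictT _ _).1.
apply: (measurableT_comp mbr).
apply: (@measurable_fun_itv_cc _ _ _ false true).
apply: open_continuous_measurable_fun; first exact: interval_open.
by move=> x; rewrite inE/= in_itv/= => xI; exact: continuous_acos.
Qed.

Lemma bcos_bound : exists2 C, 0 < C & forall c, 0 <= bcos c <= C.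
Proof.
case: hb => _ [C C0 bC] _; exists C => // c; rewrite /bcos.
case: ifPn => [cI|_]; last by rewrite lexx ltW.
have aI : 0 <= acos c <= pi by rewrite acos_ge0//= acos_lepi.
rewrite patchE mem_set//=; have /andP[b0 b1] := bC _ aI; rewrite b0/=.
apply: (le_trans b1); rewrite -[leRHS]mulr1 ler_pM2l// ler_norml.
by rewrite cos_geN1 cos_le1.
Qed.

Lemma bcos_ge0 c : 0 <= bcos c.
Proof. by have [C _ /(_ c)/andP[]] := bcos_bound. Qed.

(** The bound by |cos theta| forces [b] to vanish at the right angle. Since a
    division by zero yields zero, the kernel is then 0 at z = 0. *)
Lemma bcos0 : bcos 0 = 0.
Proof.
rewrite bcosE; last by lra.
case: hb => _ [C C0 bC] _; rewrite acos0.
have pp := @pi_gt0 R; have /bC : 0 <= (pi : R) / 2 <= pi by apply/andP; split; lra.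
by rewrite cos_pihalf normr0 mulr0 -eq_le => /eqP.
Qed.

Lemma kernelBE gamma z (a : R * R) :
  kernelB gamma b z (sphere_point a) =
  norm3 z `^ gamma * bcos (dot z (sphere_point a) / norm3 z).
Proof. by rewrite /kernelB bcosE// dot_sphere_bound. Qed.

Lemma sphere_integralE (g : R3 R -> R) :
  sphere_integral g = \int[leb2]_a (g (sphere_point a) * sphere_weight a).
Proof.
rewrite /sphere_integral Rintegral_mkcond; apply: eq_Rintegral => a _.
rewrite patchE /sphere_weight; case: ifPn => [|].
  rewrite inE/= => -[]; rewrite /= !in_itv/= => /andP[a0 ap] aI.
  rewrite aI andbT; case: (boolP (0 < a.1 < pi)) => [_|]; first by rewrite mul1r.
  rewrite mul0r mulr0 negb_and -!leNgt => /orP[a1|a1].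
    by rewrite (_ : a.1 = 0) ?sin0 ?mulr0//; apply/eqP; rewrite eq_le a1.
  by rewrite (_ : a.1 = pi) ?sinpi ?mulr0//; apply/eqP; rewrite eq_le ap.
move=> aI; case: (boolP (_ && _)) => [/andP[/andP[a0 ap] a2]|]; last by rewrite mul0r mulr0.
by move/negP: aI; rewrite inE/=; case; split; rewrite /= in_itv//= !ltW.
Qed.

Local Open Scope ereal_scope.

Definition ball_bcos : \bar R :=
  \int[leb3]_p ((dot p p <= 1)%R%:R * bcos (p.2 / norm3 p))%:E.

Definition radial_mass : \bar R :=
  \int[leb1]_r ((0 < r)%R%:R * r ^+ 2 * (r ^+ 2 <= 1)%R%:R)%:E.

(** In polar coordinates, the integral of an angular function over the unit ball is
    the product of its mass on the sphere and of a radial mass, while the integral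
    over the ball does not depend on the direction of z, by rotation invariance. *)
Lemma sphere_bcos_mass z : z != 0%R ->
  (\int[leb2]_a (sphere_weight a * bcos (dot z (sphere_point a) / norm3 z))%:E) *
  radial_mass = ball_bcos.
Proof.
move=> z0; have mw := @measurable_sphere_weight R; have mb := measurable_bcos.
have w0 := @sphere_weight_ge0 R; have b0 := bcos_ge0.
have nz0 : norm3 z != 0%R by rewrite norm3_eq0.
have [a zE] := sphere_point_exists z.
pose k p := ((dot p p <= 1)%R%:R * bcos (dot z p / (norm3 z * norm3 p)))%:E.
have mk : measurable_fun setT k by rewrite /k /norm3; meas.
have k0 p : 0 <= k p by rewrite /k; nneg.
have mwb : measurable_fun setT
    (fun a => (sphere_weight a * bcos (dot z (sphere_point a) / norm3 z))%:E).
  by rewrite /norm3; meas.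
transitivity (\int[leb3]_p k p); last first.
  rewrite -(integral_frame a mk k0); apply: eq_integral => p _.
  rewrite /k dot_frame_frame /ball_bcos; congr (_ * bcos _)%:E.
  rewrite [in dot z _]zE -[frame a p](_ : smul 1 (frame a p) = _); last first.
    by rewrite /smul !mul1r; case: (frame a p) => [[]].
  rewrite dot_smul mulr1 dotC dot_frame norm3_smul normr1 mul1r /norm3 dot_frame_frame.
  by rewrite -/(norm3 z) -/(norm3 p) invfM mulrACA divff ?mul1r.
rewrite -(integral_spherical mk k0).
rewrite muleC -ge0_integralZl; [|exact: measurableT|exact: mwb|by nneg|by rewrite /radial_mass; nneg].
apply: eq_integral => c _.
rewrite EFinM muleCA; congr (_ * _).
rewrite /radial_mass muleC -ge0_integralZl.
- apply: eq_integral => r _; rewrite -EFinM /k.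
  case: ltP => [r0|_]; last by rewrite !mul0r mulr0 mul0e.
  rewrite dot_smul dot_sphere_point mulr1 -expr2 norm3_smul (gtr0_norm r0).
  have -> : norm3 (sphere_point c) = 1%R by rewrite /norm3 dot_sphere_point sqrtr1.
  rewrite mulr1 mul1r -EFinM.
  have -> : dot z (smul r (sphere_point c)) = (r * dot z (sphere_point c))%R.
    by rewrite /dot /smul/=; ring.
  rewrite (_ : r * _ / _ = dot z (sphere_point c) / norm3 z)%R; last by field; rewrite nz0 gt_eqF.
  by congr EFin; ring.
- exact: measurableT.
- by meas.
- by nneg.
- by rewrite lee_fin.
Qed.

End Kernel.
End Angular.

Section Constants.
Context {R : realType}.
Notation leb1 := (@lebesgue_measure R).
Notation RR := (measurableTypeR R).
Local Open Scope ereal_scope.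

Lemma integral_segment (a c : R) : (a <= c)%R ->
  \int[leb1]_x ((a <= x <= c)%R%:R%:E) = (c - a)%:E.
Proof.
move=> ac; transitivity (\int[leb1]_x (\1_(`[a, c]%classic : set RR) x)%:E).
  apply: eq_integral => x _; rewrite indicE; congr (nat_of_bool _)%:R%:E.
  by apply/idP/idP; rewrite inE/= in_itv.
rewrite integral_indic// setIT -[LHS]/(lebesgue_measure _) lebesgue_measure_itv/= lte_fin.
case: ltP => [_|ca]; first by rewrite EFinB.
by have -> : a = c; [apply/eqP; rewrite eq_le ac|rewrite subrr].
Qed.

Lemma sphere_area_fin : \int[leb2]_a (@sphere_weight R a)%:E <= (2 * pi * pi)%:E.
Proof.
have pp := @pi_gt0 R.
pose h (a : RR * RR) := (((0 <= a.1 <= pi)%R%:R)%:E * ((0 <= a.2 <= 2 * pi)%R%:R)%:E : \bar R).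
have mh : measurable_fun setT h by rewrite /h; meas.
have h0 a : 0 <= h a by rewrite /h; nneg.
apply: (@le_trans _ _ (\int[leb2]_a h a)).
  apply: le_integral_dom => a _; first by rewrite lee_fin sphere_weight_ge0.
  rewrite /h -EFinM lee_fin /sphere_weight.
  case: (boolP (0 < a.1 < pi)%R) => [/andP[x0 xp]|_]; last by rewrite mul0r; nneg.
  rewrite (ltW x0) (ltW xp)/= mul1r ler_piMr// ?sin_le1//.
rewrite (leb2E mh h0) /h/=.
under eq_integral.
  move=> x _; rewrite ge0_integralZl; [|exact: measurableT|by meas|by nneg|by rewrite lee_fin].
  by rewrite integral_segment ?subr0//; [over|lra].
rewrite ge0_integralZr; [|exact: measurableT|by meas|by nneg|by rewrite lee_fin; lra].
by rewrite integral_segment ?subr0 -?EFinM ?lee_fin ?(mulrC pi)//; lra.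
Qed.

Lemma radial_mass_gt0 : 0 < @radial_mass R.
Proof.
apply: (@lt_le_trans _ _ ((1 / 8)%:E)); first by rewrite lte_fin; lra.
apply: (@le_trans _ _ (\int[leb1]_r ((1/4)%:E * ((1/2 <= r <= 1)%R%:R%:E)))).
  rewrite ge0_integralZl; [|exact: measurableT|by meas|by nneg|by rewrite lee_fin; lra].
  by rewrite integral_segment -?EFinM ?lee_fin; lra.
apply: le_integral_dom => r _; first by rewrite -EFinM lee_fin mulr_ge0//; lra.
rewrite -EFinM lee_fin; case: (boolP (1/2 <= r <= 1)%R) => [/andP[r1 r2]|_]; last first.
  by rewrite mulr0; nneg.
have r0 : (0 < r)%R by lra.
have rr : (r ^+ 2 <= 1)%R by rewrite expr_le1// ltW.
have h : (1/2 * (1/2) <= r * r)%R by apply: ler_pM; lra.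
by rewrite r0 rr !mulr1 -[true%:R]/(1%R) !mul1r expr2 (le_trans _ h)//; lra.
Qed.

Lemma radial_mass_fin : @radial_mass R < +oo.
Proof.
apply: (@le_lt_trans _ _ (\int[leb1]_r (((0 <= r <= 1)%R%:R)%:E))); last first.
  by rewrite integral_segment// ltry.
apply: le_integral_dom => r _; first by rewrite lee_fin; nneg.
rewrite lee_fin; have [r0|r0] := ltP 0%R r; last by rewrite !mul0r; nneg.
rewrite mul1r (ltW r0)/=; have [r1|r1] := leP r 1%R.
  have rr : (r ^+ 2 <= 1)%R by rewrite expr_le1// ltW.
  by rewrite rr mulr1.
rewrite (_ : (r ^+ 2 <= 1)%R = false) ?mulr0//; apply/negbTE; rewrite -ltNge.
by rewrite expr2; apply: (lt_trans r1); rewrite ltr_pMr.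
Qed.

(** The mass does not depend on the direction by [sphere_bcos_mass]. It is positive:
    in the direction of the third axis the polar angle is theta itself, and a zero
    mass would make [b] vanish almost everywhere. *)
Lemma angular_mass (b : R -> R) : angular_kernel b -> exists2 c : R, (0 < c)%R &
  forall z : R3 R, z != 0%R ->
  \int[leb2]_a (sphere_weight a * bcos b (dot z (sphere_point a) / norm3 z))%:E = c%:E.
Proof.
move=> hb; have mw := @measurable_sphere_weight R; have mb := measurable_bcos hb.
have w0 := @sphere_weight_ge0 R; have b0 := bcos_ge0 hb.
have mass := sphere_bcos_mass hb; have [C C0 bC] := bcos_bound hb.
have m0 := radial_mass_gt0; have moo := radial_mass_fin.
pose I (z : R3 R) := \int[leb2]_a (sphere_weight a * bcos b (dot z (sphere_point a) / norm3 z))%:E.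
pose e3 : R3 R := (0, 0, 1)%R.
have e30 : e3 != 0%R.
  by apply/eqP => -[] /eqP; rewrite oner_eq0.
have Ioo : I e3 < +oo.
  apply: (@le_lt_trans _ _ (C%:E * \int[leb2]_a (@sphere_weight R a)%:E)).
    rewrite -ge0_integralZl; [|exact: measurableT|by meas|by nneg|by rewrite lee_fin ltW].
    apply: le_integral_dom => a _; first by rewrite lee_fin mulr_ge0.
    by rewrite -EFinM lee_fin mulrC ler_wpM2r// (andP (bC _)).2.
  apply: (@le_lt_trans _ _ (C%:E * (2 * pi * pi)%:E)); last by rewrite -EFinM ltry.
  by apply: lee_wpmul2l; [rewrite lee_fin ltW|exact: sphere_area_fin].
have I0 : 0 <= I e3 by rewrite /I; nneg.
have In0 : I e3 != 0.
  apply/eqP => Iz; case: hb => mbb [C' _ _]; apply.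
  have cosE (a : RR * RR) : (dot e3 (sphere_point a) / norm3 e3 = cos a.1)%R.
    by rewrite /norm3 /dot /e3/= !mul0r !add0r !mul1r sqrtr1 divr1.
  pose g (a : RR * RR) := (sphere_weight a * bcos b (cos a.1))%:E.
  have mg : measurable_fun setT g by rewrite /g; meas.
  have g0 a : 0 <= g a by rewrite /g; nneg.
  have ig : \int[leb2]_a g a = 0.
    by rewrite -[RHS]Iz; apply: eq_integral => a _; rewrite /g cosE.
  rewrite (leb2E mg g0) in ig.
  have mG : measurable_fun setT (fun x => \int[leb1]_y g (x, y)) by meas.
  have aeg : {ae leb1, forall x, \int[leb1]_y g (x, y) = 0}.
    exact: (integral0_ae mG (fun x => integral_ge0 _ (fun y _ => g0 _)) ig).
  have aepi : {ae leb1, forall x : RR, x != 0%R /\ x != pi}.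
    have cS : countable ([set 0%R; pi] : set RR).
      by apply: finite_set_countable; rewrite finite_setU; split; exact: finite_set1.
    exists [set 0%R; pi]; split.
    - exact: countable_measurable.
    - exact: countable_lebesgue_measure0.
    - move=> x /= /not_andP[/negP|/negP]; rewrite negbK => /eqP ->; [by left|by right].
  have pp := @pi_gt0 R.
  apply: (filterS2 _ _ aeg aepi) => x gx [x0 xp] /andP[x0' xp'].
  have xI : (0 < x < pi)%R by rewrite lt_neqAle eq_sym x0 x0' lt_neqAle xp xp'.
  have bE : bcos b (cos x) = b x.
    by rewrite bcosE ?cosK ?in_itv/= ?x0' ?xp'// cos_geN1 cos_le1.
  have sb0 : (0 <= sin x * b x)%R by apply: mulr_ge0; [rewrite ltW ?sin_gt0_pi|rewrite -bE; exact: b0].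
  have : \int[leb1]_y ((sin x * b x)%:E * ((0 <= y <= 2 * pi)%R%:R%:E)) = 0.
    rewrite -[RHS]gx; apply: eq_integral => y _.
    rewrite /g /sphere_weight/= xI/= bE -EFinM; congr EFin; ring.
  rewrite ge0_integralZl; [|exact: measurableT|by meas|by nneg|by rewrite lee_fin].
  rewrite integral_segment; last by lra.
  rewrite -EFinM => -[] /eqP; rewrite !mulf_eq0 subr0 (gt_eqF (sin_gt0_pi xI))/=.
  by rewrite mulf_eq0 (gt_eqF pp) pnatr_eq0 !orbF => /eqP.
have Ifin : I e3 = (fine (I e3))%:E by rewrite fineK// ge0_fin_numE.
exists (fine (I e3)); first by rewrite fine_gt0// Ioo lt0e In0 I0.
move=> z z0; rewrite -Ifin; apply/eqP.
have mfin : @radial_mass R \is a fin_num by rewrite ge0_fin_numE// ltW.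
rewrite -/(I z).
have e : I z * radial_mass = I e3 * radial_mass by rewrite (mass _ z0) (mass _ e30).
by rewrite eq_le; apply/andP; split; rewrite -(lee_pmul2r mfin m0)/= e.
Qed.

(** Monotone convergence along the intervals [1 / (n + 2), 1], on which the
    fundamental theorem of calculus applies. *)
Lemma powR_integral_fin (p : R) : (-1 < p)%R ->
  \int[leb1]_r ((0 < r <= 1)%R%:R * r `^ p)%:E < +oo.
Proof.
move=> p1; have q0 : (0 < p + 1)%R by lra.
pose F n : set RR := `[(n.+2%:R)^-1%R, 1%R]%classic.
have FU : \bigcup_n F n = `]0%R, 1%R]%classic.
  apply/seteqP; split => [x [n _]|x] /=; rewrite /F/= !in_itv/= => /andP[x0 x1].
    by rewrite x1 andbT (lt_le_trans _ x0)// invr_gt0 ltr0n.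
  exists (Num.truncn x^-1) => //=; rewrite in_itv/= x1 andbT.
  rewrite -[leRHS]invrK lef_pV2 ?posrE ?invr_gt0 ?ltr0n//.
  have xi : (0 <= x^-1)%R by rewrite invr_ge0 ltW.
  have /andP[_ /ltW h] := truncn_itv xi.
  by rewrite (le_trans h)// ler_nat.
have -> : \int[leb1]_r ((0 < r <= 1)%R%:R * r `^ p)%:E =
    \int[leb1]_(r in \bigcup_n F n) (r `^ p)%:E.
  rewrite FU [RHS]integral_mkcond; apply: eq_integral => x _; rewrite patchE.
  case: ifPn; rewrite ?notin_setE ?inE/= in_itv/=; first by move=> ->; rewrite mul1r.
  by move=> /negP/negbTE ->; rewrite mul0r.
have mpw : measurable_fun setT (fun r : RR => (r `^ p)%:E) by meas.
have := @ge0_nondecreasing_set_cvg_integral _ _ _ F (fun r : RR => (r `^ p)%:E) leb1.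
move=> /(_ _ _ _ _) cv.
have {}cv : \int[leb1]_(x in F i) (x `^ p)%:E @[i --> \oo] --> \int[leb1]_(x in \bigcup_i F i) (x `^ p)%:E.
  apply: cv.
  - apply/nondecreasing_seqP => n; rewrite subsetEset => x; rewrite /F/= !in_itv/= => /andP[h ->].
    by rewrite andbT (le_trans _ h)// lef_pV2 ?posrE ?ltr0n// ler_nat.
  - by move=> n; exact: measurable_itv.
  - by move=> n; exact: measurable_funTS.
  - by move=> n x _; rewrite lee_fin powR_ge0.
apply: (@le_lt_trans _ _ ((p + 1)^-1)%:E); last exact: ltry.
rewrite -(cvg_lim _ cv)//; apply: lime_le; first by apply/cvg_ex; eexists; exact: cv.
apply: nearW => n; rewrite /F.
have e0 : (0 < (n.+2%:R : R)^-1)%R by rewrite invr_gt0 ltr0n.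
have e1 : ((n.+2%:R : R)^-1 < 1)%R by rewrite invf_lt1 ?ltr0n// ltr1n.
set e := (n.+2%:R)^-1%R in e0 e1 *.
have pos x : x \in `[e, 1%R] -> (0 < x)%R.
  by rewrite in_itv/= => /andP[ex _]; exact: lt_le_trans ex.
have cpow (s x : R) : (0 < x)%R -> {for x, continuous (fun y : R => (y `^ s)%R)}.
  move=> x0; apply: differentiable_continuous; apply/derivable1_diffP.
  by apply: derivable_powR; rewrite in_itv/= x0.
rewrite (@continuous_FTC2 _ _ (fun r => (p + 1)^-1 * r `^ (p + 1))%R).
- rewrite -EFinB lee_fin powR1 mulr1 gerBl mulr_ge0 ?powR_ge0// invr_ge0 ltW//.
- exact: e1.
- by apply: continuous_in_subspaceT => x /set_mem/= xI; apply: cpow; exact: pos.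
- have dF x : (0 < x)%R -> derivable (fun r => (p + 1)^-1 * r `^ (p + 1))%R x 1.
    by move=> x0; apply: derivableM => //; apply: derivable_powR; rewrite in_itv/= x0.
  have cF x : (0 < x)%R -> {for x, continuous (fun r => (p + 1)^-1 * r `^ (p + 1))%R}.
    by move=> x0; apply: differentiable_continuous; apply/derivable1_diffP; exact: dF.
  split.
  + by move=> x xI; apply: dF; apply: pos; exact: subset_itv_oo_cc.
  + by apply: cvg_at_right_filter; exact: cF.
  + by apply: cvg_at_left_filter; exact: cF.
- move=> x xI; have x0 : (0 < x)%R by apply: pos; exact: subset_itv_oo_cc.
  rewrite derive1E deriveZ/=; last by apply: derivable_powR; rewrite in_itv/= x0.
  rewrite -derive1E powR_derive1 ?in_itv/= ?x0// addrK /GRing.scale/= mulrA mulVf ?mul1r//.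
  by rewrite gt_eqF.
Qed.

End Constants.

(** * Gaussian integrals and the collision frequency *)

Section Gaussian.
Context {R : realType}.
Notation leb1 := (@lebesgue_measure R).
Notation RR := (measurableTypeR R).
Implicit Types (u v z : R3 R).
Local Open Scope ereal_scope.

Lemma integral_gauss1 (c : R) : (0 < c)%R ->
  \int[leb1]_x (expR (- (c * x ^+ 2)))%:E = (Num.sqrt (pi / c))%:E.
Proof.
move=> c0; have s0 : (0 < Num.sqrt c)%R by rewrite sqrtr_gt0.
transitivity (\int[leb1]_x (gauss_fun (Num.sqrt c * x + 0))%:E).
  by apply: eq_integral => x _; rewrite /gauss_fun addr0 exprMn sqr_sqrtr// ltW.
rewrite (@integral_affineV _ (Num.sqrt c) 0%R (fun x => (gauss_fun x)%:E)).
- rewrite integralT_gauss -EFinM gtr0_norm// mulrC sqrtrM ?pi_ge0// sqrtrV//.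
  exact: ltW.
- by rewrite gt_eqF.
- by apply/measurable_EFinP; exact: measurable_gauss_fun.
- by move=> x; rewrite lee_fin gauss_fun_ge0.
Qed.

Lemma integral_gauss3 (c : R) : (0 < c)%R ->
  \int[leb3]_u (expR (- (c * dot u u)))%:E = (Num.sqrt (pi / c) ^+ 3)%:E.
Proof.
move=> c0; set s := Num.sqrt _.
have s0 : 0 <= s%:E by rewrite lee_fin sqrtr_ge0.
have fE u : (expR (- (c * dot u u)))%:E = (expR (- (c * u.1.1 ^+ 2)))%:E *
   (expR (- (c * u.1.2 ^+ 2)))%:E * (expR (- (c * u.2 ^+ 2)))%:E :> \bar R.
  by rewrite -!EFinM -!expRD /dot; congr (expR _)%:E; ring.
under eq_integral do rewrite fE.
rewrite leb3E; [|by meas|by nneg].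
transitivity (\int[leb2]_q (s%:E * ((expR (- (c * q.1 ^+ 2)))%:E * (expR (- (c * q.2 ^+ 2)))%:E))).
  apply: eq_integral => q _ /=; rewrite ge0_integralZl; [|exact: measurableT|by meas|by nneg|by nneg].
  by rewrite integral_gauss1// muleC.
rewrite ge0_integralZl; [|exact: measurableT|by meas|by nneg|exact: s0].
rewrite leb2E; [|by meas|by nneg] => /=.
transitivity (s%:E * \int[leb1]_x (s%:E * (expR (- (c * x ^+ 2)))%:E)).
  congr (_ * _); apply: eq_integral => x _.
  rewrite ge0_integralZl; [|exact: measurableT|by meas|by nneg|by nneg].
  by rewrite integral_gauss1// muleC.
rewrite ge0_integralZl; [|exact: measurableT|by meas|by nneg|exact: s0].
by rewrite integral_gauss1// -!EFinM; congr EFin; rewrite -/s; ring.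
Qed.

Lemma maxwellian_gt0 v : (0 < maxwellian v)%R.
Proof. by rewrite /maxwellian mulr_gt0 ?expR_gt0// powR_gt0// mulr_gt0// pi_gt0. Qed.

Lemma integral_maxwellian : \int[leb3]_v (@maxwellian R v)%:E = 1.
Proof.
have pp := @pi_gt0 R.
transitivity (((2 * pi : R) `^ (- (3 / 2)))%R%:E * \int[leb3]_u (expR (- (2^-1 * dot u u)))%:E).
  rewrite -ge0_integralZl; [|exact: measurableT|by meas|by nneg|by nneg].
  by apply: eq_integral => v _; rewrite -EFinM /maxwellian (mulrC 2^-1%R).
rewrite integral_gauss3// -EFinM; congr EFin.
rewrite invrK (mulrC pi) powRN.
have -> : ((2 * pi : R) `^ (3 / 2) = Num.sqrt (2 * pi) ^+ 3)%R.
  rewrite -powR12_sqrt ?mulr_ge0 ?ltW// -powR_mulrn ?powR_ge0// -powRrM mulrC.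
  by congr (_ `^ _)%R; rewrite mulrC.
by rewrite mulVf// expf_neq0// gt_eqF// sqrtr_gt0 mulr_gt0.
Qed.

Lemma powR2pi_le1 : ((2 * pi : R) `^ (- (3 / 2)) <= 1)%R.
Proof.
have pp := @pi_gt0 R; have p2 := @pi_ge2 R.
rewrite powRN invf_le1 ?powR_gt0 ?mulr_gt0//.
by rewrite -[leLHS](@powRr0 _ (2 * pi)) ler_powR//; lra.
Qed.

Lemma maxwellian_le v : (maxwellian v <= expR (- (2^-1 * dot v v)))%R.
Proof.
rewrite /maxwellian (mulrC 2^-1%R) -[leRHS]mul1r ler_wpM2r ?expR_ge0//.
exact: powR2pi_le1.
Qed.

Lemma sqrt_maxwellian_le v : (Num.sqrt (maxwellian v) <= expR (- (4^-1 * dot v v)))%R.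
Proof.
rewrite -[leRHS]ger0_norm ?expR_ge0// -sqrtr_sqr ler_wsqrtr//.
rewrite (le_trans (maxwellian_le v))// -expRM_natl ler_expR; lra.
Qed.

Lemma sing_integral_fin (gamma : R) : (-3 < gamma)%R ->
  \int[leb3]_z ((0 < norm3 z <= 1)%R%:R * norm3 z `^ gamma)%:E < +oo.
Proof.
move=> g3; have mw := @measurable_sphere_weight R; have w0 := @sphere_weight_ge0 R.
pose k z := ((0 < norm3 z <= 1)%R%:R * norm3 z `^ gamma)%:E : \bar R.
have mk : measurable_fun setT k by rewrite /k /norm3; meas.
have k0 z : 0 <= k z by rewrite /k; nneg.
rewrite -[X in X < _]/(\int[leb3]_z k z) -(integral_spherical mk k0).
pose J := \int[leb1]_r ((0 < r <= 1)%R%:R * r `^ (gamma + 2))%:E.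
have Joo : J < +oo by apply: powR_integral_fin; lra.
have J0 : 0 <= J by rewrite /J; nneg.
have JE : J = (fine J)%:E by rewrite fineK// ge0_fin_numE.
apply: (@le_lt_trans _ _ (\int[leb2]_a ((sphere_weight a)%:E * J))).
  apply: le_integral_dom => a _; first by nneg; exact: w0.
  apply: lee_wpmul2l; first by rewrite lee_fin.
  apply: le_integral_dom => r _; first by nneg; exact: k0.
  rewrite /k norm3_smul (_ : norm3 (sphere_point a) = 1%R); last first.
    by rewrite /norm3 dot_sphere_point sqrtr1.
  rewrite mulr1 -EFinM lee_fin; have [r0|r0] := ltP 0%R r; last first.
    by rewrite !mul0r; nneg.
  rewrite (gtr0_norm r0) r0/= mul1r mulrCA ler_wpM2l// powRD; last first.
    by rewrite (gt_eqF r0) implybT.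
  by rewrite (powR_mulrn _ (ltW r0)) mulrC lexx.
rewrite JE ge0_integralZr; [|exact: measurableT|by meas|by nneg; exact: w0|by rewrite lee_fin fine_ge0].
apply: (@le_lt_trans _ _ ((2 * pi * pi)%:E * (fine J)%:E)); last by rewrite -EFinM ltry.
by apply: lee_wpmul2r; [rewrite lee_fin fine_ge0|exact: sphere_area_fin].
Qed.

Lemma powR_le_sing (gamma : R) z : (gamma <= 1)%R ->
  (norm3 z `^ gamma <= 1 + norm3 z + (0 < norm3 z <= 1)%R%:R * norm3 z `^ gamma)%R.
Proof.
move=> g1; have n0 := norm3_ge0 z; set r := norm3 z in n0 *.
have [r1|r1] := leP r 1%R.
  move: n0; rewrite le_eqVlt => /predU1P[<-|rp]; last first.
    by rewrite rp/= mul1r lerDr addr_ge0// ltW.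
  rewrite ltxx mul0r !addr0; have [->|g0] := eqVneq gamma 0%R; first by rewrite powRr0.
  by rewrite powR0.
rewrite andbF mul0r addr0; apply: (@le_trans _ _ r); last by rewrite lerDr.
by rewrite ler1_powR// ltW.
Qed.

Lemma one_add_le_expR (c q : R) : (0 < c <= 1)%R -> (0 <= q)%R ->
  (1 + q <= c^-1 * expR (c * q))%R.
Proof.
move=> /andP[c0 c1] q0; rewrite mulrC ler_pdivlMr//.
by apply: le_trans (expR_ge1Dx _); nra.
Qed.

Lemma dot_sub_le u v : (dot (v - u) (v - u) <= 2 * dot v v + 2 * dot u u)%R.
Proof.
rewrite -subr_ge0.
have -> : (2 * dot v v + 2 * dot u u - dot (v - u) (v - u) = dot (v + u) (v + u))%R.
  by rewrite /dot/=; ring.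
exact: dot_ge0.
Qed.

(** For |z| <= 1 the singularity |z|^gamma is integrable because gamma > -3; for
    |z| >= 1 it is at most |z| because gamma <= 1, and the resulting growth in u is
    absorbed by the Gaussian. *)
Lemma kappa_bound (gamma : R) : (-3 < gamma <= 1)%R ->
  exists2 C : R, (0 < C)%R & forall v,
  \int[leb3]_u (norm3 (v - u) `^ gamma * expR (- (4^-1 * dot u u)))%:E
  <= (C * (1 + dot v v))%:E.
Proof.
move=> /andP[g3 g1].
have Soo := sing_integral_fin g3.
set S := (X in X < +oo) in Soo.
have S0 : 0 <= S by rewrite /S /norm3; nneg.
have SE : S = (fine S)%:E by rewrite fineK// ge0_fin_numE.
set G := (Num.sqrt (pi / 8^-1) ^+ 3 : R)%R.
have G0 : (0 < G)%R by rewrite exprn_gt0// sqrtr_gt0 divr_gt0// pi_gt0.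
have fS0 : (0 <= fine S)%R by rewrite fine_ge0.
exists (16 * G + fine S)%R; first by apply: ltr_wpDr => //; lra.
move=> v; have qv := dot_ge0 v.
pose sg z := ((0 < norm3 z <= 1)%R%:R * norm3 z `^ gamma)%R.
have msg : measurable_fun setT (sg : R3 R -> RR).
  by rewrite /sg /norm3; meas.
have sg0 z : (0 <= sg z)%R by rewrite /sg; nneg.
apply: (@le_trans _ _ (\int[leb3]_u ((16 * (1 + dot v v))%:E * (expR (- (8^-1 * dot u u)))%:E
   + (sg (v - u)%R)%:E))).
  apply: le_integral_dom => u _; first by rewrite lee_fin; nneg.
  rewrite -EFinM -EFinD lee_fin.
  have qu := dot_ge0 u; set z := (v - u)%R.
  have := powR_le_sing z g1; rewrite -/(sg z) => pz.
  (* |z| <= 1 + |z|^2 and |v - u|^2 <= 2 |v|^2 + 2 |u|^2 *)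
have nz : (norm3 z <= 1 + 2 * dot v v + 2 * dot u u)%R.
    have := dot_sub_le u v; rewrite -/z -sqr_norm3 => h.
    have := sqr_ge0 (norm3 z - 1)%R; rewrite sqrrB1 => h'.
    have n0 := norm3_ge0 z; nra.
  have ep : (0 < expR (- (4^-1 * dot u u)))%R by exact: expR_gt0.
  have ele : (expR (- (4^-1 * dot u u)) <= 1)%R by rewrite expR_le1 oppr_le0 mulr_ge0.
  apply: (@le_trans _ _ ((1 + norm3 z) * expR (- (4^-1 * dot u u)) + sg z)%R).
    apply: (@le_trans _ _ ((1 + norm3 z + sg z) * expR (- (4^-1 * dot u u)))%R).
      by rewrite ler_wpM2r// ltW.
    by rewrite mulrDl lerD2l ler_piMr.
  rewrite lerD2r.
  have eE : (expR (- (8^-1 * dot u u)) = expR (8^-1 * dot u u) * expR (- (4^-1 * dot u u)))%R.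
    by rewrite -expRD; congr expR; lra.
  rewrite eE mulrA ler_pM2r//.
  have h8 : (1 + dot u u <= 8^-1^-1 * expR (8^-1 * dot u u))%R.
    by apply: one_add_le_expR => //; apply/andP; split; lra.
  rewrite invrK in h8.
  apply: (@le_trans _ _ (2 * (1 + dot v v) * (1 + dot u u))%R); first nra.
  have -> : (16 * (1 + dot v v) * expR (8^-1 * dot u u) =
     2 * (1 + dot v v) * (8 * expR (8^-1 * dot u u)))%R by ring.
  by rewrite ler_wpM2l//; lra.
rewrite ge0_integralD; [|exact: measurableT|by nneg; lra|by meas|by nneg|by meas].
rewrite ge0_integralZl; [|exact: measurableT|by meas|by nneg|by rewrite lee_fin; lra].
rewrite integral_gauss3; last by lra.
rewrite (@integral_reflect3 R v (fun z => (sg z)%:E)); [|by meas|by move=> z; rewrite lee_fin].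
rewrite -/S SE -EFinM -EFinD lee_fin -/G; nra.
Qed.

End Gaussian.

Section CollisionFrequency.
Context {R : realType}.
Notation leb1 := (@lebesgue_measure R).
Notation RR := (measurableTypeR R).
Implicit Types (u v z : R3 R).
Local Open Scope ereal_scope.

Definition box (s : R) u : bool :=
  [&& (s - 4^-1 <= u.1.1 <= s + 4^-1)%R, (0 <= u.1.2 <= 1)%R & (0 <= u.2 <= 1)%R].

Lemma integral_box s : \int[leb3]_u (box s u)%:R%:E = (2^-1)%:E.
Proof.
rewrite /box leb3E; [|by meas|by nneg].
transitivity (\int[leb2]_q ((s - 4^-1 <= q.1 <= s + 4^-1)%R && (0 <= q.2 <= 1)%R)%:R%:E).
  apply: eq_integral => q _ /=.
  transitivity (((s - 4^-1 <= q.1 <= s + 4^-1)%R && (0 <= q.2 <= 1)%R)%:R%:E *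
     \int[leb1]_y (0 <= y <= 1)%R%:R%:E).
    rewrite -ge0_integralZl; [|exact: measurableT|by meas|by nneg|by nneg].
    by apply: eq_integral => y _; rewrite -EFinM -natrM mulnb andbA.
  by rewrite integral_segment// subr0 mule1.
rewrite leb2E; [|by meas|by nneg] => /=.
transitivity (\int[leb1]_x ((s - 4^-1 <= x <= s + 4^-1)%R)%:R%:E).
  apply: eq_integral => x _.
  transitivity (((s - 4^-1 <= x <= s + 4^-1)%R)%:R%:E * \int[leb1]_y (0 <= y <= 1)%R%:R%:E).
    rewrite -ge0_integralZl; [|exact: measurableT|by meas|by nneg|by nneg].
    by apply: eq_integral => y _; rewrite -EFinM -natrM mulnb.
  by rewrite integral_segment// subr0 mule1.
rewrite integral_segment; last by lra.
by congr EFin; lra.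
Qed.

Lemma powR_lower (gamma r : R) : (-3 < gamma <= 1)%R -> (2^-1 <= r)%R ->
  (2^-1 / (1 + r ^+ 2) ^+ 2 <= r `^ gamma)%R.
Proof.
move=> /andP[g3 g1] r2; have r0 : (0 < r)%R by lra.
have d1 : (1 <= 1 + r ^+ 2)%R by rewrite lerDl sqr_ge0.
have D1 : (1 <= (1 + r ^+ 2) ^+ 2)%R by rewrite exprn_ege1.
have D0 : (0 < (1 + r ^+ 2) ^+ 2)%R by apply: lt_le_trans D1.
have [r1|r1] := leP 1%R r; last first.
  apply: (@le_trans _ _ (2^-1)%R); first by rewrite ler_pdivrMr// ler_peMr.
  apply: (le_trans r2); rewrite -[leLHS](powRr1 (ltW r0)) ger_powR//.
  by rewrite r0 ltW.
apply: (@le_trans _ _ (r `^ (- 4%:R))%R); last by rewrite ler_powR//; lra.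
rewrite (powR_invn _ (ltW r0)).
apply: (@le_trans _ _ ((1 + r ^+ 2) ^- 2)%R).
  by rewrite ler_piMl ?invr_ge0 ?ltW//; lra.
rewrite lef_pV2 ?posrE ?exprn_gt0//; last by lra.
rewrite (_ : r ^+ 4 = (r ^+ 2) ^+ 2)%R; last by rewrite -exprM.
by rewrite lerXn2r ?nnegrE ?sqr_ge0 ?addr_ge0 ?sqr_ge0 ?lerDr.
Qed.

(** It is enough to integrate over one box of velocities u at distance at least 1/2
    from v. There the Maxwellian is bounded below, and |v - u|^gamma is at least a
    multiple of (1 + |v|^2)^-2 since gamma > -4. *)
Lemma nu_lower (gamma : R) (b : R -> R) : (-3 < gamma <= 1)%R -> angular_kernel b ->
  exists2 c : R, (0 < c)%R & forall v, (c / (1 + dot v v) ^+ 2 <= nu gamma b v)%R.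
Proof.
move=> hg hb; have [cb cb0 cbE] := angular_mass hb.
have [Ck Ck0 kappa] := kappa_bound hg.
have mb := measurable_bcos hb; have b0 := bcos_ge0 hb.
have mw := @measurable_sphere_weight R; have w0 := @sphere_weight_ge0 R.
pose m0 : R := ((2 * pi) `^ (- (3 / 2)) * expR (- (3 / 2)))%R.
have m00 : (0 < m0)%R by rewrite mulr_gt0 ?expR_gt0// powR_gt0// mulr_gt0// pi_gt0.
exists (cb * m0 / 196)%R; first by rewrite divr_gt0// mulr_gt0.
move=> v; have qv := dot_ge0 v.
pose X u := sphere_integral (fun omega => (kernelB gamma b (v - u) omega * maxwellian u)%R).
have XE u : v != u -> X u = (norm3 (v - u) `^ gamma * maxwellian u * cb)%R.
  rewrite -subr_eq0 => z0; rewrite /X sphere_integralE /Rintegral.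
  transitivity (fine (\int[leb2]_a ((norm3 (v - u) `^ gamma * maxwellian u)%:E *
     (sphere_weight a * bcos b (dot (v - u)%R (sphere_point a) / norm3 (v - u)))%:E))).
    congr fine; apply: eq_integral => a _.
    by rewrite -EFinM kernelBE//; congr EFin; ring.
  rewrite ge0_integralZl; [|exact: measurableT|by rewrite /norm3; meas|by nneg|by rewrite lee_fin mulr_ge0 ?powR_ge0// ltW ?maxwellian_gt0].
  by rewrite (cbE _ z0) -EFinM.
have Xv : X v = 0%R.
  rewrite /X sphere_integralE (_ : (fun a => _) = cst 0%R).
    by rewrite /Rintegral integral0.
  apply/funext => a; rewrite kernelBE// subrr.
  rewrite (_ : norm3 (0%R : R3 R) = 0%R); last by apply/eqP; rewrite norm3_eq0.
  by rewrite invr0 mulr0 bcos0// mulr0 !mul0r.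
have X0 u : (0 <= X u)%R.
  have [<-|uv] := eqVneq v u; first by rewrite Xv.
  by rewrite XE// !mulr_ge0 ?powR_ge0// ltW// maxwellian_gt0.
have Xle u : (X u <= cb * (norm3 (v - u) `^ gamma * expR (- (4^-1 * dot u u))))%R.
  have [<-|uv] := eqVneq v u; first by rewrite Xv !mulr_ge0 ?powR_ge0 ?expR_ge0// ltW.
  rewrite XE// mulrC ler_pM2l// ler_wpM2l ?powR_ge0//.
  by apply: (le_trans (maxwellian_le u)); rewrite ler_expR; have := dot_ge0 u; lra.
have Xfin : \int[leb3]_u (X u)%:E < +oo.
  apply: (@le_lt_trans _ _ (cb%:E * (Ck * (1 + dot v v))%:E)); last by rewrite -EFinM ltry.
  apply: le_trans (lee_wpmul2l _ (kappa v)); last by rewrite lee_fin ltW.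
  rewrite -ge0_integralZl; [|exact: measurableT|by rewrite /norm3; meas|by nneg|by rewrite lee_fin ltW].
  apply: le_integral_dom => u _; first by rewrite lee_fin.
  by rewrite -EFinM lee_fin.
rewrite -lee_fin /nu /collision_integral /Rintegral fineK; last first.
  by rewrite ge0_fin_numE// integral_ge0// => u _; rewrite lee_fin; exact: X0.
(* the box is centred on the other side of the origin than v along the first axis *)
pose s : R := if (0 <= v.1.1)%R then (- (3 / 4))%R else (3 / 4)%R.
apply: (@le_trans _ _ (\int[leb3]_u ((cb * m0 / 98 / (1 + dot v v) ^+ 2)%:E * (box s u)%:R%:E))).
  rewrite ge0_integralZl; [|exact: measurableT|by rewrite /box; meas|by nneg|].
    by rewrite integral_box -EFinM lee_fin le_eqVlt; apply/orP; left; apply/eqP; field; rewrite gt_eqF// ltr_wpDr.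
  by rewrite lee_fin; apply: divr_ge0; [apply: divr_ge0 => //; rewrite mulr_ge0// ltW|exact: sqr_ge0].
apply: le_integral_dom => u _; first by nneg; rewrite ?ltW// addr_ge0.
rewrite -EFinM lee_fin -/(X u); case: (boolP (box s u)) => [|_]; last by rewrite mulr0.
rewrite mulr1 /box => /and3P[/andP[s1 s2] /andP[u21 u22] /andP[u31 u32]].
have [u11 u12] : (2^-1 <= `|v.1.1 - u.1.1|)%R /\ (u.1.1 ^+ 2 <= 1)%R.
  move: s1 s2; rewrite /s; case: (leP 0%R v.1.1) => v1 s1 s2.
    split; first by rewrite ger0_norm; lra.
    by rewrite -(sqrrN u.1.1) expr_le1//; lra.
  split; first by rewrite ler0_norm; lra.
  by rewrite expr_le1//; lra.
have qu : (dot u u <= 3)%R.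
  have a2 : (u.1.2 ^+ 2 <= 1)%R by rewrite expr_le1.
  have a3 : (u.2 ^+ 2 <= 1)%R by rewrite expr_le1.
  by rewrite /dot -!expr2; lra.
have rz : (2^-1 <= norm3 (v - u))%R.
  apply: (le_trans u11); rewrite -sqrtr_sqr /norm3 ler_wsqrtr// /dot/= -!expr2.
  by rewrite -addrA lerDl addr_ge0// sqr_ge0.
have vu : v != u.
  by apply/eqP => vu; move: rz; rewrite vu subrr (_ : norm3 (0%R : R3 R) = 0%R) ?invr_le0; [lra|apply/eqP; rewrite norm3_eq0].
rewrite XE// mulrC -mulrA.
have pl := powR_lower hg rz.
have mu_lo : (m0 <= maxwellian u)%R.
  by rewrite /m0 /maxwellian ler_wpM2l ?powR_ge0// ler_expR; lra.
have zz : (1 + norm3 (v - u) ^+ 2 <= 7 * (1 + dot v v))%R.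
  by rewrite sqr_norm3; have := dot_sub_le u v; lra.
have D0 : (0 < 1 + dot v v)%R by lra.
have k1 : (98^-1 / (1 + dot v v) ^+ 2 <= norm3 (v - u) `^ gamma)%R.
  apply: le_trans pl.
  have -> : (98^-1 / (1 + dot v v) ^+ 2 = 2^-1 / (7 * (1 + dot v v)) ^+ 2)%R.
    by field; rewrite gt_eqF.
  rewrite ler_pM2l ?invr_gt0// lef_pV2 ?posrE ?exprn_gt0 ?mulr_gt0//; last first.
    by rewrite ltr_wpDr// sqr_ge0.
  have Z0 : (0 <= 1 + norm3 (v - u) ^+ 2)%R by rewrite addr_ge0 ?sqr_ge0.
  have Y0 : (0 <= 7 * (1 + dot v v))%R by lra.
  by rewrite lerXn2r// nnegrE.
have := ler_pM _ (ltW m00) k1 mu_lo => /(_ ltac:(by rewrite divr_ge0 ?exprn_ge0 ?invr_ge0// ltW)) h.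
have := ler_wpM2r (ltW cb0) h; apply: le_trans.
by rewrite le_eqVlt; apply/orP; left; apply/eqP; field; rewrite gt_eqF.
Qed.

End CollisionFrequency.

(** * Majorants of the collision operators *)

Section CollisionBound.
Context {R : realType}.
Notation leb1 := (@lebesgue_measure R).
Notation RR := (measurableTypeR R).
Implicit Types (u v z : R3 R).

Definition sqrt_mu v : R := Num.sqrt (maxwellian v).

Lemma sqrt_mu_gt0 v : 0 < sqrt_mu v. Proof. by rewrite sqrtr_gt0 maxwellian_gt0. Qed.

Lemma sqrt_mu_ge0 v : 0 <= sqrt_mu v. Proof. exact: sqrtr_ge0. Qed.

Lemma sqrt_mu_le_gauss v : sqrt_mu v <= expR (- (4^-1 * dot v v)).
Proof. exact: sqrt_maxwellian_le. Qed.

Lemma sqrt_mu_le1 v : sqrt_mu v <= 1.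
Proof.
apply: (le_trans (sqrt_mu_le_gauss v)).
by rewrite expR_le1 oppr_le0 mulr_ge0// dot_ge0.
Qed.

Lemma sqrt_maxwellianM u v : Num.sqrt (maxwellian u * maxwellian v) = sqrt_mu u * sqrt_mu v.
Proof. by rewrite sqrtrM// ltW// maxwellian_gt0. Qed.

Lemma measurable_sqrt_mu : measurable_fun setT (sqrt_mu : R3 R -> RR).
Proof. by rewrite /sqrt_mu /maxwellian; meas. Qed.

Lemma collision_energy u v (a : R * R) :
  dot (post_u v u (sphere_point a)) (post_u v u (sphere_point a))
  + dot (post_v v u (sphere_point a)) (post_v v u (sphere_point a))
  = dot u u + dot v v.
Proof.
have w1 := dot_sphere_point a; set w := sphere_point a in w1 *.
set l := dot (v - u) w.
have -> : dot (post_u v u w) (post_u v u w) = dot u u + 2 * l * dot u w + l ^+ 2 * dot w w.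
  by rewrite /post_u -/l /dot /smul/=; ring.
have -> : dot (post_v v u w) (post_v v u w) = dot v v - 2 * l * dot v w + l ^+ 2 * dot w w.
  by rewrite /post_v -/l /dot /smul/=; ring.
have lE : l = dot v w - dot u w by rewrite /l /dot/=; ring.
rewrite w1; move: lE; move: (dot u u) (dot v v) (dot u w) (dot v w) => p q c d ->.
ring.
Qed.

(** Conservation of energy in a collision. *)
Lemma sqrt_mu_post u v (a : R * R) :
  sqrt_mu (post_u v u (sphere_point a)) * sqrt_mu (post_v v u (sphere_point a)) = sqrt_mu u * sqrt_mu v.
Proof.
rewrite -!sqrt_maxwellianM; congr Num.sqrt.
rewrite /maxwellian [LHS]mulrACA [RHS]mulrACA -!expRD; congr (_ * expR _).
by have := collision_energy u v a; lra.
Qed.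

Local Open Scope ereal_scope.

Section Bounds.
Variables (gamma : R) (b : R -> R) (Cb : R).
Hypotheses (Cb0 : (0 < Cb)%R) (bCb : forall c, (0 <= bcos b c <= Cb)%R).

Lemma collision_integral_bound v (G : R3 R -> R3 R -> R)
    (Gm : R3 R -> RR * RR -> \bar R) :
  (forall u a, `|G u (sphere_point a)|%:E <= Gm u a) ->
  `|collision_integral gamma b v G|%:E <=
  \int[leb3]_u \int[leb2]_a ((norm3 (v - u) `^ gamma * Cb * sphere_weight a)%:E * Gm u a).
Proof.
move=> GGm; apply: normr_Rintegral_dom => u _.
rewrite sphere_integralE; apply: normr_Rintegral_dom => a _.
have w0 := @sphere_weight_ge0 R a.
rewrite kernelBE// normrM (ger0_norm w0) normrM normrM (ger0_norm (powR_ge0 _ _)).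
have /andP[b0 b1] := bCb (dot (v - u) (sphere_point a) / norm3 (v - u))%R.
rewrite (ger0_norm b0) mulrAC EFinM; apply: lee_pmul; rewrite ?lee_fin//.
- by apply: mulr_ge0 => //; apply: mulr_ge0 => //; exact: powR_ge0.
- by rewrite ler_wpM2r// ler_wpM2l ?powR_ge0.
Qed.

(** [Gh] stands for an envelope of |h|. The three velocities produced by a collision
    enter linearly, also for the quadratic collision term, where one of the two
    factors is estimated by the supremum of |h|. *)
Definition collision_majorant v (Gh : R3 R -> \bar R) : \bar R :=
  \int[leb3]_u \int[leb2]_a
    ((norm3 (v - u) `^ gamma * Cb * sphere_weight a)%:E * ((sqrt_mu u)%:E *
     (Gh u + Gh (post_v v u (sphere_point a)) + Gh (post_u v u (sphere_point a))))).

Variables (M : R) (h : R3 R -> R) (Gh : R3 R -> \bar R).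
Hypotheses (M1 : (1 <= M)%R) (mG : measurable_fun setT Gh).
Hypotheses (hG : forall w, `|h w|%:E <= Gh w) (Goo : forall w, (M < `|h w|)%R -> Gh w = +oo).

Let Gh0 w : 0 <= Gh w. Proof. by apply: le_trans (hG w). Qed.

Let T v (X : R3 R -> RR * RR -> \bar R) := \int[leb3]_u \int[leb2]_a
    ((norm3 (v - u) `^ gamma * Cb * sphere_weight a)%:E * ((sqrt_mu u)%:E * X u a)).

Let mw := @measurable_sphere_weight R.
Let w0 := @sphere_weight_ge0 R.
Let msm := measurable_sqrt_mu.
Let sm0 := sqrt_mu_ge0.

Let TD v (X Y : R3 R -> RR * RR -> \bar R) :
  measurable_fun setT (fun z : R3 R * (RR * RR) => X z.1 z.2) ->
  measurable_fun setT (fun z : R3 R * (RR * RR) => Y z.1 z.2) ->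
  (forall u a, 0 <= X u a) -> (forall u a, 0 <= Y u a) ->
  T v X + T v Y = T v (fun u a => X u a + Y u a).
Proof.
move=> mX mY X0 Y0; have C0 := ltW Cb0.
have k0 u a : (0 <= norm3 (v - u) `^ gamma * Cb * sphere_weight a)%R.
  by apply: mulr_ge0 => //; apply: mulr_ge0 => //; exact: powR_ge0.
have mXu u : measurable_fun setT (X u).
  have mu : measurable_fun setT (fun a : RR * RR => (u, a)) by meas.
  exact: (measurableT_comp mX mu).
have mYu u : measurable_fun setT (Y u).
  have mu : measurable_fun setT (fun a : RR * RR => (u, a)) by meas.
  exact: (measurableT_comp mY mu).
have p0 (Z : R3 R -> RR * RR -> \bar R) u a : (forall u a, 0 <= Z u a) ->
    0 <= (norm3 (v - u) `^ gamma * Cb * sphere_weight a)%:E * ((sqrt_mu u)%:E * Z u a).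
  by move=> Z0; apply: mule_ge0; [rewrite lee_fin|apply: mule_ge0; rewrite ?lee_fin]; auto.
rewrite /T -ge0_integralD.
- apply: eq_integral => u _; rewrite -ge0_integralD.
  + by apply: eq_integral => a _; rewrite -ge0_muleDr ?mule_ge0 ?lee_fin// -ge0_muleDr.
  + exact: measurableT.
  + by move=> a _; exact: p0.
  + by meas.
  + by move=> a _; exact: p0.
  + by meas.
- exact: measurableT.
- by move=> u _; apply: integral_ge0 => a _; exact: p0.
- apply: (@meas_int _ _ _ _ _ _ (fun u a => (norm3 (v - u) `^ gamma * Cb * sphere_weight a)%:E * ((sqrt_mu u)%:E * X u a))).
    by rewrite /norm3; apply: meas_mule; [meas|apply: meas_mule => //; meas].
  by move=> u a; exact: p0.
- by move=> u _; apply: integral_ge0 => a _; exact: p0.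
- apply: (@meas_int _ _ _ _ _ _ (fun u a => (norm3 (v - u) `^ gamma * Cb * sphere_weight a)%:E * ((sqrt_mu u)%:E * Y u a))).
    by rewrite /norm3; apply: meas_mule; [meas|apply: meas_mule => //; meas].
  by move=> u a; exact: p0.
Qed.

Let TZ v (c : R) (X : R3 R -> RR * RR -> \bar R) : (0 <= c)%R ->
  measurable_fun setT (fun z : R3 R * (RR * RR) => X z.1 z.2) ->
  (forall u a, 0 <= X u a) ->
  \int[leb3]_u \int[leb2]_a ((norm3 (v - u) `^ gamma * Cb * sphere_weight a)%:E *
      (c%:E * ((sqrt_mu u)%:E * X u a))) = c%:E * T v X.
Proof.
move=> c0 mX X0.
have mXu u : measurable_fun setT (X u).
  have mu : measurable_fun setT (fun a : RR * RR => (u, a)) by meas.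
  exact: (measurableT_comp mX mu).
have p0 u a : 0 <= (norm3 (v - u) `^ gamma * Cb * sphere_weight a)%:E * ((sqrt_mu u)%:E * X u a).
  apply: mule_ge0; [rewrite lee_fin|apply: mule_ge0; rewrite ?lee_fin]; auto.
  by apply: mulr_ge0 => //; apply: mulr_ge0; [exact: powR_ge0|exact: ltW].
rewrite /T -ge0_integralZl.
- apply: eq_integral => u _; rewrite -ge0_integralZl.
  + by apply: eq_integral => a _; rewrite muleCA.
  + exact: measurableT.
  + by meas.
  + by move=> a _; exact: p0.
  + by rewrite lee_fin.
- exact: measurableT.
- apply: (@meas_int _ _ _ _ _ _ (fun u a => (norm3 (v - u) `^ gamma * Cb * sphere_weight a)%:E * ((sqrt_mu u)%:E * X u a))) => //.
  by rewrite /norm3; apply: meas_mule; [meas|apply: meas_mule => //; meas].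
- by move=> u _; apply: integral_ge0 => a _; exact: p0.
- by rewrite lee_fin.
Qed.

Let X1 v u a := Gh (post_v v u (sphere_point a)).
Let X2 v u a := Gh (post_u v u (sphere_point a)).
Let X3 u (a : RR * RR) := Gh u.

Let mX1 v : measurable_fun setT (fun z : R3 R * (RR * RR) => X1 v z.1 z.2).
Proof. by rewrite /X1 /post_v; meas. Qed.

Let mX2 v : measurable_fun setT (fun z : R3 R * (RR * RR) => X2 v z.1 z.2).
Proof. by rewrite /X2 /post_u; meas. Qed.

Let mX3 : measurable_fun setT (fun z : R3 R * (RR * RR) => X3 z.1 z.2).
Proof. by rewrite /X3; meas. Qed.

Let majorantE v : collision_majorant v Gh = T v X3 + (T v (X1 v) + T v (X2 v)).
Proof.
rewrite [X in _ = _ + X](TD v (mX1 v) (mX2 v)); [|by move=> *; exact: Gh0|by move=> *; exact: Gh0].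
rewrite [RHS](TD v mX3 (meas_adde (mX1 v) (mX2 v))); [|by move=> *; exact: Gh0|by move=> *; apply: adde_ge0; exact: Gh0].
by apply: eq_integral => u _; apply: eq_integral => a _; rewrite addeA.
Qed.

(** Of the two factors under each square root one is at most 1, the other gives
    integrability in u. *)
Lemma K_bound v : `|K gamma b h v|%:E <= collision_majorant v Gh.
Proof.
rewrite majorantE /K /K2 /K1.
set a1 := collision_integral gamma b v _.
set a2 := collision_integral gamma b v _.
set a3 := collision_integral gamma b v _.
have h3 : `|a3|%:E <= T v X3.
  apply: collision_integral_bound => u a; rewrite normrM EFinM sqrt_maxwellianM.
  apply: lee_pmul; rewrite ?lee_fin//.
  rewrite ger0_norm ?mulr_ge0 ?sqrt_mu_ge0//.
  by rewrite -[leRHS]mul1r ler_wpM2r ?sqrt_mu_ge0// sqrt_mu_le1.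
have h1 : `|a1|%:E <= T v (X1 v).
  apply: collision_integral_bound => u a; rewrite normrM EFinM sqrt_maxwellianM.
  apply: lee_pmul; rewrite ?lee_fin//.
  rewrite ger0_norm ?mulr_ge0 ?sqrt_mu_ge0//.
  by rewrite -[leRHS]mulr1 ler_wpM2l ?sqrt_mu_ge0// sqrt_mu_le1.
have h2 : `|a2|%:E <= T v (X2 v).
  apply: collision_integral_bound => u a; rewrite normrM EFinM sqrt_maxwellianM.
  apply: lee_pmul; rewrite ?lee_fin//.
  rewrite ger0_norm ?mulr_ge0 ?sqrt_mu_ge0//.
  by rewrite -[leRHS]mulr1 ler_wpM2l ?sqrt_mu_ge0// sqrt_mu_le1.
apply: (@le_trans _ _ (`|a3|%:E + (`|a1|%:E + `|a2|%:E))); last first.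
  exact: leeD h3 (leeD h1 h2).
rewrite -!EFinD lee_fin; move: (a1) (a2) (a3) => x y z.
by apply: (le_trans (ler_normB _ _)); rewrite [leLHS]addrC lerD2l ler_normD.
Qed.

(** By [sqrt_mu_post] the weights of both the gain and the loss term reduce to the
    factor sqrt (mu u) once sqrt (mu v) is divided out. In each product of two values
    of h one factor is at most M, unless the envelope is infinite there. *)
Lemma Gamma_bound v : (`|h v| <= M)%R ->
  `|Gamma gamma b h h v|%:E <= M%:E * collision_majorant v Gh.
Proof.
move=> hv; have M0 : (0 <= M)%R by exact: le_trans ler01 M1.
have prod2 w1 w2 : (`|h w1| * `|h w2|)%:E <= M%:E * (Gh w1 + Gh w2).
  have [w1M|w1M] := leP (`|h w1|)%R M.
    apply: (@le_trans _ _ (M%:E * Gh w2)); last by rewrite lee_wpmul2l ?lee_fin// leeDr.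
    by rewrite EFinM lee_pmul ?lee_fin.
  have Mp : 0 < M%:E by rewrite lte_fin (lt_le_trans ltr01).
  have w20 : Gh w2 != -oo by rewrite gt_eqF// (lt_le_trans _ (Gh0 w2))// ltNyr.
  by rewrite (Goo w1M) addye// gt0_muley// leey.
rewrite majorantE /Gamma /Q /Qgain /Qloss.
set a1 := collision_integral gamma b v _.
set a3 := collision_integral gamma b v _.
have h1 : `|a1|%:E <= (sqrt_mu v * M)%:E * (T v (X1 v) + T v (X2 v)).
  rewrite (TD v (mX1 v) (mX2 v)); [|by move=> *; exact: Gh0|by move=> *; exact: Gh0].
  rewrite -TZ.
  - apply: collision_integral_bound => u a.
    rewrite -!/(sqrt_mu _) mulrACA sqrt_mu_post normrM (ger0_norm (mulr_ge0 _ _)) ?sqrt_mu_ge0//.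
    rewrite normrM EFinM.
    rewrite [X in _ <= X](_ : _ = (sqrt_mu u * sqrt_mu v)%:E * (M%:E * (X1 v u a + X2 v u a))); last first.
      by rewrite !muleA -!EFinM; congr (_%:E * _); ring.
    apply: lee_wpmul2l; first by rewrite lee_fin mulr_ge0 ?sqrt_mu_ge0.
    by rewrite addeC; exact: prod2.
  - by rewrite mulr_ge0// sqrt_mu_ge0.
  - exact: meas_adde.
  - by move=> *; apply: adde_ge0; exact: Gh0.
have h3 : `|a3|%:E <= (sqrt_mu v * M)%:E * T v X3.
  rewrite -TZ.
  - apply: collision_integral_bound => u a.
    rewrite -!/(sqrt_mu _) mulrACA normrM (ger0_norm (mulr_ge0 _ _)) ?sqrt_mu_ge0// normrM EFinM.
    rewrite [X in _ <= X](_ : _ = (sqrt_mu u * sqrt_mu v)%:E * (M%:E * Gh u)); last first.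
      by rewrite !muleA -!EFinM; congr (_%:E * _); ring.
    apply: lee_wpmul2l; first by rewrite lee_fin mulr_ge0 ?sqrt_mu_ge0.
    by rewrite mulrC EFinM; apply: lee_pmul; rewrite ?lee_fin.
  - by rewrite mulr_ge0// sqrt_mu_ge0.
  - exact: mX3.
  - by move=> *; exact: Gh0.
have sv0 := sqrt_mu_gt0 v.
rewrite -/(sqrt_mu v) normrM (ger0_norm (_ : 0 <= (sqrt_mu v)^-1)%R) ?invr_ge0 ?sqrt_mu_ge0//.
have T0 (X : R3 R -> RR * RR -> \bar R) : (forall u a, 0 <= X u a) -> 0 <= T v X.
  move=> X0; apply: integral_ge0 => u _; apply: integral_ge0 => a _.
  apply: mule_ge0; [rewrite lee_fin|apply: mule_ge0; rewrite ?lee_fin]; auto.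
  by apply: mulr_ge0 => //; apply: mulr_ge0; [exact: powR_ge0|exact: ltW].
have T1 : 0 <= T v (X1 v) + T v (X2 v) by rewrite adde_ge0//; apply: T0 => *; exact: Gh0.
have T3 : 0 <= T v X3 by apply: T0 => *; exact: Gh0.
have : (`|a1 - a3|)%:E <= (sqrt_mu v * M)%:E * (T v X3 + (T v (X1 v) + T v (X2 v))).
  rewrite ge0_muleDr//.
  apply: (@le_trans _ _ (`|a3|%:E + `|a1|%:E)); last exact: leeD h3 h1.
  by rewrite -EFinD lee_fin [leRHS]addrC ler_normB.
move=> /(lee_wpmul2l (_ : 0 <= ((sqrt_mu v)^-1)%:E)); rewrite lee_fin invr_ge0 sqrt_mu_ge0 => /(_ isT).
by rewrite muleA -!EFinM mulrA mulVf ?mul1r// gt_eqF.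
Qed.

End Bounds.
End CollisionBound.

(** * Absolute continuity of the scattering flow *)

Section AbsoluteContinuity.
Local Open Scope ereal_scope.
Context d1 d2 (X : measurableType d1) (Y : measurableType d2) (R : realType).
Variables (m1 : {measure set X -> \bar R}) (m2 : {measure set Y -> \bar R}).
Variables (w : X -> \bar R) (Phi : X -> Y).
Hypothesis intw : m1.-integrable setT w.
Hypothesis w0 : forall x, 0 <= w x.
Hypothesis mPhi : measurable_fun setT Phi.
Hypothesis null : forall A, measurable A -> m2 A = 0 ->
  \int[m1]_(x in Phi @^-1` A) w x = 0.

(** The image of an integrable density is a finite measure; that it vanishes on null
    sets is equivalent to the epsilon-delta form of absolute continuity. *)
Lemma pushforward_abs_continuous (e : R) : (0 < e)%R ->
  exists2 dl : R, (0 < dl)%R & forall A, measurable A -> m2 A < dl%:E ->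
    \int[m1]_(x in Phi @^-1` A) w x < e%:E.
Proof.
move=> e0.
pose nu0 : {charge set X -> \bar R} := induced_charge intw.
pose nu1 : {charge set Y -> \bar R} := pushforward nu0 Phi.
have [P [N PN]] := Hahn_decomposition (nu1 mPhi).
have dom : nu1 mPhi `<< m2 by apply/null_content_dominatesP => A mA mA0; exact: null.
have [dl [dl0 H]] := charge_variation_continuous PN dom e0.
exists dl => // A mA mAd; apply: le_lt_trans (H A mA mAd).
apply: le_trans (abse_charge_variation PN mA).
by rewrite -[leLHS]gee0_abs//; exact: integral_ge0.
Qed.

End AbsoluteContinuity.

Section Transport.
Local Open Scope ereal_scope.
Context {R : realType}.
Notation leb1 := (@lebesgue_measure R).
Notation RR := (measurableTypeR R).

(** Scattering histories ((v, u), (a, tau)): the observed velocity v, the partner u,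
    the angles a of the collision, and the time tau elapsed since then. *)
Definition leb9 : set ((R3 R * R3 R) * R3 R) -> \bar R := (leb6 \x leb3)%E.
HB.instance Definition _ := Measure.on leb9.

(** Points (tau, (y, w)) of space-time and velocity; the time tau and the displacement
    y are counted backwards from the point of observation. *)
Definition leb7 : set (RR * (R3 R * R3 R)) -> \bar R := (leb1 \x leb6)%E.
HB.instance Definition _ := Measure.on leb7.

Lemma leb9E (f : (R3 R * R3 R) * R3 R -> \bar R) : measurable_fun setT f ->
  (forall x, 0 <= f x) ->
  \int[leb9]_z f z = \int[leb6]_p \int[leb3]_q f (p, q).
Proof. by move=> mf f0; exact: (@fubini_tonelli1 _ _ _ _ _ leb6 leb3). Qed.

Lemma leb7E (f : RR * (R3 R * R3 R) -> \bar R) : measurable_fun setT f ->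
  (forall x, 0 <= f x) ->
  \int[leb7]_z f z = \int[leb1]_s \int[leb6]_p f (s, p).
Proof. by move=> mf f0; exact: (@fubini_tonelli1 _ _ _ _ _ leb1 leb6). Qed.

Lemma integral_expR_decay (c : R) : (0 < c)%R ->
  \int[leb1]_t ((0 <= t)%R%:R * expR (- (c * t)))%:E = (c^-1)%:E.
Proof.
move=> c0; have E := integral_exponential_pdf c0.
transitivity ((c^-1)%:E * \int[leb1]_t (exponential_pdf c t)%:E); last by rewrite E mule1.
rewrite -ge0_integralZl.
- apply: eq_integral => t _; rewrite -EFinM; congr EFin.
  have [t0|t0] := leP 0%R t.
    by rewrite exponential_pdfE// mul1r mulrA mulVf ?mul1r ?mulNr// gt_eqF.
  by rewrite lt0_exponential_pdf// mul0r mulr0.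
- exact: measurableT.
- by apply/measurable_EFinP; exact: measurable_exponential_pdf.
- by move=> t _; rewrite lee_fin exponential_pdf_ge0// ltW.
- by rewrite lee_fin invr_ge0 ltW.
Qed.

Lemma integral_sphere_cst (k : \bar R) : 0 <= k ->
  \int[leb2]_a ((@sphere_weight R a)%:E * k) <= (2 * pi * pi)%:E * k.
Proof.
move=> k0; rewrite ge0_integralZr; [|exact: measurableT| | |exact: k0].
- by apply: lee_wpmul2r => //; exact: sphere_area_fin.
- by apply/measurable_EFinP; exact: measurable_sphere_weight.
- by move=> a _; rewrite lee_fin sphere_weight_ge0.
Qed.

Section Density.
Variables (gamma Cb c : R).
Hypotheses (hg : (-3 < gamma <= 1)%R) (Cb0 : (0 < Cb)%R) (c0 : (0 < c)%R).

(** The weight of a history in the Duhamel formula, after multiplication by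
    sqrt (mu v): the damping since the collision, at the rate found in [nu_lower],
    and the kernel of [collision_majorant]. *)
Definition scattering_density (z : (R3 R * R3 R) * R3 R) : R :=
  ((0 <= z.2.2)%R%:R * expR (- (c / (1 + dot z.1.1 z.1.1) ^+ 2 * z.2.2)) *
  (norm3 (z.1.1 - z.1.2) `^ gamma * Cb * sphere_weight z.2.1) *
  (sqrt_mu z.1.2 * sqrt_mu z.1.1))%R.

Let mw := @measurable_sphere_weight R.
Let w0 := @sphere_weight_ge0 R.
Let msm := @measurable_sqrt_mu R.
Let sm0 := @sqrt_mu_ge0 R.

Lemma measurable_scattering_density :
  measurable_fun setT (scattering_density : _ -> RR).
Proof. by rewrite /scattering_density /norm3; meas. Qed.

Lemma scattering_density_ge0 z : (0 <= scattering_density z)%R.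
Proof.
apply: mulr_ge0; last by apply: mulr_ge0.
apply: mulr_ge0; first by apply: mulr_ge0; [exact: ler0n|exact: expR_ge0].
by apply: mulr_ge0 => //; apply: mulr_ge0; [exact: powR_ge0|exact: ltW].
Qed.

(** The time integral of the damping costs a factor (1 + |v|^2)^2 and the integral in
    u a factor 1 + |v|^2, by [kappa_bound]; the Gaussian in v pays for both. *)
Lemma scattering_density_fin : \int[leb9]_z (scattering_density z)%:E < +oo.
Proof.
have mW := measurable_scattering_density; have W0 := scattering_density_ge0.
have [P PE P0] : exists2 P : R, P = (2 * pi * pi)%R & (0 < P)%R.
  by exists (2 * pi * pi)%R => //; apply: mulr_gt0; [apply: mulr_gt0|]; rewrite ?pi_gt0.
have [Ck Ck0 kappa] := kappa_bound hg.
pose r v : R := (c / (1 + dot v v) ^+ 2)%R.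
have r0 v : (0 < r v)%R by rewrite /r divr_gt0// exprn_gt0// ltr_wpDr// dot_ge0.
rewrite leb9E; [|by meas|by nneg].
rewrite leb6E; [|by meas|by nneg] => /=.
pose C := (P * Cb * Ck / c * 24 ^+ 3)%R.
have D0 : (0 < (24 : R) ^+ 3)%R by exact: exprn_gt0.
have E0 : (0 < P * Cb * Ck / c)%R by apply: divr_gt0 => //; apply: mulr_gt0 => //; exact: mulr_gt0.
have C0 : (0 < C)%R by exact: mulr_gt0.
apply: (@le_lt_trans _ _ (\int[leb3]_v (C%:E * (expR (- (8^-1 * dot v v)))%:E))); last first.
  rewrite ge0_integralZl; [|exact: measurableT|by meas|by nneg|by rewrite lee_fin ltW].
  by rewrite integral_gauss3 -?EFinM ?ltry//; lra.
apply: le_integral_dom => v _; first by nneg.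
have A0 : (0 <= P * Cb / r v * sqrt_mu v)%R.
  by apply: mulr_ge0 => //; apply: divr_ge0; [apply: mulr_ge0; exact: ltW|exact: ltW].
apply: (@le_trans _ _ (\int[leb3]_u ((P * Cb * (r v)^-1 * sqrt_mu v)%:E *
    (norm3 (v - u) `^ gamma * expR (- (4^-1 * dot u u)))%:E))).
  apply: le_integral_dom => u _; first by nneg.
  rewrite leb3E; [|by meas|by nneg].
  pose k : R := (norm3 (v - u) `^ gamma * Cb * (sqrt_mu u * sqrt_mu v))%R.
  have k0 : (0 <= k)%R.
    by apply: mulr_ge0; [apply: mulr_ge0; [exact: powR_ge0|exact: ltW]|exact: mulr_ge0].
  apply: (@le_trans _ _ (\int[leb2]_a ((sphere_weight a)%:E * ((k * (r v)^-1)%:E)))).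
    apply: le_integral_dom => a _; first by nneg.
    rewrite le_eqVlt; apply/orP; left; apply/eqP.
    transitivity (\int[leb1]_t ((sphere_weight a * k)%:E * ((0 <= t)%R%:R * expR (- (r v * t)))%:E)).
      apply: eq_integral => t _; rewrite -EFinM /scattering_density/= -/(r v); congr EFin.
      by rewrite /k; ring.
    rewrite ge0_integralZl; [|exact: measurableT|by meas|by nneg|by rewrite lee_fin mulr_ge0].
    by rewrite integral_expR_decay// -!EFinM; congr EFin; rewrite /k; ring.
  have kr0 : 0 <= (k * (r v)^-1)%:E by rewrite lee_fin mulr_ge0// invr_ge0 ltW.
  apply: (le_trans (integral_sphere_cst kr0)); rewrite -PE -!EFinM lee_fin /k.
  have -> : (P * (norm3 (v - u) `^ gamma * Cb * (sqrt_mu u * sqrt_mu v) / r v) =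
    (P * Cb / r v * sqrt_mu v) * (norm3 (v - u) `^ gamma * sqrt_mu u))%R by ring.
  apply: ler_wpM2l; first exact: A0.
  by apply: ler_wpM2l; [exact: powR_ge0|exact: sqrt_mu_le_gauss].
rewrite ge0_integralZl; [|exact: measurableT|by rewrite /norm3; meas|by nneg|by rewrite lee_fin].
apply: (le_trans (lee_wpmul2l _ (kappa v))); first by rewrite lee_fin.
rewrite -!EFinM lee_fin.
have qv := dot_ge0 v; set q := dot v v in qv *.
have sv := sqrt_mu_le_gauss v; rewrite -/q in sv.
have h24 : (1 + q <= 24^-1^-1 * expR (24^-1 * q))%R.
  by apply: one_add_le_expR => //; apply/andP; split; lra.
rewrite invrK in h24.
have h3 : ((1 + q) ^+ 3 <= 24 ^+ 3 * expR (8^-1 * q))%R.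
  have -> : (24 ^+ 3 * expR (8^-1 * q) = (24 * expR (24^-1 * q)) ^+ 3)%R.
    by rewrite exprMn -expRM_natl; congr (_ * expR _)%R; lra.
  by rewrite lerXn2r// nnegrE; [lra|rewrite mulr_ge0 ?expR_ge0].
have -> : (P * Cb / r v * sqrt_mu v * (Ck * (1 + q)) =
   (P * Cb * Ck / c) * ((1 + q) ^+ 3 * sqrt_mu v))%R.
  rewrite /r -/q; field; rewrite gt_eqF ?andbT; [|exact: c0]; rewrite gt_eqF//; lra.
rewrite /C -[leRHS]mulrA; apply: ler_wpM2l; first exact: ltW.
apply: (@le_trans _ _ (24 ^+ 3 * expR (8^-1 * q) * expR (- (4^-1 * q)))%R).
  by apply: ler_pM => //; rewrite exprn_ge0//; lra.
by rewrite -mulrA -expRD; apply: ler_wpM2l; [exact: ltW|rewrite ler_expR; lra].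
Qed.

Lemma scattering_density_integrable :
  leb9.-integrable setT (fun z => (scattering_density z)%:E).
Proof.
apply/integrableP; split.
  by apply/measurable_EFinP; exact: measurable_scattering_density.
under eq_integral do rewrite gee0_abs ?lee_fin ?scattering_density_ge0//.
exact: scattering_density_fin.
Qed.

Section Map.
Variable wm : R3 R -> R3 R -> RR * RR -> R3 R.
Hypothesis mwm : measurable_fun setT
  (fun z : (R3 R * R3 R) * (RR * RR) => wm z.1.1 z.1.2 z.2).
Hypothesis nullwm : forall v (k : R3 R -> \bar R), measurable_fun setT k ->
  (forall p, 0 <= k p) -> \int[leb3]_p k p = 0 ->
  \int[leb3]_u \int[leb2]_a ((sphere_weight a)%:E * k (wm v u a)) = 0.

(** Where a history leads back to: the time and place of the collision, and one of
    the velocities u, v', u' at which the solution is evaluated there. *)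
Definition flow_map (z : (R3 R * R3 R) * R3 R) : RR * (R3 R * R3 R) :=
  (z.2.2, (smul z.2.2 z.1.1, wm z.1.1 z.1.2 z.2.1)).

Lemma measurable_flow_map : measurable_fun setT flow_map.
Proof.
rewrite /flow_map.
have m1 : measurable_fun setT (fun z : (R3 R * R3 R) * R3 R => wm z.1.1 z.1.2 z.2.1).
  have m2 : measurable_fun setT (fun z : (R3 R * R3 R) * R3 R => (z.1, z.2.1)) by meas.
  exact: (measurableT_comp mwm m2).
by apply: meas_pair; [meas|apply: meas_pair; [meas|exact: m1]].
Qed.

(** For fixed tau <> 0 the map v |-> tau v preserves null sets, and for fixed v the
    average over u and omega does not charge null sets of velocities w, by the
    hypothesis on [wm]. *)
Lemma flow_map_null_fun (h : RR * (R3 R * R3 R) -> \bar R) : measurable_fun setT h ->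
  (forall p, 0 <= h p) -> \int[leb7]_p h p = 0 ->
  \int[leb9]_z ((scattering_density z)%:E * h (flow_map z)) = 0.
Proof.
move=> mh h0 ih; have mW := measurable_scattering_density.
have W0 := scattering_density_ge0; have mF := measurable_flow_map.
pose g z := (@sphere_weight R z.2.1)%:E * h (flow_map z).
have mg : measurable_fun setT g by rewrite /g; meas.
have g0 z : 0 <= g z by rewrite /g; nneg.
apply: (@integral0_support _ _ _ _ _ g) => //.
- by meas.
- by nneg.
- move=> z /eqP; rewrite /g mule_eq0 eqe => /orP[/eqP sw0|/eqP ->]; last by rewrite mule0.
  by rewrite /scattering_density sw0 !(mulr0, mul0r) mul0e.
rewrite leb9E//.
have gE p q : g (p, q) = (sphere_weight q.1)%:E *
   h (q.2, (smul q.2 p.1, wm p.1 p.2 q.1)) by [].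
pose J (t : RR) (v : R3 R) := \int[leb3]_u \int[leb2]_a g ((v, u), (a, t)).
have mJ : measurable_fun setT (fun z : RR * R3 R => J z.1 z.2).
  rewrite /J; apply: (@meas_int _ _ _ _ _ _ (fun z u => \int[leb2]_a g ((z.2, u), (a, z.1)))).
    apply: (@meas_int _ _ _ _ _ _ (fun z a => g ((z.1.2, z.2), (a, z.1.1)))) => //.
    by meas.
  by nneg.
have J0 t v : 0 <= J t v by rewrite /J; nneg.
transitivity (\int[leb1]_t \int[leb3]_v J t v).
  transitivity (\int[leb6]_p \int[leb1]_t \int[leb2]_a g (p, (a, t))).
    by apply: eq_integral => p _; rewrite leb3E'//; meas.
  rewrite (@integral_swap _ _ _ _ R leb6 leb1 (fun p t => \int[leb2]_a g (p, (a, t)))); last 2 first.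
  - apply: (@meas_int _ _ _ _ _ _ (fun z a => g (z.1, (a, z.2)))); first by meas.
    by nneg.
  - by nneg.
  apply: eq_integral => t _; rewrite leb6E => [//||p]; last by nneg.
  apply: (@meas_int _ _ _ _ _ _ (fun p a => g (p, (a, t)))); first by meas.
  by nneg.
pose B (t : RR) (y : R3 R) := \int[leb3]_w h (t, (y, w)).
have mB : measurable_fun setT (fun z : RR * R3 R => B z.1 z.2).
  rewrite /B; apply: (@meas_int _ _ _ _ _ _ (fun z w => h (z.1, (z.2, w)))); first by meas.
  by nneg.
have B0 t y : 0 <= B t y by rewrite /B; nneg.
have mBt t : measurable_fun setT (B t).
  have m2 : measurable_fun setT (fun y : R3 R => (t, y)) by meas.
  exact: (measurableT_comp mB m2).
have mJt t : measurable_fun setT (J t).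
  have m2 : measurable_fun setT (fun y : R3 R => (t, y)) by meas.
  exact: (measurableT_comp mJ m2).
have iB : \int[leb1]_t \int[leb3]_y B t y = 0.
  rewrite -[RHS]ih leb7E//; apply: eq_integral => t _; rewrite leb6E//.
  by meas.
have JB t v : B t (smul t v) = 0 -> J t v = 0.
  move=> Btv; rewrite /J.
  have := nullwm v (k := fun w => h (t, (smul t v, w))).
  by apply => //; meas.
rewrite integral_off0.
- apply: (@integral0_support _ _ _ _ _ (fun t => \int[leb3]_y B t y)); last exact: iB.
  + apply: meas_mule; first by meas.
    exact: (@meas_int _ _ _ _ _ _ J).
  + exact: (@meas_int _ _ _ _ _ _ B).
  + by nneg.
  + by nneg.
  move=> t iBt; have [->|t0] := eqVneq t 0%R; first by rewrite mul0e.
  rewrite mul1e; apply: (@integral0_support _ _ _ _ _ (fun v => B t (smul t v))).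
  + exact: mJt.
  + have m2 : measurable_fun setT (fun v : R3 R => smul t v) by meas.
    exact: (measurableT_comp (mBt t) m2).
  + exact: J0.
  + by move=> v; exact: B0.
  + exact: JB.
  transitivity (\int[leb3]_p B t (t * p.1.1 + (0 : R3 R).1.1, t * p.1.2 + (0 : R3 R).1.2, t * p.2 + (0 : R3 R).2)%R).
    by apply: eq_integral => p _; rewrite /smul/= !addr0.
  by rewrite integral_affine3// iBt mule0.
- exact: (@meas_int _ _ _ _ _ _ J).
- by nneg.
Qed.

Lemma flow_map_abs_continuous (e : R) : (0 < e)%R ->
  exists2 dl : R, (0 < dl)%R & forall A, measurable A -> leb7 A < dl%:E ->
    \int[leb9]_(z in flow_map @^-1` A) (scattering_density z)%:E < e%:E.
Proof.
apply: (@pushforward_abs_continuous _ _ _ _ R leb9 leb7).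
- exact: scattering_density_integrable.
- by move=> z; rewrite lee_fin scattering_density_ge0.
- exact: measurable_flow_map.
move=> A mA A0; rewrite integral_mkcond.
have mI : measurable_fun setT (fun p => (\1_A p)%:E : \bar R).
  by apply/measurable_EFinP; exact: measurable_indic.
have I0 p : 0 <= (\1_A p)%:E :> \bar R by rewrite lee_fin.
have iI : \int[leb7]_p (\1_A p)%:E = 0.
  by rewrite integral_indic; [rewrite setIT; exact: A0|exact: measurableT|exact: mA].
rewrite -[RHS](flow_map_null_fun mI I0 iI); apply: eq_integral => z _.
rewrite patchE indicE (_ : (z \in _) = (flow_map z \in A)); last first.
  by apply/idP/idP; rewrite !inE.
by case: ifPn; rewrite ?mule1 ?mule0.
Qed.

End Map.
End Density.
End Transport.

(** * Periodic functions *)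

Section Periodic.
Context {R : realType}.
Notation leb1 := (@lebesgue_measure R).
Notation RR := (measurableTypeR R).
Local Open Scope ereal_scope.

Lemma periodic_int (T : R) (g : RR -> \bar R) : (forall y, g (y + T)%R = g y) ->
  forall (m : int) y, g (y + m%:~R * T)%R = g y.
Proof.
move=> gT; have gn (n : nat) y : g (y + n%:R * T)%R = g y.
  elim: n y => [|n IH] y; first by rewrite mul0r addr0.
  by rewrite -natr1 mulrDl mul1r addrA gT IH.
case=> n y; first exact: gn.
rewrite NegzE mulrNz mulNr -[in RHS](subrK (n.+1%:R * T)%R y).
exact/esym/gn.
Qed.

(** An interval of length 2 r meets at most 2 r / T + 2 consecutive periods, wherever
    it is placed. *)
Lemma integral_window_periodic (T r : R) : (0 < T)%R -> (0 <= r)%R ->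
  exists n : nat, forall (g : RR -> \bar R) (x : R),
  measurable_fun setT g -> (forall y, 0 <= g y) -> (forall y, g (y + T)%R = g y) ->
  \int[leb1]_y ((`|y| <= r)%R%:R%:E * g (x - y)%R) <=
  n%:R%:E * \int[leb1]_y ((0 <= y < T)%R%:R%:E * g y).
Proof.
move=> T0 r0; pose n := (Num.truncn (2 * r / T)).+2.
exists n => g x mg g0 gT.
(* the period containing the left end x - r of the window *)
pose k : int := Num.floor ((x - r) / T).
have kle : (k%:~R * T <= x - r)%R by rewrite -ler_pdivlMr// Num.Theory.floor_le.
have klt : (x - r < (k + 1)%:~R * T)%R by rewrite -ltr_pdivrMr// Num.Theory.floorD1_gt.
pose cellk (j : nat) (y : R) : bool := (0 <= y - (k + j%:Z)%:~R * T < T)%R.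
have -> : \int[leb1]_y ((`|y| <= r)%R%:R%:E * g (x - y)%R) =
    \int[leb1]_y ((`|x - y| <= r)%R%:R%:E * g y).
  pose G y := (`|x - y| <= r)%R%:R%:E * g y.
  transitivity (\int[leb1]_y G ((-1) * y + x)%R).
    apply: eq_integral => y _; rewrite /G; congr ((nat_of_bool (`|_| <= _)%R)%:R%:E * g _).
      by ring.
    by ring.
  rewrite (@integral_affineV _ (-1) x G) ?oppr_eq0 ?oner_eq0//.
  - by rewrite normrN1 invr1 mul1e.
  - by rewrite /G; meas.
  - by rewrite /G; nneg.
apply: (@le_trans _ _ (\int[leb1]_y \sum_(j < n) ((cellk j y)%:R%:E * g y))).
  apply: le_integral_dom => y _; first by nneg.
  have S0 : 0 <= \sum_(j < n) ((cellk j y)%:R%:E * g y) by apply: sume_ge0 => j _; nneg.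
  case: (boolP (`|x - y| <= r)%R) => [|_]; last by rewrite mul0e.
  rewrite ler_norml mul1e => /andP[y1 y2].
  pose l : int := Num.floor (y / T).
  have lle : (l%:~R * T <= y)%R by rewrite -ler_pdivlMr// Num.Theory.floor_le.
  have llt : (y < (l + 1)%:~R * T)%R by rewrite -ltr_pdivrMr// Num.Theory.floorD1_gt.
  have kl : (k <= l)%R.
    rewrite -ltzD1 -(ltr_int R) -(ltr_pM2r T0).
    by apply: (le_lt_trans kle); apply: le_lt_trans llt; lra.
  have lkn : (`|l - k| < n)%N.
    rewrite -ltz_nat gez0_abs ?subr_ge0// -(ltr_int R).
    have tb : (2 * r / T < (Num.truncn (2 * r / T)).+1%:R)%R.
      have q0 : (0 <= 2 * r / T)%R by rewrite divr_ge0 ?mulr_ge0// ltW.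
      by have /andP[] := truncn_itv q0.
    have : ((l - k)%:~R * T < (2 * r / T + 1) * T)%R.
      rewrite mulrDl divfK ?gt_eqF// mul1r rmorphB/= mulrBl.
      move: klt; rewrite rmorphD/= mulrDl mul1r; lra.
    rewrite ltr_pM2r// => h; apply: (lt_trans h).
    rewrite /n -[(Num.truncn _).+2%:~R]natr1 ltrD2r; exact: tb.
  have cy : cellk `|(l - k)%R|%N y.
    rewrite /cellk gez0_abs ?subr_ge0// (addrC k) subrK.
    by rewrite lle/= ltrBlDl; move: llt; rewrite rmorphD/= mulrDl mul1r.
  rewrite (bigD1 (Ordinal lkn)) //= cy mul1e.
  by apply: lee_paddr => //; apply: sume_ge0 => j _; nneg.
rewrite ge0_integral_sum//; last 2 first.
- by move=> j; rewrite /cellk; meas.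
- by move=> j y _; nneg.
rewrite (eq_bigr (fun=> \int[leb1]_y ((0 <= y < T)%R%:R%:E * g y))); last first.
  move=> j _; pose G (y : RR) := (0 <= y < T)%R%:R%:E * g (y + (k + j%:Z)%:~R * T)%R.
  transitivity (\int[leb1]_y G (1 * y + - ((k + j%:Z)%:~R * T))%R).
    by apply: eq_integral => y _; rewrite /G /cellk mul1r subrK.
  rewrite (@integral_affineV _ 1 _ G) ?oner_eq0//.
  - rewrite normr1 invr1 mul1e; apply: eq_integral => y _.
    by rewrite /G periodic_int.
  - by rewrite /G; meas.
  - by rewrite /G; nneg.
by rewrite sumr_const card_ord mule_natl.
Qed.


Definition cube (r : R) (y : R3 R) : bool :=
  [&& (`|y.1.1| <= r)%R, (`|y.1.2| <= r)%R & (`|y.2| <= r)%R].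

Definition cellb (Omega : spatial_domain) (y : R3 R) : bool :=
  if Omega is Torus then
    [&& (0 <= y.1.1 < 2 * pi)%R, (0 <= y.1.2 < 2 * pi)%R & (0 <= y.2 < 2 * pi)%R]
  else true.

Lemma cellbP Omega y : cell Omega y <-> cellb Omega y.
Proof.
case: Omega => //=; rewrite /setX/= !in_itv/=; split.
  by move=> [[-> ->] ->].
by move=> /and3P[-> -> ->].
Qed.

Lemma measurable_cellb Omega : measurable_fun setT (cellb Omega).
Proof. by case: Omega; rewrite /cellb; meas. Qed.

Lemma measurable_cube r : measurable_fun setT (cube r).
Proof. by rewrite /cube; meas. Qed.

(** On the torus the one-dimensional estimate is applied in each coordinate in turn;
    in the whole space C = 1 does, by reflection. *)
Lemma integral_cube_periodic (Omega : spatial_domain) (r : R) : (0 <= r)%R ->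
  exists2 C : R, (0 < C)%R & forall (h : R3 R -> \bar R) x,
  measurable_fun setT h -> (forall y, 0 <= h y) -> on_domain Omega h ->
  \int[leb3]_y ((cube r y)%:R%:E * h (x - y)%R) <=
  C%:E * \int[leb3]_y ((cellb Omega y)%:R%:E * h y).
Proof.
move=> r0; case: Omega; last first.
  exists 1%R => // h x mh h0 _; rewrite mul1e.
  under [X in _ <= X]eq_integral do rewrite mul1e.
  rewrite -(integral_reflect3 x mh h0); apply: le_integral_dom => y _; first by nneg.
  by case: (cube r y); rewrite ?mul1e ?mul0e.
have pp : (0 < 2 * pi :> R)%R by apply: mulr_gt0; rewrite ?pi_gt0.
set T := (2 * pi)%R in pp *.
have [n win] := integral_window_periodic pp r0.
exists (n%:R ^+ 3 + 1)%R; first by rewrite ltr_wpDl// exprn_ge0.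
move=> h x mh h0 per.
have p1 a b c : h (a + T, b, c)%R = h (a, b, c).
  by have [+ _ _] := per (a, b, c); rewrite -[h (_ + _)%R]/(h (a + T, b + 0, c + 0)%R) !addr0.
have p2 a b c : h (a, b + T, c)%R = h (a, b, c).
  by have [_ + _] := per (a, b, c); rewrite -[h (_ + _)%R]/(h (a + 0, b + T, c + 0)%R) !addr0.
have p3 a b c : h (a, b, c + T)%R = h (a, b, c).
  by have [_ _ +] := per (a, b, c); rewrite -[h (_ + _)%R]/(h (a + 0, b + 0, c + T)%R) !addr0.
pose k (t : RR) : \bar R := (0 <= t < T)%R%:R%:E.
have mk : measurable_fun setT k by rewrite /k; meas.
have k0 t : 0 <= k t by rewrite /k; nneg.
pose h2 a b := \int[leb1]_c (k c * h (a, b, c)).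
pose h1 a := \int[leb1]_b (k b * h2 a b).
have mh2 : measurable_fun setT (fun z : RR * RR => h2 z.1 z.2).
  rewrite /h2; apply: (@meas_int _ _ _ _ _ _ (fun z c => k c * h (z.1, z.2, c))); first by meas.
  by nneg.
have h20 a b : 0 <= h2 a b by rewrite /h2; nneg.
have mh2a a : measurable_fun setT (h2 a).
  have m2 : measurable_fun setT (fun b : RR => (a, b)) by meas.
  exact: (measurableT_comp mh2 m2).
have mh1 : measurable_fun setT h1.
  rewrite /h1; apply: (@meas_int _ _ _ _ _ _ (fun a b => k b * h2 a b)).
    by apply: meas_mule; [meas|exact: mh2].
  by move=> a b; rewrite mule_ge0.
have h10 a : 0 <= h1 a by apply: integral_ge0 => b _; rewrite mule_ge0.
have nn0 : 0 <= n%:R%:E :> \bar R by rewrite lee_fin.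
have cellE : \int[leb3]_y ((cellb Torus y)%:R%:E * h y) = \int[leb1]_a (k a * h1 a).
  have mc := measurable_cellb Torus.
  rewrite leb3E; [|by meas|by nneg].
  rewrite leb2E; [|by meas|by nneg] => /=.
  apply: eq_integral => a _; rewrite /h1 -ge0_integralZl; last first.
  - exact: k0.
  - by move=> b _; rewrite mule_ge0.
  - exact: (meas_mule mk (mh2a a)).
  - exact: measurableT.
  apply: eq_integral => b _; rewrite /h2 -!ge0_integralZl; last first.
  - exact: k0.
  - by nneg.
  - by meas.
  - exact: measurableT.
  - exact: k0.
  - by nneg.
  - by meas.
  - exact: measurableT.
  apply: eq_integral => c _.
  by rewrite /k !muleA -!EFinM -!natrM !mulnb andbA.
have mcu := measurable_cube r.
rewrite cellE leb3E; [|by meas|by nneg].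
pose w (t : RR) : \bar R := (`|t| <= r)%R%:R%:E.
have mww : measurable_fun setT w by rewrite /w; meas.
have ww0 t : 0 <= w t by rewrite /w; nneg.
apply: (@le_trans _ _ (\int[leb2]_q (w q.1 * (w q.2 * (n%:R%:E * h2 (x.1.1 - q.1)%R (x.1.2 - q.2)%R))))).
  apply: le_integral_dom => q _; first by nneg.
  have := @win (fun c => h (x.1.1 - q.1, x.1.2 - q.2, c)%R) x.2.
  move=> /(_ _ _ _)/= W.
  apply: (@le_trans _ _ (w q.1 * (w q.2 * \int[leb1]_c (w c * h (x.1.1 - q.1, x.1.2 - q.2, x.2 - c)%R)))).
    rewrite -!ge0_integralZl; last first.
    - exact: ww0.
    - by nneg.
    - by meas.
    - exact: measurableT.
    - exact: ww0.
    - by nneg.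
    - by meas.
    - exact: measurableT.
    rewrite le_eqVlt; apply/orP; left; apply/eqP; apply: eq_integral => c _.
    by rewrite /w /cube/= !muleA -!EFinM -!natrM !mulnb andbA.
  apply: lee_wpmul2l; first exact: ww0.
  apply: lee_wpmul2l; first exact: ww0.
  by apply: W => [|y|y]; [meas|exact: h0|exact: p3].
have h2per a b : h2 a (b + T)%R = h2 a b by apply: eq_integral => c _; rewrite p2.
have h1per a : h1 (a + T)%R = h1 a.
  apply: eq_integral => b _; congr (_ * _).
  by apply: eq_integral => c _; rewrite p1.
have mh2s : measurable_fun setT (fun z : RR * RR => h2 (x.1.1 - z.1)%R (x.1.2 - z.2)%R).
  have m2 : measurable_fun setT (fun z : RR * RR => (x.1.1 - z.1, x.1.2 - z.2)%R) by meas.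
  exact: (measurableT_comp mh2 m2).
rewrite leb2E; [|by apply: meas_mule; [meas|apply: meas_mule; [meas|apply: meas_mule; [meas|exact: mh2s]]]|by nneg].
have mh2x a : measurable_fun setT (fun b : RR => h2 a (x.1.2 - b)%R).
  have m2 : measurable_fun setT (fun b : RR => (a, x.1.2 - b)%R) by meas.
  exact: (measurableT_comp mh2 m2).
apply: (@le_trans _ _ (\int[leb1]_a (w a * (n%:R%:E * (n%:R%:E * h1 (x.1.1 - a)%R))))).
  apply: le_integral_dom => a _; first by nneg.
  have W := @win (h2 (x.1.1 - a)%R) x.1.2 (mh2a _) (h20 _) (h2per _).
  apply: (@le_trans _ _ (w a * (n%:R%:E * \int[leb1]_b (w b * h2 (x.1.1 - a)%R (x.1.2 - b)%R)))).
    rewrite -!ge0_integralZl; last first.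
    - exact: nn0.
    - by nneg.
    - exact: (meas_mule mww (mh2x _)).
    - exact: measurableT.
    - exact: ww0.
    - by nneg.
    - by apply: meas_mule; [meas|exact: (meas_mule mww (mh2x _))].
    - exact: measurableT.
    rewrite le_eqVlt; apply/orP; left; apply/eqP; apply: eq_integral => b _ /=.
    by congr (_ * _); rewrite muleCA.
  apply: lee_wpmul2l; first exact: ww0.
  by apply: lee_wpmul2l; first exact: nn0.
have mh1x : measurable_fun setT (fun a : RR => h1 (x.1.1 - a)%R) by meas.
apply: (@le_trans _ _ (n%:R%:E * (n%:R%:E * (n%:R%:E * \int[leb1]_a (k a * h1 a))))).
  have W := @win h1 x.1.1 mh1 h10 h1per.
  apply: (@le_trans _ _ (n%:R%:E * (n%:R%:E * \int[leb1]_a (w a * h1 (x.1.1 - a)%R)))).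
    rewrite -!ge0_integralZl; last first.
    - exact: nn0.
    - by nneg.
    - by meas.
    - exact: measurableT.
    - exact: nn0.
    - by nneg.
    - by meas.
    - exact: measurableT.
    rewrite le_eqVlt; apply/orP; left; apply/eqP; apply: eq_integral => a _ /=.
    by rewrite muleCA; congr (_ * _); rewrite muleCA.
  apply: lee_wpmul2l; first exact: nn0.
  by apply: lee_wpmul2l; first exact: nn0.
rewrite !muleA -!EFinM; apply: lee_wpmul2r.
  by apply: integral_ge0 => a _; rewrite mule_ge0.
by rewrite lee_fin -!expr2 -exprSr lerDl.
Qed.

Lemma cube_exhaust (y : R3 R) : exists n : nat, cube n%:R y.
Proof.
exists (Num.truncn (`|y.1.1| + `|y.1.2| + `|y.2|)%R).+1.
have s0 : (0 <= `|y.1.1| + `|y.1.2| + `|y.2|)%R by rewrite !addr_ge0.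
have /andP[_ /ltW h] := truncn_itv s0.
have := normr_ge0 y.1.1; have := normr_ge0 y.1.2; have := normr_ge0 y.2 => a b c.
by apply/and3P; split; apply: le_trans h; lra.
Qed.

(** Space is exhausted by cubes, and each cube is covered by finitely many cells. *)
Lemma periodic_null Omega (h : R3 R -> \bar R) : measurable_fun setT h ->
  (forall y, 0 <= h y) -> on_domain Omega h ->
  \int[leb3]_y ((cellb Omega y)%:R%:E * h y) = 0 -> \int[leb3]_y h y = 0.
Proof.
move=> mh h0 per ih.
have aen n : {ae leb3, forall y, (cube n%:R y)%:R%:E * h y = 0}.
  have mcu := measurable_cube (n%:R).
  apply: integral0_ae; [by meas|by nneg|].
  have [C _ HC] := integral_cube_periodic Omega (ler0n R n).
  have := HC h 0%R mh h0 per; rewrite ih mule0 => le0.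
  rewrite -(@integral_reflect3 R 0%R (fun y => (cube n%:R y)%:R%:E * h y)); [|by meas|by nneg].
  apply/eqP; rewrite eq_le integral_ge0 ?andbT; last by nneg.
  apply: le_trans le0; apply: le_integral_dom => y _; first by nneg.
  by rewrite /cube/= !add0r !normrN.
apply: ae_integral0 => //; apply: filterS (ae_foralln aen) => y hy.
have [n cn] := cube_exhaust y.
by have := hy n; rewrite cn mul1e.
Qed.

End Periodic.

(** * Relative entropy and superlevel sets *)

Section Entropy.
Context {R : realType}.
Notation leb1 := (@lebesgue_measure R).
Notation RR := (measurableTypeR R).

(** By ln x <= x - 1 at x = sqrt (m / F): the square of the difference of the roots is
    at most the relative entropy density. *)
Lemma sqrt_distance_entropy (m F : R) : 0 < m -> 0 <= F ->
  (Num.sqrt F - Num.sqrt m) ^+ 2 <= F * ln F - m * ln m - (ln m + 1) * (F - m).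
Proof.
move=> m0 F0; rewrite sqrrB !sqr_sqrtr ?(ltW m0)// -mulr_natr.
set p := Num.sqrt F * Num.sqrt m.
have [F0'|F1] := eqVneq F 0.
  by rewrite /p F0' sqrtr0 ln0// !(mul0r, mulr0); lra.
have Fp : 0 < F by rewrite lt_def F1.
set r := Num.sqrt F; set s := Num.sqrt m.
have r0 : 0 < r by rewrite sqrtr_gt0.
have s0 : 0 < s by rewrite sqrtr_gt0.
have lnsr : ln (s / r) = (ln m - ln F) / 2.
  have FE : F = r ^+ 2 by rewrite sqr_sqrtr.
  have mE : m = s ^+ 2 by rewrite sqr_sqrtr// ltW.
  by rewrite ln_div// {1}FE {1}mE !lnXn// !mulr2n; field.
have le : ln (s / r) <= s / r - 1.
  by have := @le_ln1Dx R (s / r - 1); rewrite addrCA subrr addr0; apply; rewrite ltrBrDl subrr divr_gt0.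
have : F * ((ln m - ln F) / 2) <= p - F.
  rewrite -lnsr; apply: (le_trans (ler_wpM2l F0 le)).
  by rewrite mulrBr mulr1 lerB// -{1}[F]sqr_sqrtr// -/r -/s expr2 /p -/r -/s mulrACA divff ?mulr1 ?gt_eqF.
lra.
Qed.

(** If |r - s| were smaller than both s and k / 3, then r + s < 3 s, and the product
    of |r - s| and r + s would be smaller than k s. *)
Lemma sqrt_gap (k q s r : R) : 0 < k -> 0 < q -> q <= s -> 0 <= r ->
  k * s < `|r ^+ 2 - s ^+ 2| -> Num.min q (k / 3) ^+ 2 <= (r - s) ^+ 2.
Proof.
move=> k0 q0 qs r0 gap; rewrite leNgt; apply/negP => lt.
set p := Num.min q (k / 3) in lt.
have p0 : 0 <= p by rewrite le_min ltW//= divr_ge0 ?ltW.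
have pq : p <= q by rewrite ge_min lexx.
have pk : p <= k / 3 by rewrite ge_min lexx orbT.
have : `|r - s| < p.
  by rewrite -(ltr_pXn2r (n := 2)) ?nnegrE// real_normK ?num_real.
move=> rsp; move: gap; rewrite ltNge => /negP; apply.
rewrite subr_sqr normrM (ger0_norm (x := r + s)); last by lra.
apply: (@le_trans _ _ (k / 3 * (3 * s))); last by lra.
apply: ler_pM => //; first by lra.
  by apply: le_trans pk; exact: ltW.
by move: rsp; rewrite ltr_norml => /andP[]; lra.
Qed.

Lemma ln_maxwellian (v : R3 R) :
  ln (maxwellian v) = - (3 / 2 * ln (2 * pi)) - dot v v / 2.
Proof.
rewrite /maxwellian lnM ?posrE ?expR_gt0 ?powR_gt0 ?mulr_gt0 ?pi_gt0//.
by rewrite ln_powR expRK mulNr.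
Qed.

Lemma maxwellian_cube_lower (r : R) : exists2 q : R, 0 < q &
  forall v, cube r v -> q <= sqrt_mu v.
Proof.
exists (Num.sqrt ((2 * pi) `^ (- (3 / 2)) * expR (- (3 * r ^+ 2 / 2)))).
  by rewrite sqrtr_gt0 mulr_gt0 ?expR_gt0 ?powR_gt0 ?mulr_gt0 ?pi_gt0.
move=> v /and3P[v1 v2 v3]; rewrite ler_wsqrtr// ler_wpM2l ?powR_ge0// ler_expR lerN2.
have sq (a : R) : `|a| <= r -> a ^+ 2 <= r ^+ 2.
  move=> ar; rewrite -real_normK ?num_real// lerXn2r ?nnegrE//.
  by apply: le_trans ar.
have := sq _ v1; have := sq _ v2; have := sq _ v3; rewrite /dot -!expr2; lra.
Qed.

Lemma measurable_cell Omega : measurable (cell Omega : set (R3 R)).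
Proof.
by case: Omega => /=; [apply: measurableX; [apply: measurableX|]|].
Qed.

Lemma measurable_phase Omega : measurable (phase Omega : set (R3 R * R3 R)).
Proof. by apply: measurableX => //; exact: measurable_cell. Qed.

Local Open Scope ereal_scope.

Lemma integral_phase Omega (k : R3 R * R3 R -> \bar R) :
  \int[leb6]_(z in phase Omega) k z =
  \int[leb6]_z ((cellb Omega z.1)%:R%:E * k z).
Proof.
rewrite integral_mkcond; apply: eq_integral => z _; rewrite patchE.
have [zp|zp] := boolP (z \in phase Omega).
  by move: zp; rewrite inE => -[/cellbP -> _]; rewrite mul1e.
have -> : cellb Omega z.1 = false; last by rewrite mul0e.
apply/negP => /cellbP c; move/negP: zp; apply; rewrite inE; split => //.
Qed.

Section Bound.
Variables (Omega : spatial_domain) (h : R3 R -> R3 R -> R).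
Hypothesis mh : measurable_fun setT (fun z : R3 R * R3 R => h z.1 z.2).
Let F := density_of h.

Let ent (x v : R3 R) : R := (F x v * ln (F x v) - maxwellian v * ln (maxwellian v))%R.
Let mass (x v : R3 R) : R := (F x v - maxwellian v)%R.
Let ener (x v : R3 R) : R := (dot v v * (F x v - maxwellian v))%R.
Let psi (x v : R3 R) : R :=
  (ent x v + (3 / 2 * ln (2 * pi) - 1) * mass x v + 1 / 2 * ener x v)%R.

Lemma relative_entropyE : conserved_defects_integrable Omega F ->
  defect_entropy_integrable Omega F ->
  leb6.-integrable (phase Omega) (fun z => (psi z.1 z.2)%:E) /\
  relative_entropy Omega F = (\int[leb6]_(z in phase Omega) psi z.1 z.2)%R.
Proof.
move=> [im _ ie] ient; have mP := measurable_phase Omega.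
have im2 : leb6.-integrable (phase Omega)
    (EFin \o (fun z => ((3 / 2 * ln (2 * pi) - 1) * mass z.1 z.2)%R)).
  exact: (integrableZl mP _ im).
have ie2 : leb6.-integrable (phase Omega)
    (EFin \o (fun z => (1 / 2 * ener z.1 z.2)%R)).
  exact: (integrableZl mP _ ie).
have i1 : leb6.-integrable (phase Omega)
    (EFin \o (fun z => (ent z.1 z.2 + (3 / 2 * ln (2 * pi) - 1) * mass z.1 z.2)%R)).
  exact: (integrableD mP ient im2).
split; first exact: (integrableD mP i1 ie2).
rewrite /relative_entropy /defect_mass /defect_energy /defect_entropy /phase_integral.
by rewrite /psi (RintegralD mP i1 ie2) (RintegralD mP ient im2) !RintegralZl.
Qed.

(** Chebyshev's inequality for the relative entropy density, which
    [sqrt_distance_entropy] and [sqrt_gap] bound below wherever |h| > k and v lies in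
    the cube. *)
Lemma entropy_bound (eps k r q : R) : (0 < k)%R -> (0 < q)%R ->
  (forall v, cube r v -> (q <= sqrt_mu v)%R) ->
  conserved_defects_integrable Omega F -> defect_entropy_integrable Omega F ->
  ae_phase Omega (fun x v => 0 <= F x v)%R ->
  (relative_entropy Omega F <= eps)%R ->
  \int[leb6]_z ((cellb Omega z.1)%:R%:E *
     ((cube r z.2)%:R%:E * (k < `|h z.1 z.2|)%R%:R%:E)) <=
  (eps / Num.min q (k / 3) ^+ 2)%:E.
Proof.
move=> k0 q0 qs cd de Fge0 le.
have [ip rE] := relative_entropyE cd de; rewrite rE in le.
have mP := measurable_phase Omega.
set d := (Num.min q (k / 3) ^+ 2)%R.
have d0 : (0 < d)%R by rewrite exprn_gt0// lt_min q0 divr_gt0.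
have mcu := measurable_cube r.
pose I (z : R3 R * R3 R) : R := ((cube r z.2)%:R * (k < `|h z.1 z.2|)%R%:R)%R.
have mI : measurable_fun setT (I : _ -> RR) by rewrite /I; meas.
rewrite mulrC EFinM lee_pdivlMl// -integral_phase.
have psifin : \int[leb6]_(z in phase Omega) (psi z.1 z.2)%:E =
    ((\int[leb6]_(z in phase Omega) psi z.1 z.2)%R)%:E.
  by rewrite /Rintegral fineK//; exact: integrable_fin_num.
have psile z : (0 <= F z.1 z.2)%R ->
    (0 <= psi z.1 z.2)%R /\ (d * I z <= psi z.1 z.2)%R.
  move=> Fz; have := sqrt_distance_entropy (maxwellian_gt0 z.2) Fz.
  rewrite [leRHS](_ : _ = psi z.1 z.2); last first.
    by rewrite /psi /ent /mass /ener ln_maxwellian; lra.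
  move=> lp; split; first by apply: le_trans lp; exact: sqr_ge0.
  apply: le_trans lp; rewrite /I.
  case: (boolP (cube r z.2)) => [cz|_]; last by rewrite mul0r mulr0 sqr_ge0.
  case: (ltP k `|h z.1 z.2|%R) => [kz|_]; last by rewrite mulr0 mulr0 sqr_ge0.
  rewrite !mulr1; apply: sqrt_gap => //; first exact: qs.
  rewrite !sqr_sqrtr//; last by rewrite ltW// maxwellian_gt0.
  rewrite /F /density_of addrAC subrr add0r normrM ger0_norm ?sqrtr_ge0//.
  by rewrite mulrC ltr_pM2l// sqrt_mu_gt0.
have mpsi : measurable_fun (phase Omega) (fun z => (psi z.1 z.2)%:E) by case/integrableP: ip.
pose P z := maxe 0 ((psi z.1 z.2)%:E).
have mPp : measurable_fun (phase Omega) P by apply: measurable_maxe.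
have mdI : measurable_fun (phase Omega) (fun z => (d * I z)%:E).
  by apply: measurable_funTS; meas.
apply: (@le_trans _ _ (\int[leb6]_(z in phase Omega) (d * I z)%:E)).
  rewrite -ge0_integralZl; [|exact: mP| | |by rewrite lee_fin ltW].
  - rewrite le_eqVlt; apply/orP; left; apply/eqP; apply: eq_integral => z _.
    by rewrite /I !EFinM.
  - by apply: measurable_funTS; meas.
  - by nneg.
apply: (@le_trans _ _ (\int[leb6]_(z in phase Omega) P z)).
  apply: ae_ge0_le_integral => //.
  - by move=> z _; rewrite lee_fin mulr_ge0 ?(ltW d0)// /I mulr_ge0.
  - by move=> z _; rewrite le_max lexx.
  - apply: filterS Fge0 => z Fz zp; have [_ le1] := psile z (Fz zp).
    by rewrite le_max; apply/orP; right; rewrite lee_fin.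
rewrite (_ : \int[leb6]_(z in phase Omega) P z = \int[leb6]_(z in phase Omega) (psi z.1 z.2)%:E).
  by rewrite psifin lee_fin.
apply: ae_eq_integral => //.
apply: filterS Fge0 => z Fz zp; have [p0 _] := psile z (Fz zp).
by apply/max_idPr; rewrite lee_fin.
Qed.
End Bound.
End Entropy.

(** * Null sets along characteristics *)

Section NullSets.
Context {R : realType}.
Notation leb1 := (@lebesgue_measure R).
Notation RR := (measurableTypeR R).
Local Open Scope ereal_scope.

(** Tonelli's theorem for the indicator of a null set. *)
Lemma ae_slices d1 d2 (T1 : measurableType d1) (T2 : measurableType d2)
    (m1 : {sigma_finite_measure set T1 -> \bar R})
    (m2 : {sigma_finite_measure set T2 -> \bar R}) (P : T1 * T2 -> Prop) :
  {ae (m1 \x m2), forall z, P z} -> {ae m1, forall x, {ae m2, forall y, P (x, y)}}.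
Proof.
move=> [N [mN N0 PN]].
have mI : measurable_fun setT (fun z => (\1_N z)%:E : \bar R).
  by apply/measurable_EFinP; exact: measurable_indic.
have I0 z : 0 <= (\1_N z)%:E :> \bar R by rewrite lee_fin.
have : \int[m1]_x \int[m2]_y (\1_N (x, y))%:E = 0.
  rewrite -(@fubini_tonelli1 _ _ _ _ _ m1 m2 (fun z => (\1_N z)%:E))//.
  by rewrite integral_indic// setIT.
have mIx x : measurable_fun setT (fun y => (\1_N (x, y))%:E : \bar R).
  exact: (measurableT_comp mI (pair1_measurable x)).
move=> /(@integral0_ae _ _ _ m1 (fun x => \int[m2]_y (\1_N (x, y))%:E)) H.
apply: filterS (H _ _); last 2 first.
- exact: (measurable_fun_fubini_tonelli_F (m2 := m2) (fun z => (\1_N z)%:E)).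
- by move=> x; exact: integral_ge0.
move=> x /(integral0_ae (mIx x) (fun y => I0 (x, y))); apply: filterS => y yN.
apply: contrapT => nP; have := PN (x, y) nP => Nxy.
by move: yN; rewrite indicE mem_set// => -[] /eqP; rewrite oner_eq0.
Qed.

(** The weight is at least 1. *)
Lemma Linf_norm_ae Omega (beta M : R) (h : R3 R -> R3 R -> R) : (0 <= beta)%R ->
  Linf_norm Omega (fun x v => weight beta v * h x v)%R <= M%:E ->
  ae_phase Omega (fun x v => `|h x v| <= M)%R.
Proof.
move=> b0; rewrite /Linf_norm unlock.
case: ifPn => [_ /ess_supP|]; last first.
  rewrite -leNgt measure_le0 => /eqP m0 _; exists setT; split => //.
apply: filterS => z /= + zp; rewrite patchE mem_set//= lee_fin; apply: le_trans.
rewrite normrM ler_peMl// ger0_norm ?powR_ge0// /weight.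
apply: (@le_trans _ _ (1 `^ (beta / 2))%R); first by rewrite powR1.
have d0 := dot_ge0 z.2.
by rewrite ge0_ler_powR ?nnegrE ?divr_ge0// ?lerDl// addr_ge0.
Qed.

(** The velocity integral of the indicator is periodic in x, so that [periodic_null]
    propagates its vanishing from one cell to the whole space. *)
Lemma phase_null_global Omega (M : R) (h : R3 R -> R3 R -> R) :
  phase_function Omega h -> ae_phase Omega (fun x v => `|h x v| <= M)%R ->
  \int[leb6]_z (M < `|h z.1 z.2|)%R%:R%:E = 0.
Proof.
move=> [mh per] hM.
pose k (x v : R3 R) : \bar R := (M < `|h x v|)%R%:R%:E.
have mk : measurable_fun setT (fun z : R3 R * R3 R => k z.1 z.2) by rewrite /k; meas.
have k0 x v : 0 <= k x v by rewrite /k; nneg.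
rewrite -[LHS]/(\int[leb6]_z k z.1 z.2) leb6E//.
pose g x := \int[leb3]_v k x v.
have mg : measurable_fun setT g by exact: (@meas_int _ _ _ _ _ _ k).
have g0 x : 0 <= g x by apply: integral_ge0.
have mc := @measurable_cellb R Omega.
apply: (@periodic_null _ Omega g) => //.
  move: per; case: (Omega) => //= per x.
  by split; apply: eq_integral => v _; rewrite /k; have [p1 p2 p3] := per x; rewrite ?p1 ?p2 ?p3.
have mkx x : measurable_fun setT (k x).
  by have := measurableT_comp mk (pair1_measurable x).
rewrite /g (_ : (fun y => _) = (fun y => \int[leb3]_v ((cellb Omega y)%:R%:E * k y v))); last first.
  apply/funext => y; rewrite ge0_integralZl//.
rewrite -(leb6E (f := fun z => (cellb Omega z.1)%:R%:E * k z.1 z.2)); last 2 first.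
- by apply: meas_mule; [meas|exact: mk].
- by move=> z; rewrite mule_ge0// lee_fin.
apply: ae_integral0; [by apply: meas_mule; [meas|exact: mk]|by move=> z; rewrite mule_ge0// lee_fin|].
apply: filterS hM => z Hz; case: (boolP (cellb Omega z.1)) => [/cellbP c|_]; last by rewrite mul0e.
by rewrite /k ltNge Hz ?mule0//; split.
Qed.

Lemma integral_translate3 (e : R3 R) (h : R3 R -> \bar R) :
  measurable_fun setT h -> (forall x, 0 <= h x) ->
  \int[leb3]_p h (p - e)%R = \int[leb3]_p h p.
Proof.
move=> mh h0.
rewrite -(@integral_reflect3 R e (fun p => h (p - e)%R)); [|by meas|by []].
rewrite -(@integral_reflect3 R 0%R h)//.
by apply: eq_integral => p _; rewrite addrAC subrr.
Qed.

(** Free transport preserves Lebesgue measure in x at fixed v. *)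
Lemma exceed_transport (h : R3 R -> R3 R -> R) (M t : R) :
  measurable_fun setT (fun z : R3 R * R3 R => h z.1 z.2 : RR) ->
  \int[leb6]_z (M < `|h z.1 z.2|)%R%:R%:E = 0 ->
  {ae leb3, forall x, {ae leb3, forall v, `|h (x - smul t v)%R v| <= M}%R}.
Proof.
move=> mh null.
have mhc d (T : measurableType d) (x v : T -> R3 R) :
    measurable_fun setT x -> measurable_fun setT v ->
    measurable_fun setT (fun z => h (x z) (v z) : RR).
  move=> mx mv; have m2 : measurable_fun setT (fun z => (x z, v z)) by meas.
  exact: (measurableT_comp mh m2).
pose k (x v : R3 R) : \bar R := (M < `|h (x - smul t v)%R v|)%R%:R%:E.
have k0 x v : 0 <= k x v by rewrite /k; nneg.
have mk : measurable_fun setT (fun z : R3 R * R3 R => k z.1 z.2).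
  by rewrite /k; meas; apply: mhc; meas.
have : {ae leb3, forall x, \int[leb3]_v k x v = 0}.
  apply: (@integral0_ae _ _ _ leb3 (fun x => \int[leb3]_v k x v)).
  - exact: (@meas_int _ _ _ _ _ _ k).
  - by move=> x; exact: integral_ge0.
  rewrite (@integral_swap _ _ _ _ R leb3 leb3 k)//.
  rewrite -[RHS]null leb6E'; [|by meas|by nneg].
  apply: eq_integral => v _.
  apply: (@integral_translate3 (smul t v) (fun x => (M < `|h x v|)%R%:R%:E)); last by nneg.
  by meas; apply: mhc; meas.
apply: filterS => x ix.
have mkx : measurable_fun setT (k x).
  by have := measurableT_comp mk (pair1_measurable x).
apply: filterS (integral0_ae mkx (k0 x) ix) => v; rewrite /k => -[] /eqP; rewrite pnatr_eq0 eqb0 -leNgt.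
by [].
Qed.

End NullSets.

Section Exceptional.
Context {R : realType}.
Notation leb1 := (@lebesgue_measure R).
Notation RR := (measurableTypeR R).
Local Open Scope ereal_scope.

Variables (Omega : spatial_domain) (fh : RR -> R3 R -> R3 R -> R) (M : R).
Hypothesis mfh : measurable_fun setT
  (fun z : RR * (R3 R * R3 R) => fh z.1 z.2.1 z.2.2).
Hypothesis per : forall s, on_domain Omega (fh s).
Hypothesis null : forall s, \int[leb6]_z (M < `|fh s z.1 z.2|)%R%:R%:E = 0.

Lemma meas_fh d (T : measurableType d) (s : T -> RR) (x v : T -> R3 R) :
  measurable_fun setT s -> measurable_fun setT x -> measurable_fun setT v ->
  measurable_fun setT (fun z => fh (s z) (x z) (v z) : RR).
Proof.
move=> ms mx mv.
have m2 : measurable_fun setT (fun z => (s z, (x z, v z))) by meas.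
exact: (measurableT_comp mfh m2).
Qed.

(** At each time the slice is periodic in space, hence its measure in a window is at
    most a constant times that over one cell; it remains to integrate over
    |tau| <= r. *)
Lemma superlevel_leb7 (t k : R) (x : R3 R) (r : R) : (0 <= r)%R ->
  forall (C e : R), (0 <= C)%R ->
  (forall h (x : R3 R), measurable_fun setT h -> (forall y, 0 <= h y) -> on_domain Omega h ->
     \int[leb3]_y ((cube r y)%:R%:E * h (x - y)%R) <=
     C%:E * \int[leb3]_y ((cellb Omega y)%:R%:E * h y)) ->
  (forall s, \int[leb6]_z ((cellb Omega z.1)%:R%:E *
     ((cube r z.2)%:R%:E * (k < `|fh s z.1 z.2|)%R%:R%:E)) <= e%:E) ->
  \int[leb7]_p ((`|p.1| <= r)%R%:R%:E * ((cube r p.2.1)%:R%:E * ((cube r p.2.2)%:R%:E *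
     (k < `|fh (t - p.1) (x - p.2.1) p.2.2|)%R%:R%:E))) <= (2 * r * (C * e))%:E.
Proof.
move=> r0 C e C0 HC He.
have mcu := measurable_cube r; have mc := @measurable_cellb R Omega.
have mfh' := meas_fh.
have e0 : (0 <= e)%R by rewrite -lee_fin; apply: le_trans (He 0%R); apply: integral_ge0 => z _; nneg.
rewrite leb7E; [|by meas; apply: mfh'; meas|by nneg].
apply: (@le_trans _ _ (\int[leb1]_s ((- r <= s <= r)%R%:R%:E * (C * e)%:E))); last first.
  rewrite ge0_integralZr; [|exact: measurableT|by meas|by nneg|by rewrite lee_fin mulr_ge0].
  by rewrite integral_segment ?ge0_cp// -EFinM opprK lee_fin; rewrite (_ : (r + r) * (C * e) = 2 * r * (C * e))%R//; ring.
apply: le_integral_dom => s _ /=; first by apply: integral_ge0 => p _; nneg.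
rewrite -ler_norml; case: (boolP (`|s| <= r)%R) => _; last first.
  by rewrite mul0e integral0_eq// => p _; rewrite mul0e.
rewrite mul1e; under eq_integral do rewrite mul1e.
rewrite leb6E; [|by meas; apply: mfh'; meas|by nneg].
pose hh y := \int[leb3]_w ((cube r w)%:R%:E * (k < `|fh (t - s)%R y w|)%R%:R%:E).
have mhh : measurable_fun setT hh.
  apply: (@meas_int _ _ _ _ _ _ (fun y w => (cube r w)%:R%:E * (k < `|fh (t - s)%R y w|)%R%:R%:E)).
    by meas; apply: mfh'; meas.
  by nneg.
have hh0 y : 0 <= hh y by apply: integral_ge0 => w _; nneg.
have hper : on_domain Omega hh.
  move: (per (t - s)%R); case: (Omega) => //= per' y.
  by split; apply: eq_integral => w _; have [p1 p2 p3] := per' y; rewrite ?p1 ?p2 ?p3.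
rewrite (_ : \int[leb3]_y _ = \int[leb3]_y ((cube r y)%:R%:E * hh (x - y)%R)); last first.
  apply: eq_integral => y _ /=; rewrite ge0_integralZl; [by []|exact: measurableT| |by nneg|by nneg].
  by meas; apply: mfh'; meas.
apply: (le_trans (HC hh x mhh hh0 hper)).
rewrite EFinM; apply: lee_wpmul2l; first by rewrite lee_fin.
apply: le_trans (He (t - s)%R); rewrite leb6E; [|by meas; apply: mfh'; meas|by nneg].
rewrite le_eqVlt; apply/orP; left; apply/eqP; apply: eq_integral => y _ /=.
rewrite ge0_integralZl; [by []|exact: measurableT| |by nneg|by nneg].
by meas; apply: mfh'; meas.
Qed.

Lemma exceed_leb7 (t : R) (x : R3 R) :
  \int[leb7]_p (M < `|fh (t - p.1) (x - p.2.1) p.2.2|)%R%:R%:E = 0.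
Proof.
rewrite leb7E; [|by meas; apply: meas_fh; meas|by nneg].
apply: integral0_eq => s _ /=.
rewrite leb6E'; [|by meas; apply: meas_fh; meas|by nneg].
rewrite -[RHS](null (t - s)%R) leb6E'; [|by meas; apply: meas_fh; meas|by nneg].
apply: eq_integral => w _ /=.
apply: (@integral_reflect3 R x (fun y => (M < `|fh (t - s)%R y w|)%R%:R%:E)); last by nneg.
by meas; apply: meas_fh; meas.
Qed.

(** As in [exceed_transport], with an additional integration in time. *)
Lemma exceed_trajectory (t : R) :
  {ae leb3, forall x, \int[leb3]_v \int[leb1]_s
     (M < `|fh s (x - smul (t - s) v)%R v|)%R%:R%:E = 0}.
Proof.
pose k (x v : R3 R) (s : RR) : \bar R := (M < `|fh s (x - smul (t - s) v)%R v|)%R%:R%:E.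
have k0 x v s : 0 <= k x v s by rewrite /k; nneg.
pose g x v := \int[leb1]_s k x v s.
have g0 x v : 0 <= g x v by exact: integral_ge0.
have mg : measurable_fun setT (fun z : R3 R * R3 R => g z.1 z.2).
  apply: (@meas_int _ _ _ _ _ _ (fun z s => k z.1 z.2 s)) => //.
  by rewrite /k; meas; apply: meas_fh; meas.
apply: (@integral0_ae _ _ _ leb3 (fun x => \int[leb3]_v g x v)).
- exact: (@meas_int _ _ _ _ _ _ g).
- by move=> x; exact: integral_ge0.
rewrite (@integral_swap _ _ _ _ R leb3 leb3 g)//.
transitivity (\int[leb3]_v \int[leb1]_s \int[leb3]_x k x v s).
  apply: eq_integral => v _; apply: (@integral_swap _ _ _ _ R leb3 leb1 (fun x s => k x v s)) => //.
  by rewrite /k; meas; apply: meas_fh; meas.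
pose l (v : R3 R) (s : RR) := \int[leb3]_x (M < `|fh s x v|)%R%:R%:E.
transitivity (\int[leb3]_v \int[leb1]_s l v s).
  apply: eq_integral => v _; apply: eq_integral => s _.
  apply: (@integral_translate3 R (smul (t - s) v) (fun x => (M < `|fh s x v|)%R%:R%:E)); last by nneg.
  by meas; apply: meas_fh; meas.
rewrite (@integral_swap _ _ _ _ R leb3 leb1 l).
- apply: integral0_eq => s _; rewrite -[RHS](null s) leb6E'; [by []| |by nneg].
  by meas; apply: meas_fh; meas.
- apply: (@meas_int _ _ _ _ _ _ (fun z x => (M < `|fh z.2 x z.1|)%R%:R%:E)); last by nneg.
  by meas; apply: meas_fh; meas.
- by move=> v s; apply: integral_ge0 => x _; nneg.
Qed.

End Exceptional.

(** * Scattering of small sets *)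

Section FlowEstimates.
Context {R : realType}.
Notation leb1 := (@lebesgue_measure R).
Notation RR := (measurableTypeR R).
Local Open Scope ereal_scope.

Variables (gamma Cb c : R).
Hypotheses (hg : (-3 < gamma <= 1)%R) (Cb0 : (0 < Cb)%R) (c0 : (0 < c)%R).
Local Notation d := (scattering_density gamma Cb c).
Let md := @measurable_scattering_density R gamma Cb c.
Let d0 := @scattering_density_ge0 R gamma Cb c Cb0.

Section OneMap.
Variable wm : R3 R -> R3 R -> RR * RR -> R3 R.
Hypothesis mwm : measurable_fun setT
  (fun z : (R3 R * R3 R) * (RR * RR) => wm z.1.1 z.1.2 z.2).
Hypothesis nullwm : forall v (k : R3 R -> \bar R), measurable_fun setT k ->
  (forall p, 0 <= k p) -> \int[leb3]_p k p = 0 ->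
  \int[leb3]_u \int[leb2]_a ((sphere_weight a)%:E * k (wm v u a)) = 0.

Definition window (r : R) (p : RR * (R3 R * R3 R)) : bool :=
  (`|p.1| <= r)%R && (cube r p.2.1 && cube r p.2.2).

Lemma measurable_window r : measurable_fun setT (window r).
Proof. by have mc := @measurable_cube R r; rewrite /window; meas. Qed.

Lemma window_exhaust p : exists n : nat, forall m, (n <= m)%N -> window m%:R p.
Proof.
have [n1 h1] := cube_exhaust (p.1, 0%R, 0%R); have [n2 h2] := cube_exhaust p.2.1.
have [n3 h3] := cube_exhaust p.2.2.
exists (n1 + n2 + n3)%N => m le.
have le1 : (n1%:R <= m%:R :> R)%R by rewrite ler_nat (leq_trans _ le)// -addnA leq_addr.
have le2 : (n2%:R <= m%:R :> R)%R by rewrite ler_nat (leq_trans _ le)// addnAC leq_addl.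
have le3 : (n3%:R <= m%:R :> R)%R by rewrite ler_nat (leq_trans _ le)// leq_addl.
move: h1 h2 h3 => /and3P[/= a1 _ _] /and3P[b1 b2 b3] /and3P[e1 e2 e3].
rewrite /window /cube (le_trans a1)// (le_trans b1)// (le_trans b2)// (le_trans b3)//.
by rewrite (le_trans e1)// (le_trans e2)// (le_trans e3).
Qed.

(** Dominated convergence, since the windows exhaust the space. *)
Lemma flow_tail (e : R) : (0 < e)%R -> exists n : nat,
  \int[leb9]_z ((d z)%:E * (~~ window n%:R (flow_map wm z))%:R%:E) < e%:E.
Proof.
move=> e0; have mF := measurable_flow_map mwm.
pose f_ (n : nat) z := (d z)%:E * (~~ window n%:R (flow_map wm z))%:R%:E.
have mf n : measurable_fun setT (f_ n).
  apply: meas_mule; first by meas.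
  apply: meas_EFin; apply: meas_bool; apply: measurable_neg.
  exact: (measurableT_comp (measurable_window n%:R) mF).
have cv : \int[leb9]_z f_ n z @[n --> \oo] --> \int[leb9]_z (cst 0) z.
  apply: (@dominated_cvg _ _ _ leb9 setT measurableT f_ (cst 0) (fun z => (d z)%:E)).
  - exact: mf.
  - move=> z _; have [n hn] := window_exhaust (flow_map wm z).
    apply: cvg_near_cst; exists n => // m /= nm.
    by rewrite /f_ hn// mule0.
  - by [].
  - exact: scattering_density_integrable.
  - move=> n z _; rewrite /f_ gee0_abs; last by rewrite mule_ge0 ?lee_fin.
    by case: (window _ _); rewrite ?mule0 ?mule1 lee_fin.
have : \forall n \near \oo, \int[leb9]_z f_ n z < e%:E.
  apply: (cv [set y | y < e%:E]); apply: open_nbhs_nbhs; split.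
    exact: open_ereal_lt_ereal.
  by rewrite /= integral0 lte_fin.
by move=> [n _ /(_ n (leqnn n))]; exists n.
Qed.

(** Outside a large window the scattering density has small mass; inside the window
    the absolute continuity of the flow map applies. *)
Lemma flow_localized (e : R) : (0 < e)%R -> exists (n : nat) (dl : R), (0 < dl)%R /\
  forall A : RR * (R3 R * R3 R) -> bool, measurable_fun setT A ->
  \int[leb7]_p ((window n%:R p)%:R%:E * (A p)%:R%:E) < dl%:E ->
  \int[leb9]_z ((d z)%:E * (A (flow_map wm z))%:R%:E) < e%:E.
Proof.
move=> e0; have e20 : (0 < e / 2)%R by rewrite divr_gt0.
have [n tail] := flow_tail e20.
have [dl dl0 ac] := flow_map_abs_continuous hg Cb0 c0 mwm nullwm e20.
exists n, dl; split => // A mA hA.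
have mF := measurable_flow_map mwm.
have mW := measurable_window n%:R.
have mAF : measurable_fun setT (fun z => A (flow_map wm z)) by exact: (measurableT_comp mA mF).
have mWF : measurable_fun setT (fun z => window n%:R (flow_map wm z)) by exact: (measurableT_comp mW mF).
have mNF : measurable_fun setT (fun z => ~~ window n%:R (flow_map wm z)).
  exact: measurable_neg.
pose B : set (RR * (R3 R * R3 R)) := [set p | window n%:R p && A p].
have mB : measurable B.
  have H := meas_and mW mA; rewrite -[B]setTI.
  exact: (H measurableT [set true]).
have -> : \int[leb9]_z ((d z)%:E * (A (flow_map wm z))%:R%:E) =
    \int[leb9]_z ((d z)%:E * (A (flow_map wm z) && window n%:R (flow_map wm z))%:R%:E +
                  (d z)%:E * (A (flow_map wm z) && ~~ window n%:R (flow_map wm z))%:R%:E).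
  apply: eq_integral => z _.
  by case: (A _); case: (window _ _); rewrite /= ?mule0 ?mule1 ?adde0 ?add0e.
have mAW := meas_and mAF mWF; have mAN := meas_and mAF mNF.
rewrite ge0_integralD; [|exact: measurableT| | | |].
- rewrite [X in _ < X](_ : _ = (e / 2)%:E + (e / 2)%:E); last first.
    by rewrite -EFinD; congr EFin; field.
  apply: lteD.
  + rewrite (_ : \int[leb9]_z _ = \int[leb9]_(z in flow_map wm @^-1` B) (d z)%:E).
      apply: ac => //.
      apply: le_lt_trans hA; rewrite -(setIT B) -(integral_indic leb7 measurableT mB).
      apply: le_integral_dom => p _; first by rewrite lee_fin indicE ler0n.
      rewrite -EFinM lee_fin indicE.
      case: (boolP (p \in B)) => [|_]; last by rewrite mulr_ge0.
      by rewrite inE => /andP[-> ->]; rewrite mulr1.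
    rewrite [RHS]integral_mkcond; apply: eq_integral => z _; rewrite patchE.
    case: (boolP (_ \in _)) => [|].
      by rewrite inE => /andP[-> ->]; rewrite mule1.
    by rewrite notin_setE => /negP; rewrite andbC => /negbTE ->; rewrite mule0.
  + apply: le_lt_trans tail; apply: le_integral_dom => z _.
      by rewrite mule_ge0 ?lee_fin.
    rewrite lee_wpmul2l ?lee_fin// ler_nat.
    by case: (A _); case: (window _ _).
- by move=> z _; rewrite mule_ge0 ?lee_fin.
- by apply: meas_mule; meas.
- by move=> z _; rewrite mule_ge0 ?lee_fin.
- by apply: meas_mule; meas.
Qed.

Variable Omega : spatial_domain.

(** What is retained of the entropy inequality: the conclusion of [entropy_bound] at
    every time and in every cube of velocities. *)
Definition small_superlevels (k eps : R) (fh : RR -> R3 R -> R3 R -> R) : Prop :=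
  forall (r q : R) (s : RR), (0 < q)%R -> (forall v, cube r v -> (q <= sqrt_mu v)%R) ->
  \int[leb6]_z ((cellb Omega z.1)%:R%:E *
     ((cube r z.2)%:R%:E * (k < `|fh s z.1 z.2|)%R%:R%:E)) <=
  (eps / Num.min q (k / 3) ^+ 2)%:E.

(** The family [fh] seen from the point (t, x), along backward times and
    displacements. *)
Definition backward (fh : RR -> R3 R -> R3 R -> R) (t : R) (x : R3 R)
    (p : RR * (R3 R * R3 R)) : R := fh (t - p.1)%R (x - p.2.1)%R p.2.2.

Lemma measurable_backward fh t x :
  measurable_fun setT (fun z : RR * (R3 R * R3 R) => fh z.1 z.2.1 z.2.2 : RR) ->
  measurable_fun setT (backward fh t x : _ -> RR).
Proof. by move=> mfh; rewrite /backward; apply: (meas_fh mfh); meas. Qed.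

(** The window and the tolerance given by [flow_localized] depend on e alone; then eps
    is so small that the superlevel set has a measure below the tolerance in this
    window, whatever t and x are. *)
Lemma scattered_superlevel (k e : R) : (0 < k)%R -> (0 < e)%R ->
  exists2 eps : R, (0 < eps)%R & forall fh,
  measurable_fun setT (fun z : RR * (R3 R * R3 R) => fh z.1 z.2.1 z.2.2 : RR) ->
  (forall s, on_domain Omega (fh s)) -> small_superlevels k eps fh ->
  forall t x, \int[leb9]_z ((d z)%:E *
    (k < `|backward fh t x (flow_map wm z)|)%R%:R%:E) < e%:E.
Proof.
move=> k0 e0; have [n [dl [dl0 loc]]] := flow_localized e0.
have [C C0 box] := integral_cube_periodic Omega (ler0n R n).
have [q q0 qle] := @maxwellian_cube_lower R n%:R.
set cc := (Num.min q (k / 3) ^+ 2)%R.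
have cc0 : (0 < cc)%R by rewrite exprn_gt0// lt_min q0 divr_gt0.
have B0 : (0 <= 2 * n%:R * C)%R by rewrite mulr_ge0 ?mulr_ge0// ltW.
exists (dl / (2 * n%:R * C + 1) * cc)%R.
  by rewrite mulr_gt0// divr_gt0// ltr_wpDl.
move=> fh mfh per small t x.
have mb := measurable_backward t x mfh.
apply: (loc (fun p => (k < `|backward fh t x p|)%R)); first by meas.
have small' s := small n%:R q s q0 qle.
apply: le_lt_trans (_ : _ <= (2 * n%:R * (C * (dl / (2 * n%:R * C + 1))))%:E) _.
  apply: le_trans (superlevel_leb7 (Omega := Omega) mfh per t x (ler0n R n) (ltW C0) box (k := k) _).
    rewrite le_eqVlt; apply/orP; left; apply/eqP; apply: eq_integral => p _.
    by rewrite /window/backward !muleA -!EFinM -!natrM !mulnb andbA.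
  move=> s; apply: le_trans (small' s) _.
  by rewrite lee_fin -/cc mulfK// gt_eqF.
have B1 : (0 < 2 * n%:R * C + 1)%R by rewrite ltr_wpDl.
rewrite lte_fin mulrA mulrCA gtr_pMr// ltr_pdivrMr// mul1r; lra.
Qed.

(** An upper bound of |fh| in three levels: the threshold k, the value M on the
    superlevel set, and +oo on the null set where the bound by M fails. *)
Definition envelope (k M : R) (fh : RR -> R3 R -> R3 R -> R) (t : R) (x : R3 R)
    (p : RR * (R3 R * R3 R)) : \bar R :=
  k%:E + (M%:E * (k < `|backward fh t x p|)%R%:R%:E +
          +oo * (M < `|backward fh t x p|)%R%:R%:E).

Lemma measurable_envelope k M fh t x :
  measurable_fun setT (fun z : RR * (R3 R * R3 R) => fh z.1 z.2.1 z.2.2 : RR) ->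
  measurable_fun setT (envelope k M fh t x).
Proof.
move=> mfh; have mb := measurable_backward t x mfh.
by rewrite /envelope; meas.
Qed.

Lemma envelope_ge0 k M fh t x p : (0 <= k)%R -> (0 <= M)%R -> 0 <= envelope k M fh t x p.
Proof.
by move=> k0 M0; rewrite !adde_ge0 ?mule_ge0 ?lee_fin ?leey.
Qed.

(** The three levels are integrated by means of the total mass of the density, of
    [scattered_superlevel] and of [flow_map_null_fun]. *)
Lemma scattered_envelope (k M e : R) : (0 < k)%R -> (0 <= M)%R -> (0 < e)%R ->
  exists2 eps : R, (0 < eps)%R & forall fh,
  measurable_fun setT (fun z : RR * (R3 R * R3 R) => fh z.1 z.2.1 z.2.2 : RR) ->
  (forall s, on_domain Omega (fh s)) -> small_superlevels k eps fh ->
  (forall s, \int[leb6]_z (M < `|fh s z.1 z.2|)%R%:R%:E = 0) ->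
  forall t x, \int[leb9]_z ((d z)%:E * envelope k M fh t x (flow_map wm z)) <=
    k%:E * \int[leb9]_z (d z)%:E + (M * e)%:E.
Proof.
move=> k0 M0 e0; have [eps eps0 H] := scattered_superlevel k0 e0.
exists eps => // fh mfh per small null t x; have {}H := H fh mfh per small t x.
have mb := measurable_backward t x mfh; have mF := measurable_flow_map mwm.
pose b z := backward fh t x (flow_map wm z).
have mbF : measurable_fun setT (b : _ -> RR) by exact: (measurableT_comp mb mF).
pose N z := (d z)%:E * (+oo * (M < `|b z|)%R%:R%:E).
pose A z := (d z)%:E * (k < `|b z|)%R%:R%:E.
have oo0 : 0 <= +oo :> \bar R by [].
have d0' z : 0 <= (d z)%:E by rewrite lee_fin.
have N0 z : 0 <= N z by rewrite mule_ge0 ?mule_ge0 ?lee_fin.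
have A0 z : 0 <= A z by rewrite mule_ge0 ?lee_fin.
have mN : measurable_fun setT N by rewrite /N; meas.
have mA : measurable_fun setT A by rewrite /A; meas.
have iN : \int[leb9]_z N z = 0.
  apply: (flow_map_null_fun gamma c Cb0 mwm nullwm
    (h := fun p => +oo * (M < `|backward fh t x p|)%R%:R%:E)).
  - by meas.
  - by move=> p; rewrite mule_ge0 ?lee_fin.
  - apply: (@integral0_support _ _ _ leb7 _ (fun p => (M < `|backward fh t x p|)%R%:R%:E)).
    + by meas.
    + by meas.
    + by move=> p; rewrite mule_ge0 ?lee_fin.
    + by move=> p; rewrite lee_fin.
    + by move=> p ->; rewrite mule0.
    + exact: (exceed_leb7 mfh null).
have -> : \int[leb9]_z ((d z)%:E * envelope k M fh t x (flow_map wm z)) =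
    \int[leb9]_z (k%:E * (d z)%:E + (M%:E * A z + N z)).
  apply: eq_integral => z _; rewrite /envelope -/(b z).
  rewrite ge0_muleDr ?mule_ge0 ?lee_fin ?adde_ge0 ?mule_ge0 ?lee_fin ?(ltW k0)//.
  rewrite ge0_muleDr ?mule_ge0 ?lee_fin//.
  by rewrite muleC; congr (_ + (_ + _)); rewrite /A muleCA.
rewrite ge0_integralD; [|exact: measurableT| | | |]; last 4 first.
- by move=> z _; rewrite mule_ge0// lee_fin ltW.
- by meas.
- by move=> z _; rewrite adde_ge0// mule_ge0.
- by meas.
rewrite ge0_integralZl; [|exact: measurableT|by meas|by []|by rewrite lee_fin ltW].
apply: leeD2l.
rewrite ge0_integralD; [|exact: measurableT| |by meas|by []|by []]; last first.
  by move=> z _; rewrite mule_ge0.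
rewrite iN adde0 ge0_integralZl; [|exact: measurableT|by []|by []|by []].
by rewrite EFinM lee_wpmul2l// ltW.
Qed.

End OneMap.

(** Tonelli's theorem, the order of integration being v, tau, u, a on the left and v,
    u, a, tau on the right. *)
Lemma collision_majorant_flow (G : RR * (R3 R * R3 R) -> \bar R) :
  measurable_fun setT G -> (forall p, 0 <= G p) ->
  \int[leb3]_v ((sqrt_mu v)%:E * \int[leb1]_s
    (((0 <= s)%R%:R * expR (- (c / (1 + dot v v) ^+ 2 * s)))%:E *
     collision_majorant gamma Cb v (fun w => G (s, (smul s v, w))))) =
  \int[leb9]_z ((d z)%:E * (G (flow_map (fun _ u _ => u) z) +
     G (flow_map (fun v u a => post_v v u (sphere_point a)) z) +
     G (flow_map (fun v u a => post_u v u (sphere_point a)) z))).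
Proof.
move=> mG G0.
pose S v u a s : \bar R := G (s, (smul s v, u)) + G (s, (smul s v, post_v v u (sphere_point a))) +
   G (s, (smul s v, post_u v u (sphere_point a))).
have S0 v u a s : 0 <= S v u a s by rewrite /S !adde_ge0.
pose k v u a s : \bar R := (d ((v, u), (a, s)))%:E * S v u a s.
have k0 v u a s : 0 <= k v u a s by rewrite /k mule_ge0// lee_fin.
have mk d1 (T : measurableType d1) (v u : T -> R3 R) (a : T -> RR * RR) (s : T -> RR) :
    measurable_fun setT v -> measurable_fun setT u -> measurable_fun setT a ->
    measurable_fun setT s -> measurable_fun setT (fun z => k (v z) (u z) (a z) (s z)).
  move=> mv mu ma ms; rewrite /k; apply: meas_mule.
    have mp : measurable_fun setT (fun z => ((v z, u z), (a z, s z))) by meas.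
    exact: (meas_EFin (measurableT_comp md mp)).
  by rewrite /S /post_v /post_u; meas.
transitivity (\int[leb9]_z k z.1.1 z.1.2 z.2.1 z.2.2); last by apply: eq_integral.
rewrite leb9E; [|by apply: mk; meas|by move=> z].
rewrite leb6E; [| |by move=> z; exact: integral_ge0]; last first.
  apply: (@meas_int _ _ _ _ _ _ (fun z q => k z.1 z.2 q.1 q.2)); first by apply: mk; meas.
  by move=> z q.
apply: eq_integral => v _ /=.
transitivity (\int[leb3]_u \int[leb2]_a \int[leb1]_s k v u a s); last first.
  apply: eq_integral => u _; rewrite leb3E; [by []|by apply: mk; meas|by move=> z].
transitivity (\int[leb1]_s \int[leb3]_u \int[leb2]_a k v u a s); last first.
  rewrite (@integral_swap _ _ _ _ R leb1 leb3 (fun s u => \int[leb2]_a k v u a s)).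
  - apply: eq_integral => u _; apply: (@integral_swap _ _ _ _ R leb1 leb2 (fun s a => k v u a s)).
      by apply: mk; meas.
    by move=> s a.
  - apply: (@meas_int _ _ _ _ _ _ (fun z a => k v z.2 a z.1)); first by apply: mk; meas.
    by move=> z a.
  - by move=> s u; apply: integral_ge0.
have smv0 : 0 <= (sqrt_mu v)%:E by rewrite lee_fin sqrt_mu_ge0.
have msm := @measurable_sqrt_mu R; have msw := @measurable_sphere_weight R.
pose E s : R := ((0 <= s)%R%:R * expR (- (c / (1 + dot v v) ^+ 2 * s)))%R.
have E0 s : (0 <= E s)%R by rewrite mulr_ge0 ?expR_ge0.
pose J u a s : \bar R := (norm3 (v - u)%R `^ gamma * Cb * sphere_weight a)%:E * ((sqrt_mu u)%:E * S v u a s).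
have J0 u a s : 0 <= J u a s.
  rewrite mule_ge0 ?mule_ge0 ?lee_fin ?sqrt_mu_ge0//.
  apply: mulr_ge0; last exact: sphere_weight_ge0.
  by apply: mulr_ge0; [exact: powR_ge0|exact: ltW].
have mJ d1 (T : measurableType d1) (u : T -> R3 R) (a : T -> RR * RR) (s : T -> RR) :
    measurable_fun setT u -> measurable_fun setT a ->
    measurable_fun setT s -> measurable_fun setT (fun z => J (u z) (a z) (s z)).
  by move=> mu ma ms; rewrite /J /norm3 /S /post_v /post_u; meas.
have mJ1 : measurable_fun setT (fun z : RR * R3 R => \int[leb2]_a J z.2 a z.1).
  apply: (@meas_int _ _ _ _ _ _ (fun z a => J z.2 a z.1)); first by apply: mJ; meas.
  by move=> z a.
have J10 s u : 0 <= \int[leb2]_a J u a s by exact: integral_ge0.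
have mJ2 : measurable_fun setT (fun s : RR => \int[leb3]_u \int[leb2]_a J u a s).
  apply: (@meas_int _ _ _ _ _ leb3 (fun (s : RR) u => \int[leb2]_a J u a s)).
    exact: mJ1.
  by move=> s u; exact: J10.
have mE : measurable_fun setT (E : RR -> RR) by rewrite /E; meas.
rewrite -ge0_integralZl; [|exact: measurableT| | |exact: smv0]; last 2 first.
- by apply: meas_mule; [exact: (meas_EFin mE)|exact: mJ2].
- by move=> s _; rewrite mule_ge0 ?lee_fin ?E0//; apply: integral_ge0 => u _; exact: J10.
apply: eq_integral => s _.
rewrite -[X in _ * (_ * X)]/(\int[leb3]_u \int[leb2]_a J u a s) -[(_ * expR _)%R]/(E s).
rewrite muleA -EFinM -ge0_integralZl; [|exact: measurableT| | |]; last 3 first.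
- apply: (@meas_int _ _ _ _ _ _ (fun u a => J u a s)); first by apply: mJ; meas.
  by move=> z a.
- by move=> u _; exact: J10.
- by rewrite lee_fin mulr_ge0 ?sqrt_mu_ge0.
apply: eq_integral => u _.
rewrite -ge0_integralZl; [|exact: measurableT| |by move=> *; exact: J0|]; last 2 first.
- by apply: mJ; meas.
- by rewrite lee_fin mulr_ge0 ?sqrt_mu_ge0.
apply: eq_integral => a _.
rewrite /J /k !muleA -!EFinM; congr (_%:E * _).
by rewrite /scattering_density /E /=; ring.
Qed.

End FlowEstimates.

(** * The Duhamel formula as an inequality *)

Section Duhamel.
Context {R : realType}.
Notation leb1 := (@lebesgue_measure R).
Notation RR := (measurableTypeR R).
Local Open Scope ereal_scope.

Variables (gamma Cb c : R).
Hypotheses (hg : (-3 < gamma <= 1)%R) (Cb0 : (0 < Cb)%R) (c0 : (0 < c)%R).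
Local Notation d := (scattering_density gamma Cb c).

Definition damping (v : R3 R) (s : R) : R :=
  ((0 <= s)%R%:R * expR (- (c / (1 + dot v v) ^+ 2 * s)))%R.

(** The time integral of the collision terms in the Duhamel formula, for an envelope
    [G] read along the backward characteristic of velocity v. *)
Definition scattered (G : RR * (R3 R * R3 R) -> \bar R) (v : R3 R) : \bar R :=
  \int[leb1]_s ((damping v s)%:E *
     collision_majorant gamma Cb v (fun w => G (s, (smul s v, w)))).

Lemma damping_ge0 v s : (0 <= damping v s)%R.
Proof. by rewrite mulr_ge0 ?expR_ge0. Qed.

Lemma measurable_majorant_flow G d1 (T : measurableType d1) (v : T -> R3 R) (s : T -> RR) :
  measurable_fun setT G -> (forall p, 0 <= G p) ->
  measurable_fun setT v -> measurable_fun setT s ->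
  measurable_fun setT (fun z => collision_majorant gamma Cb (v z)
     (fun w => G (s z, (smul (s z) (v z), w)))).
Proof.
move=> mG G0 mv ms; have msm := @measurable_sqrt_mu R; have msw := @measurable_sphere_weight R.
pose J v u a s : \bar R := (norm3 (v - u)%R `^ gamma * Cb * sphere_weight a)%:E *
  ((sqrt_mu u)%:E * (G (s, (smul s v, u)) + G (s, (smul s v, post_v v u (sphere_point a))) +
    G (s, (smul s v, post_u v u (sphere_point a))))).
have J0 v' u a s' : 0 <= J v' u a s'.
  apply: mule_ge0; last by rewrite mule_ge0 ?lee_fin ?sqrt_mu_ge0// !adde_ge0.
  rewrite lee_fin; apply: mulr_ge0; last exact: sphere_weight_ge0.
  by apply: mulr_ge0; [exact: powR_ge0|exact: ltW].
apply: (@meas_int _ _ _ _ _ leb3 (fun z u => \int[leb2]_a J (v z) u a (s z))); last first.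
  by move=> z u; exact: integral_ge0.
apply: (@meas_int _ _ _ _ _ leb2 (fun z a => J (v z.1) z.2 a (s z.1))); last first.
  by move=> z a.
by rewrite /J /norm3 /post_v /post_u; meas.
Qed.

Lemma collision_majorant_ge0 v Gh : (forall w, 0 <= Gh w) -> 0 <= collision_majorant gamma Cb v Gh.
Proof.
move=> G0; apply: integral_ge0 => u _; apply: integral_ge0 => a _.
apply: mule_ge0; last by rewrite mule_ge0 ?lee_fin ?sqrt_mu_ge0// !adde_ge0.
rewrite lee_fin; apply: mulr_ge0; last exact: sphere_weight_ge0.
by apply: mulr_ge0; [exact: powR_ge0|exact: ltW].
Qed.

Lemma measurable_scattered G : measurable_fun setT G -> (forall p, 0 <= G p) ->
  measurable_fun setT (scattered G).
Proof.
move=> mG G0; apply: (@meas_int _ _ _ _ _ leb1 (fun v s => (damping v s)%:E *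
     collision_majorant gamma Cb v (fun w => G (s, (smul s v, w))))).
  apply: meas_mule; first by rewrite /damping; meas.
  by apply: measurable_majorant_flow => //; meas.
by move=> v s; rewrite mule_ge0 ?lee_fin ?damping_ge0 ?collision_majorant_ge0.
Qed.

Lemma scattered_ge0 G v : (forall p, 0 <= G p) -> 0 <= scattered G v.
Proof.
move=> G0; apply: integral_ge0 => s _.
by rewrite mule_ge0 ?lee_fin ?damping_ge0 ?collision_majorant_ge0.
Qed.

(** For w = u the average over omega is only a bounded factor. *)
Lemma null_partner (v : R3 R) (k : R3 R -> \bar R) : measurable_fun setT k ->
  (forall p, 0 <= k p) -> \int[leb3]_p k p = 0 ->
  \int[leb3]_u \int[leb2]_a ((sphere_weight a)%:E * k u) = 0.
Proof.
move=> mk k0 ik; apply/eqP; rewrite eq_le; apply/andP; split; last first.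
  apply: integral_ge0 => u _; apply: integral_ge0 => a _.
  by rewrite mule_ge0 ?lee_fin ?sphere_weight_ge0.
have P0 : (0 <= 2 * pi * pi :> R)%R by rewrite !mulr_ge0 ?pi_ge0.
apply: (@le_trans _ _ (\int[leb3]_u ((2 * pi * pi)%:E * k u))).
  apply: le_integral_dom => u _; last exact: integral_sphere_cst.
  by apply: integral_ge0 => a _; rewrite mule_ge0 ?lee_fin ?sphere_weight_ge0.
rewrite ge0_integralZl; [|exact: measurableT|exact: mk|by []|by rewrite lee_fin].
by rewrite ik mule0.
Qed.

(** The velocities u, v' and u' are three instances of [scattered_envelope]; eps is the
    smallest of the three thresholds. *)
Lemma scattered_total Omega (k M e : R) : (0 < k)%R -> (0 <= M)%R -> (0 < e)%R ->
  exists2 eps : R, (0 < eps)%R & forall fh,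
  measurable_fun setT (fun z : RR * (R3 R * R3 R) => fh z.1 z.2.1 z.2.2 : RR) ->
  (forall s, on_domain Omega (fh s)) -> small_superlevels Omega k eps fh ->
  (forall s, \int[leb6]_z (M < `|fh s z.1 z.2|)%R%:R%:E = 0) ->
  forall t x, \int[leb3]_v ((sqrt_mu v)%:E * scattered (envelope k M fh t x) v) <=
    3%:E * (k%:E * \int[leb9]_z (d z)%:E + (M * e)%:E).
Proof.
move=> k0 M0 e0.
have mu1 : measurable_fun setT (fun z : (R3 R * R3 R) * (RR * RR) => z.1.2) by meas.
have mv' : measurable_fun setT (fun z : (R3 R * R3 R) * (RR * RR) =>
   post_v z.1.1 z.1.2 (sphere_point z.2)) by rewrite /post_v; meas.
have mu' : measurable_fun setT (fun z : (R3 R * R3 R) * (RR * RR) =>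
   post_u z.1.1 z.1.2 (sphere_point z.2)) by rewrite /post_u; meas.
have [e1 e10 H1] := scattered_envelope hg Cb0 c0 mu1 null_partner Omega k0 M0 e0.
have [e2 e20 H2] := scattered_envelope hg Cb0 c0 mv'
  (fun v k mk kge ik => (null_gain v mk kge ik).1) Omega k0 M0 e0.
have [e3 e30 H3] := scattered_envelope hg Cb0 c0 mu'
  (fun v k mk kge ik => (null_gain v mk kge ik).2) Omega k0 M0 e0.
exists (Num.min e1 (Num.min e2 e3)); first by rewrite !lt_min e10 e20.
move=> fh mfh per small null t x.
have sm_le e' : (Num.min e1 (Num.min e2 e3) <= e')%R -> small_superlevels Omega k e' fh.
  move=> le r q s q0 qs; apply: le_trans (small r q s q0 qs) _.
  by rewrite lee_fin ler_wpM2r// invr_ge0 sqr_ge0.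
have l1 : (Num.min e1 (Num.min e2 e3) <= e1)%R by rewrite ge_min lexx.
have l2 : (Num.min e1 (Num.min e2 e3) <= e2)%R by rewrite !ge_min lexx orbT.
have l3 : (Num.min e1 (Num.min e2 e3) <= e3)%R by rewrite !ge_min lexx !orbT.
have {}H1 := H1 fh mfh per (sm_le e1 l1) null t x.
have {}H2 := H2 fh mfh per (sm_le e2 l2) null t x.
have {}H3 := H3 fh mfh per (sm_le e3 l3) null t x.
have mG := measurable_envelope k M t x mfh.
have G0 p : 0 <= envelope k M fh t x p by apply: envelope_ge0 => //; exact: ltW.
have := @collision_majorant_flow R gamma Cb c Cb0 _ mG G0.
rewrite -[LHS]/(\int[leb3]_v ((sqrt_mu v)%:E * scattered (envelope k M fh t x) v)) => ->.
set G := envelope k M fh t x in mG G0 H1 H2 H3 *.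
pose T1 z := (d z)%:E * G (flow_map (fun _ u (_ : RR * RR) => u) z).
pose T2 z := (d z)%:E * G (flow_map (fun v u a => post_v v u (sphere_point a)) z).
pose T3 z := (d z)%:E * G (flow_map (fun v u a => post_u v u (sphere_point a)) z).
have md := @measurable_scattering_density R gamma Cb c.
have d0 z : 0 <= (d z)%:E by rewrite lee_fin scattering_density_ge0.
have m1 : measurable_fun setT T1.
  by have mF := @measurable_flow_map R (fun _ u (_ : RR * RR) => u) mu1; rewrite /T1; meas.
have m2 : measurable_fun setT T2.
  by have mF := @measurable_flow_map R (fun v u a => post_v v u (sphere_point a)) mv'; rewrite /T2; meas.
have m3 : measurable_fun setT T3.
  by have mF := @measurable_flow_map R (fun v u a => post_u v u (sphere_point a)) mu'; rewrite /T3; meas.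
have p1 z : 0 <= T1 z by rewrite mule_ge0.
have p2 z : 0 <= T2 z by rewrite mule_ge0.
have p3 z : 0 <= T3 z by rewrite mule_ge0.
rewrite (_ : \int[leb9]_z _ = \int[leb9]_z (T1 z + T2 z + T3 z)); last first.
  apply: eq_integral => z _; rewrite ge0_muleDr//; last by rewrite adde_ge0.
  by rewrite ge0_muleDr.
rewrite ge0_integralD; [|exact: measurableT|by move=> z _; rewrite adde_ge0|by meas|by []|exact: m3].
rewrite ge0_integralD; [|exact: measurableT|by []|exact: m1|by []|exact: m2].
set X := k%:E * _ + _ in H1 H2 H3 *.
have X0 : 0 <= X by apply: le_trans H1; apply: integral_ge0 => z _; exact: p1.
rewrite (_ : 3%:E * X = X + X + X).
  by apply: leeD; [apply: leeD; [exact: H1|exact: H2]|exact: H3].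
have -> : 3%:E = 1%:E + 1%:E + 1%:E :> \bar R by rewrite -!EFinD; congr EFin; ring.
by rewrite !ge0_muleDl ?mul1e ?adde_ge0 ?lee_fin.
Qed.

Lemma envelope_dom (k M : R) fh t x p : (0 <= k)%R -> (0 <= M)%R ->
  `|backward fh t x p|%:E <= envelope k M fh t x p.
Proof.
move=> k0 M0; rewrite /envelope.
have [Mb|Mb] := ltP M (`|backward fh t x p|)%R.
  have -> : +oo * (true%:R)%:E = +oo :> \bar R by rewrite mule1.
  by rewrite -EFinM !addey ?leey.
rewrite mule0 adde0; have [kb|kb] := ltP k (`|backward fh t x p|)%R.
  by rewrite mule1 -EFinD lee_fin; lra.
by rewrite mule0 adde0 lee_fin.
Qed.

Lemma envelope_oo (k M : R) fh t x p : (0 <= M)%R ->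
  (M < `|backward fh t x p|)%R -> envelope k M fh t x p = +oo.
Proof.
move=> M0 Mb; rewrite /envelope Mb.
have -> : +oo * (true%:R)%:E = +oo :> \bar R by rewrite mule1.
rewrite [X in _ + X]addey; first by rewrite addey.
by rewrite -EFinM.
Qed.

Lemma integral_reflect1 (t : R) (h : RR -> \bar R) : measurable_fun setT h ->
  (forall s, 0 <= h s) -> \int[leb1]_s h (t - s)%R = \int[leb1]_s h s.
Proof.
move=> mh h0; transitivity (\int[leb1]_s h (-1 * s + t)%R).
  by apply: eq_integral => s _; congr h; ring.
rewrite (@integral_affineV _ (-1) t h) ?oppr_eq0 ?oner_eq0//.
by rewrite normrN1 invr1 mul1e.
Qed.

Section Pointwise.
Variables (b : R -> R) (k M t : R) (x v : R3 R) (fh : RR -> R3 R -> R3 R -> R).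
Hypotheses (bCb : forall z, (0 <= bcos b z <= Cb)%R).
Hypothesis (nuc : (c / (1 + dot v v) ^+ 2 <= nu gamma b v)%R).
Hypotheses (k0 : (0 < k)%R) (M1 : (1 <= M)%R) (t0 : (0 <= t)%R).
Hypothesis mfh : measurable_fun setT
  (fun z : RR * (R3 R * R3 R) => fh z.1 z.2.1 z.2.2 : RR).
Hypothesis null : \int[leb1]_s (M < `|fh s (x - smul (t - s) v)%R v|)%R%:R%:E = 0.
Let G := envelope k M fh t x.
Let maj s := collision_majorant gamma Cb v (fun w => G (s, (smul s v, w))).

(** Change of variable s = t - tau. At the times where the bound by M fails the
    integrand is dominated by the term with +oo only, and these times form a null
    set. *)
Lemma duhamel_integral_bound (T : R -> R) :
  (forall s, (0 <= s <= t)%R -> `|T s|%:E <= M%:E * maj (t - s)%R +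
     +oo * (M < `|fh s (x - smul (t - s) v)%R v|)%R%:R%:E) ->
  `|\int[leb1]_(s in `[0%R, t]) (expR (- (nu gamma b v * (t - s))) * T s)|%:E <=
  M%:E * scattered G v.
Proof.
move=> HT; have M0 : (0 <= M)%R by apply: le_trans M1.
have mG : measurable_fun setT G by exact: measurable_envelope.
have G0 p : 0 <= G p by apply: envelope_ge0 => //; exact: ltW.
have maj0 s : 0 <= maj s by exact: collision_majorant_ge0.
have mmaj : measurable_fun setT (maj : RR -> \bar R).
  by apply: measurable_majorant_flow => //; meas.
have mda : measurable_fun setT (damping v : RR -> RR) by rewrite /damping; meas.
have da0 s : 0 <= (damping v s)%:E by rewrite lee_fin damping_ge0.
pose bad s : \bar R := (M < `|fh (t - s)%R (x - smul s v)%R v|)%R%:R%:E.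
have mbad : measurable_fun setT (bad : RR -> \bar R).
  by rewrite /bad; meas; apply: (meas_fh mfh); meas.
have bad0 s : 0 <= bad s by rewrite lee_fin.
have ibad : \int[leb1]_s bad s = 0.
  rewrite -[RHS]null -(integral_reflect1 t mbad bad0).
  by apply: eq_integral => s _; rewrite /bad subKr.
pose h s := (damping v s)%:E * (M%:E * maj s + +oo * bad s).
have MM0 : 0 <= M%:E by rewrite lee_fin.
have oo0 s : 0 <= +oo * bad s by rewrite mule_ge0 ?leey.
have Mm0 s : 0 <= M%:E * maj s by rewrite mule_ge0.
have hh0 s : 0 <= h s by rewrite /h mule_ge0// adde_ge0.
have mh : measurable_fun setT (h : RR -> \bar R) by rewrite /h; meas.
apply: (@le_trans _ _ (\int[leb1]_(s in `[0%R, t]) h (t - s)%R)).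
  apply: normr_Rintegral_dom => s; rewrite /= in_itv/= => st.
  have {}HT := HT s st; move: st => /andP[s0 st].
  rewrite normrM EFinM ger0_norm ?expR_ge0// /h.
  apply: lee_pmul; rewrite ?lee_fin ?expR_ge0//.
    rewrite /damping subr_ge0 st mul1r ler_expR lerN2 ler_wpM2r// subr_ge0//.
  by rewrite /bad subKr.
rewrite integral_mkcond.
apply: (@le_trans _ _ (\int[leb1]_s h (t - s)%R)).
  by apply: le_integral_dom => s _; rewrite patchE; case: ifP.
rewrite (integral_reflect1 t mh hh0).
rewrite (_ : \int[leb1]_s h s =
    \int[leb1]_s (M%:E * ((damping v s)%:E * maj s) + (damping v s)%:E * (+oo * bad s))); last first.
  apply: eq_integral => s _; rewrite /h ge0_muleDr ?mule_ge0//.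
  by rewrite muleCA.
have mdm : measurable_fun setT (fun s : RR => (damping v s)%:E * maj s) by meas.
rewrite ge0_integralD; [|exact: measurableT| |by meas| |by meas]; last 2 first.
- by move=> s _; rewrite !mule_ge0.
- by move=> s _; rewrite !mule_ge0.
rewrite ge0_integralZl; [|exact: measurableT|by []| |by []]; last first.
  by move=> s _; rewrite mule_ge0.
rewrite [X in _ + X](_ : _ = 0) ?adde0 ?lexx//.
apply: (@integral0_support _ _ _ leb1 _ bad) => //.
- by meas.
- by move=> s; rewrite !mule_ge0.
- by move=> s ->; rewrite !mule0.
Qed.

(** Both K and Gamma are at most M times the majorant, whence the factor 2 M. *)
Lemma duhamel_bound (f0 : R3 R -> R3 R -> R) (f : R -> R3 R -> R3 R -> R) :
  (forall s, (0 <= s)%R -> fh s = f s) ->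
  (`|f0 (x - smul t v) v| <= M)%R ->
  f t x v = (expR (- (nu gamma b v * t)) * f0 (x - smul t v) v
          + \int[leb1]_(s in `[0, t])
              (expR (- (nu gamma b v * (t - s))) *
               K gamma b (f s (x - smul (t - s) v)) v)
          + \int[leb1]_(s in `[0, t])
              (expR (- (nu gamma b v * (t - s))) *
               Gamma gamma b (f s (x - smul (t - s) v))
                             (f s (x - smul (t - s) v)) v))%R ->
  `|f t x v|%:E <= (M * expR (- (c / (1 + dot v v) ^+ 2 * t)))%:E +
     (2 * M)%:E * scattered G v.
Proof.
move=> fhf f0M ->; have M0 : (0 <= M)%R by apply: le_trans M1.
have mG : measurable_fun setT G by exact: measurable_envelope.
have G0 p : 0 <= G p by apply: envelope_ge0 => //; exact: ltW.
have sc0 := scattered_ge0 v G0.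
set I1 := (\int[leb1]_(s in _) _)%R; set I2 := (\int[leb1]_(s in _) _)%R.
have Gs s : measurable_fun setT (fun w => G (t - s, (smul (t - s) v, w)))%R by meas.
have hG s w : (0 <= s)%R ->
    `|f s (x - smul (t - s) v)%R w|%:E <= G (t - s, (smul (t - s) v, w))%R.
  move=> s0; have := @envelope_dom k M fh t x (t - s, (smul (t - s) v, w))%R (ltW k0) M0.
  by rewrite /backward/= subKr fhf.
have hoo s w : (0 <= s)%R -> (M < `|f s (x - smul (t - s) v) w|)%R ->
    G (t - s, (smul (t - s) v, w))%R = +oo.
  by move=> s0 Mf; apply: envelope_oo => //; rewrite /backward/= subKr fhf.
have b1 : `|I1|%:E <= M%:E * scattered G v.
  apply: duhamel_integral_bound => s /andP[s0 st].
  apply: (le_trans (K_bound gamma Cb0 bCb (Gs s) (fun w => hG s w s0) v)).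
  have mj0 : 0 <= maj (t - s)%R by exact: collision_majorant_ge0.
  apply: (@le_trans _ _ (M%:E * maj (t - s)%R)); first by rewrite lee_pemull.
  by rewrite leeDl// mule_ge0 ?leey ?lee_fin.
have b2 : `|I2|%:E <= M%:E * scattered G v.
  apply: duhamel_integral_bound => s /andP[s0 st].
  have mj0 : 0 <= maj (t - s)%R by exact: collision_majorant_ge0.
  have [fM|fM] := ltP M (`|fh s (x - smul (t - s) v) v|)%R.
    have -> : +oo * (true%:R)%:E = +oo :> \bar R by rewrite mule1.
    by rewrite addey ?leey// -ltNye (lt_le_trans (ltNyr 0))// mule_ge0 ?lee_fin.
  rewrite mule0 adde0; rewrite fhf// in fM.
  exact: (Gamma_bound gamma Cb0 bCb M1 (Gs s) (fun w => hG s w s0) (fun w => hoo s w s0) fM).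
apply: (@le_trans _ _ ((M * expR (- (c / (1 + dot v v) ^+ 2 * t)))%:E + (`|I1|%:E + `|I2|%:E))).
  rewrite -!EFinD lee_fin; apply: (le_trans (ler_normD _ _)).
  rewrite addrA lerD2r; apply: (le_trans (ler_normD _ _)); rewrite lerD2r.
  rewrite normrM ger0_norm ?expR_ge0// mulrC; apply: ler_pM => //.
  by rewrite ler_expR lerN2 ler_wpM2r.
apply: leeD2l; apply: (le_trans (leeD b1 b2)).
rewrite -ge0_muleDl ?lee_fin// -EFinD lee_wpmul2r// lee_fin; lra.
Qed.

End Pointwise.

End Duhamel.

(** * From the solution to its density *)

Section Damped.
Context {R : realType}.
Notation leb1 := (@lebesgue_measure R).
Notation RR := (measurableTypeR R).
Local Open Scope ereal_scope.

(** By e^{-y} <= 1 / y, decay in time is bought with the growth (1 + |v|^2)^2 in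
    velocity, which the Gaussian absorbs. *)
Lemma damped_sqrt_mu_integral (c : R) : (0 < c)%R -> exists2 D : R, (0 < D)%R &
  forall t, (0 < t)%R ->
  \int[leb3]_v (sqrt_mu v * expR (- (c / (1 + dot v v) ^+ 2 * t)))%:E <= (D / t)%:E.
Proof.
move=> c0; set g := (Num.sqrt (pi / 8^-1) ^+ 3 : R)%R.
have g0 : (0 < g)%R by rewrite exprn_gt0// sqrtr_gt0 divr_gt0 ?pi_gt0 ?invr_gt0.
pose a : R := (16 ^+ 2)%R.
have a0 : (0 < a)%R by exact: exprn_gt0.
exists (a / c * g)%R; first by rewrite mulr_gt0 ?divr_gt0.
move=> t t0; apply: (@le_trans _ _ (\int[leb3]_v ((a / c / t)%:E * (expR (- (8^-1 * dot v v)))%:E))).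
  apply: le_integral_dom => v _; first by rewrite lee_fin mulr_ge0 ?sqrt_mu_ge0 ?expR_ge0.
  rewrite -EFinM lee_fin; set q := dot v v; have q0 : (0 <= q)%R by exact: dot_ge0.
  have q1 : (0 < 1 + q)%R by rewrite ltr_pwDl.
  set y := (c / (1 + q) ^+ 2 * t)%R.
  have y0 : (0 < y)%R by rewrite mulr_gt0 ?divr_gt0 ?exprn_gt0.
  have ey : (expR (- y) <= y^-1)%R.
    by rewrite expRN lef_pV2 ?posrE ?expR_gt0// (le_trans _ (expR_ge1Dx y))// lerDr.
  have sq : ((1 + q) ^+ 2 <= a * expR (8^-1 * q))%R.
    have h : (0 < (16^-1 : R) <= 1)%R by rewrite invr_gt0 invf_le1//= ltr0n ler1n.
    have := one_add_le_expR h q0; rewrite invrK => le.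
    apply: (@le_trans _ _ ((16 * expR (16^-1 * q)) ^+ 2)%R).
      by rewrite lerXn2r// ?nnegrE ?mulr_ge0 ?expR_ge0// ltW.
    rewrite exprMn /a -expRM_natl; apply: ler_wpM2l; first exact: ltW.
    rewrite ler_expR -mulr_natl; lra.
  apply: (@le_trans _ _ (expR (- (4^-1 * q)) * y^-1)%R).
    by apply: ler_pM; rewrite ?sqrt_mu_ge0 ?expR_ge0 ?sqrt_mu_le_gauss.
  have -> : (y^-1 = (1 + q) ^+ 2 / c / t)%R.
    by rewrite /y; field; rewrite !gt_eqF.
  apply: (@le_trans _ _ (expR (- (4^-1 * q)) * (a * expR (8^-1 * q) / c / t))%R).
    by rewrite ler_wpM2l ?expR_ge0// ler_pM2r ?invr_gt0// ler_pM2r ?invr_gt0.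
  have -> : (expR (- (8^-1 * q)) = expR (- (4^-1 * q)) * expR (8^-1 * q))%R.
    by rewrite -expRD; congr expR; field.
  by rewrite le_eqVlt; apply/orP; left; apply/eqP; ring.
rewrite ge0_integralZl; [|exact: measurableT|by meas|by nneg|]; last first.
  by rewrite lee_fin ltW// !divr_gt0.
rewrite integral_gauss3 ?invr_gt0// -/g -EFinM lee_fin le_eqVlt.
by apply/orP; left; apply/eqP; ring.
Qed.

(** The domination makes sqrt (mu) h integrable, which is what allows the integral of
    mu + sqrt (mu) h to be split; mu has mass 1. *)
Lemma density_defect_bound (h : R3 R -> R) (B : R3 R -> \bar R) (m : R) :
  measurable_fun setT (h : _ -> RR) -> measurable_fun setT B -> (forall v, 0 <= B v) ->
  {ae leb3, forall v, `|h v|%:E <= B v} ->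
  \int[leb3]_v ((sqrt_mu v)%:E * B v) <= m%:E ->
  (`|\int[leb3]_v (maxwellian v + Num.sqrt (maxwellian v) * h v) - 1| =
   `|\int[leb3]_v (maxwellian v + Num.sqrt (maxwellian v) * h v - maxwellian v)|)%R /\
  (`|\int[leb3]_v (maxwellian v + Num.sqrt (maxwellian v) * h v - maxwellian v)| <= m)%R.
Proof.
move=> mh mB B0 hB Bm; have msm := @measurable_sqrt_mu R.
pose g v := (sqrt_mu v * h v)%R.
have mg : measurable_fun setT (g : _ -> RR) by rewrite /g; meas.
have gE v : (maxwellian v + Num.sqrt (maxwellian v) * h v - maxwellian v = g v)%R.
  by rewrite addrAC subrr add0r.
have gle : \int[leb3]_v `|g v|%:E <= m%:E.
  apply: le_trans Bm; apply: ae_ge0_le_integral => //.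
  - by meas.
  - by move=> v _; rewrite mule_ge0 ?lee_fin ?sqrt_mu_ge0.
  - by meas.
  - apply: filterS hB => v hv _.
    by rewrite normrM EFinM ger0_norm ?sqrt_mu_ge0// lee_wpmul2l ?lee_fin ?sqrt_mu_ge0.
have ig : leb3.-integrable setT (EFin \o g).
  apply/integrableP; split; first exact/measurable_EFinP.
  by apply: le_lt_trans gle _; exact: ltry.
have imu : leb3.-integrable setT (EFin \o (@maxwellian R)).
  apply/integrableP; split; first by apply/measurable_EFinP; rewrite /maxwellian; meas.
  under eq_integral do rewrite /= ger0_norm ?ltW ?maxwellian_gt0//.
  by rewrite integral_maxwellian ltry.
have gm : (`|\int[leb3]_v g v| <= m)%R.
  rewrite -lee_fin; apply: le_trans gle.
  exact: normr_Rintegral_dom.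
have -> : (\int[leb3]_v (maxwellian v + Num.sqrt (maxwellian v) * h v - maxwellian v) =
    \int[leb3]_v g v)%R by apply: eq_Rintegral => v _; exact: gE.
have -> : (\int[leb3]_v (maxwellian v + Num.sqrt (maxwellian v) * h v) =
    1 + \int[leb3]_v g v)%R.
  rewrite (@RintegralD _ _ _ leb3 setT (@maxwellian R) g measurableT imu ig).
  by congr (_ + _)%R; rewrite /Rintegral integral_maxwellian.
by rewrite addrAC subrr add0r.
Qed.

End Damped.

Section Reduction.
Context {R : realType}.
Notation leb1 := (@lebesgue_measure R).
Notation RR := (measurableTypeR R).
Variables (Omega : spatial_domain) (f0 : R3 R -> R3 R -> R) (f : R -> R3 R -> R3 R -> R).

(** Relative entropy differs from entropy by conserved quantities. *)
Lemma relative_entropy_nonincreasing (F0 : R3 R -> R3 R -> R) (F : R -> R3 R -> R3 R -> R) t :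
  0 <= t -> conservation_laws Omega F0 F -> entropy_inequality Omega F0 F ->
  relative_entropy Omega (F t) <= relative_entropy Omega F0.
Proof.
move=> t0 cons ent; have [_ mE _ eE] := cons t t0; have [_ le] := ent t t0.
by rewrite /relative_entropy mE eE !lerD2r.
Qed.

Lemma L1x_Linfv_norm_ge0 (h : R3 R -> R3 R -> R) : (0 <= L1x_Linfv_norm Omega h)%E.
Proof. by apply: integral_ge0 => x _; exact: Lnorm_ge0. Qed.

(** The solution is continued by 0 to negative times, in order to have a measurable
    function of all times. *)
Definition extend0 (s : RR) (x v : R3 R) : R := if 0 <= s then f s x v else 0.

Lemma extend0E s : 0 <= s -> extend0 s = f s.
Proof. by move=> s0; rewrite /extend0 s0. Qed.

Lemma extend0_neg s x v : s < 0 -> extend0 s x v = 0.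
Proof. by rewrite ltNge /extend0 => /negbTE ->. Qed.

Lemma measurable_extend0 :
  measurable_fun ([set t : RR | 0 <= t] `*` setT)
    (fun z : RR * (R3 R * R3 R) => f z.1 z.2.1 z.2.2) ->
  measurable_fun setT (fun z : RR * (R3 R * R3 R) => extend0 z.1 z.2.1 z.2.2 : RR).
Proof.
have mD : measurable ([set t : RR | 0 <= t] `*` [set: R3 R * R3 R]).
  apply: measurableX => //; rewrite (_ : [set t : RR | 0 <= t] = `[0, +oo[%classic).
    exact: measurable_itv.
  by apply/seteqP; split => s /=; rewrite in_itv/= andbT.
move=> /(measurable_restrictT _ mD); congr (measurable_fun _ _).
apply/funext => z; rewrite patchE /extend0; case: ifPn => [|nz].
  by rewrite inE => -[/= -> _].
by case: ifPn => // z0; move: nz; rewrite notin_setE => -[]; split.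
Qed.

Lemma on_domain_extend0 : (forall t, 0 <= t -> on_domain Omega (f t)) ->
  forall s, on_domain Omega (extend0 s).
Proof.
move=> per s; have [s0|s0] := leP 0 s; first by rewrite extend0E//; exact: per.
by case: (Omega) => //= x; split; apply/funext => v; rewrite !extend0_neg.
Qed.

End Reduction.

(** The initial datum, the values below the threshold k = 1 / (24 M (L + 1)), and the
    superlevel set with e = 1 / (24 M^2) contribute at most 1/4 each. *)
Lemma three_quarter_budget (R : realType) (M L D t : R) : 1 <= M -> 0 <= L -> 0 < t ->
  4 * M * D <= t ->
  M * (D / t) + 2 * M * (3 * ((24 * M * (L + 1))^-1 * L + M * (24 * M ^+ 2)^-1)) <= 3 / 4.
Proof.
move=> M1 L0 t0 tT; have M0 : 0 < M by exact: lt_le_trans ltr01 M1.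
have first : M * (D / t) <= 4^-1.
  rewrite mulrA ler_pdivrMr//; lra.
have L1 : 0 < L + 1 by rewrite ltr_wpDl.
have -> : 2 * M * (3 * ((24 * M * (L + 1))^-1 * L + M * (24 * M ^+ 2)^-1)) =
    4^-1 * (L / (L + 1)) + 4^-1 by field; rewrite !gt_eqF.
have : L / (L + 1) <= 1 by rewrite ler_pdivrMr// mul1r lerDl.
lra.
Qed.

Theorem corollary1p5 (R : realType) (Omega : spatial_domain)
    (gamma : R) (hgamma : -3 < gamma <= 1)
    (b : R -> R) (hb : angular_kernel b)
    (beta : R) (hbeta : Num.max 3 (3 + gamma) < beta)
    (C1 : R) (hC1 : 0 < C1)
    (Mbar : R) (hMbar : 1 <= Mbar) :
  exists2 eps0 : R, 0 < eps0 &
  forall (f0 : R3 R -> R3 R -> R) (f : R -> R3 R -> R3 R -> R),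
    let F0 := density_of f0 in
    let F := fun t => density_of (f t) in
    phase_function Omega f0 ->
    ae_phase Omega (fun x v => 0 <= F0 x v) ->
    (Linf_norm Omega (fun x v => (weight beta v * f0 x v)%R) <= Mbar%:E)%E ->
    ((relative_entropy Omega F0)%:E + L1x_Linfv_norm Omega f0 <= eps0%:E)%E ->
    mild_solution Omega gamma b f0 f ->
    (forall t, 0 <= t -> ae_phase Omega (fun x v => 0 <= F t x v)) ->
    conservation_laws Omega F0 F ->
    entropy_inequality Omega F0 F ->
    (forall t, 0 <= t ->
       (Linf_norm Omega (fun x v => (weight beta v * f t x v)%R)
          <= (C1 * Mbar ^+ 2)%:E)%E) ->
  exists2 T0 : R, 0 < T0 &
  forall t, T0 <= t ->
    ae_space Omega (fun x =>
      `|\int[leb3]_v F t x v - 1| = `|\int[leb3]_v (F t x v - maxwellian v)|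
      /\ `|\int[leb3]_v (F t x v - maxwellian v)| <= 3 / 4).
Proof.
have [Cb Cb0 bCb] := bcos_bound hb.
have [c c0 nuc] := nu_lower hgamma hb.
pose M : R := Num.max Mbar (C1 * Mbar ^+ 2).
have M1 : 1 <= M by rewrite le_max hMbar.
have M0 : 0 < M by exact: lt_le_trans ltr01 M1.
have [D D0 HD] := damped_sqrt_mu_integral c0.
have dfin := scattering_density_fin hgamma Cb0 c0.
have dge : (0 <= \int[leb9]_z (scattering_density gamma Cb c z)%:E)%E.
  by apply: integral_ge0 => z _; rewrite lee_fin scattering_density_ge0.
pose L : R := fine (\int[leb9]_z (scattering_density gamma Cb c z)%:E)%E.
have LE : (\int[leb9]_z (scattering_density gamma Cb c z)%:E = L%:E)%E.
  by rewrite fineK// ge0_fin_numE.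
have L0 : 0 <= L by rewrite fine_ge0.
(* k and e are the threshold and the tolerance of [three_quarter_budget] *)
pose k : R := (24 * M * (L + 1))^-1.
have k0 : 0 < k by rewrite invr_gt0 mulr_gt0 ?mulr_gt0// ltr_wpDl.
pose e : R := (24 * M ^+ 2)^-1.
have e0 : 0 < e by rewrite invr_gt0 mulr_gt0 ?exprn_gt0.
have beta0 : 0 <= beta.
  by move: hbeta; rewrite gt_max => /andP[b3 _]; apply: ltW; exact: lt_trans b3.
have [eps0 eps00 H] := scattered_total hgamma Cb0 c0 Omega k0 (ltW M0) e0.
exists eps0 => // f0 f F0 F [mf0 per0] F0ge f0M small [mf perf mild] Fge cons ent fM.
have re0 : relative_entropy Omega F0 <= eps0.
  rewrite -lee_fin; apply: le_trans small.
  by rewrite leeDl// L1x_Linfv_norm_ge0.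
pose fh := extend0 f.
have mfh := measurable_extend0 mf; have perh := on_domain_extend0 perf.
have fM' t : 0 <= t -> ae_phase Omega (fun x v => `|f t x v| <= M).
  move=> t0; apply: (Linf_norm_ae beta0); apply: (le_trans (fM t t0)).
  by rewrite lee_fin le_max lexx orbT.
have mft t : 0 <= t -> measurable_fun setT (fun z : R3 R * R3 R => f t z.1 z.2).
  by move=> t0; rewrite -(extend0E f t0); apply: (meas_fh mfh); meas.
have null s : (\int[leb6]_z (M < `|fh s z.1 z.2|)%R%:R%:E = 0)%E.
  have [s0|s0] := leP 0 s.
    by rewrite /fh extend0E//; apply: phase_null_global (fM' s s0); split; [exact: mft|exact: perf].
  apply: integral0_eq => z _; rewrite /fh extend0_neg// normr0 ltNge (ltW M0).
  by [].
have smallh : small_superlevels Omega k eps0 fh.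
  move=> r q s q0 qs; have [s0|s0] := leP 0 s.
    rewrite /fh extend0E//; apply: entropy_bound => //.
    - exact: mft.
    - by have [] := cons s s0.
    - by have [] := ent s s0.
    - exact: Fge.
    - exact: le_trans (relative_entropy_nonincreasing s0 cons ent) re0.
  rewrite integral0_eq => [|z _].
    by rewrite lee_fin divr_ge0 ?sqr_ge0 ?ltW.
  by rewrite /fh extend0_neg// normr0 ltNge (ltW k0)/= !mule0.
exists (4 * M * D + 1); first by rewrite ltr_wpDl// !mulr_ge0 ?ltW.
move=> t tT; have t0 : 0 < t.
  by apply: lt_le_trans tT; rewrite ltr_wpDl// !mulr_ge0 ?ltW.
have null0 : (\int[leb6]_z (M < `|f0 z.1 z.2|)%R%:R%:E = 0)%E.
  apply: (@phase_null_global _ Omega) => //; apply: (Linf_norm_ae beta0).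
  by apply: (le_trans f0M); rewrite lee_fin le_max lexx.
have good0 := exceed_transport t mf0 null0.
have good1 := exceed_trajectory mfh null t.
have good2 := ae_slices (mild t (ltW t0)).
have Fae : Filter (nbhs (almost_everywhere (@leb3 R))).
  apply: ae_filter_ringOfSetsType.
apply: filterS (filterI good0 (filterI good1 good2)) => x [g0 [g1 g2]] xc.
pose G := envelope k M fh t x.
have mG : measurable_fun setT G by exact: measurable_envelope.
have G0 p : (0 <= G p)%E by apply: envelope_ge0; exact: ltW.
have msc := measurable_scattered gamma c Cb0 mG G0.
have sc0 v := scattered_ge0 gamma c Cb0 v G0.
pose d v : R := M * expR (- (c / (1 + dot v v) ^+ 2 * t)).
have d0 v : 0 <= d v by rewrite mulr_ge0 ?expR_ge0 ?ltW.
have md : measurable_fun setT (d : R3 R -> measurableTypeR R) by rewrite /d; meas.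
pose B v : \bar R := ((d v)%:E + (2 * M)%:E * scattered gamma Cb c G v)%E.
have twoM : (0 <= (2 * M)%:E)%E by rewrite lee_fin mulr_ge0 ?ltW.
apply: (@density_defect_bound R (f t x) B (3 / 4)).
- have H2 := mft t (ltW t0); exact: (measurableT_comp H2 (pair1_measurable x)).
- by rewrite /B; meas.
- by move=> v; rewrite adde_ge0 ?lee_fin ?mule_ge0.
- have : {ae leb3, forall v, (\int[lebesgue_measure]_s
     (M < `|fh s (x - smul (t - s) v)%R v|)%R%:R%:E = 0)%E}.
    apply: (integral0_ae _ _ g1).
      apply: (@meas_int _ _ _ _ _ _ (fun v s => (M < `|fh s (x - smul (t - s) v)%R v|)%R%:R%:E)).
        by meas; apply: (meas_fh mfh); meas.
      by move=> v s; rewrite lee_fin.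
    by move=> v; apply: integral_ge0 => s _; rewrite lee_fin.
  move=> g3; apply: filterS (filterI g0 (filterI g2 g3)) => v [f0v [mv nv]].
  have vp : phase Omega (x, v) by split.
  exact: (duhamel_bound Cb0 bCb (nuc v) k0 M1 (ltW t0) mfh nv (fun s => @extend0E _ f s) f0v (mv vp)).
have msm := @measurable_sqrt_mu R.
have smv (v : R3 R) : (0 <= (sqrt_mu v)%:E)%E by rewrite lee_fin sqrt_mu_ge0.
rewrite (_ : (\int[leb3]_v _ = \int[leb3]_v (M%:E * (sqrt_mu v * expR (- (c / (1 + dot v v) ^+ 2 * t)))%:E
   + (2 * M)%:E * ((sqrt_mu v)%:E * scattered gamma Cb c G v)))%E); last first.
  apply: eq_integral => v _; rewrite /B ge0_muleDr ?lee_fin ?mule_ge0//.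
  by rewrite -!EFinM /d mulrCA muleCA.
have mde : measurable_fun setT (fun v : R3 R =>
    sqrt_mu v * expR (- (c / (1 + dot v v) ^+ 2 * t)) : measurableTypeR R) by meas.
have de0 v : 0 <= sqrt_mu v * expR (- (c / (1 + dot v v) ^+ 2 * t)).
  by rewrite mulr_ge0 ?sqrt_mu_ge0 ?expR_ge0.
have ME0 : (0 <= M%:E)%E by rewrite lee_fin ltW.
rewrite ge0_integralD; [|exact: measurableT| | | |]; last 4 first.
- by move=> v _; rewrite mule_ge0 ?lee_fin.
- by meas.
- by move=> v _; rewrite mule_ge0 ?mule_ge0.
- by meas.
rewrite ge0_integralZl; [|exact: measurableT|by meas|by move=> v _; rewrite lee_fin|by []].
rewrite ge0_integralZl; [|exact: measurableT|by meas|by move=> v _; rewrite mule_ge0|by []].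
have Hv := H fh mfh perh smallh null t x.
apply: (@le_trans _ _ (M%:E * (D / t)%:E + (2 * M)%:E * (3%:E * (k%:E * L%:E + (M * e)%:E)))%E).
  apply: leeD; first by apply: lee_wpmul2l => //; exact: HD.
  by apply: lee_wpmul2l => //; rewrite -LE; exact: Hv.
rewrite (_ : (_ + _)%E = (M * (D / t) + 2 * M * (3 * (k * L + M * e)))%:E); last first.
  by rewrite (EFinD (M * (D / t))) (EFinM M (D / t)) (EFinM (2 * M)) (EFinM 3) (EFinD (k * L)) (EFinM k).
rewrite lee_fin.
by apply: three_quarter_budget => //; apply: le_trans tT; rewrite lerDl.
Qed.
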